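(* Let $n\ge 2$ and let $A=(a_1,\ldots,a_n)$ be positive integers with $a_1\le\cdots\le a_{n-1}<a_n$. Then the map $\widetilde\pi:\mathrm{G}\cdot[v_A]\to SL_2\cdot[v_A]\simeq\mathbb P^1$ extends to a (locally trivial) bundle $\pi:\mathrm{sh}_A\to\mathbb P^1$ with fiber isomorphic to $\mathrm{sh}_{(a_1,\ldots,a_{n-1})}$. Moreover, for every $x\in\mathbb P^1$ one has $\pi^{-1}(x)=\overline{\widetilde\pi^{-1}(x)}$ (closure in $\mathrm{sh}_A$).
   Context: Fusion products. Let $e,h,f$ be the standard basis of $\mathfrak{sl}_2(\mathbb C)$ and write $x_j=x\otimes t^j$. For positive integers $A=(a_1,\ldots,a_n)$ choose pairwise distinct $z_1,\ldots,z_n\in\mathbb C$, let $\mathbb C^{a}$ be the $a$-dimensional irreducible $\mathfrak{sl}_2$-module, and $\mathbb C^{a_i}(z_i)$ the $\mathfrak{sl}_2\otimes\mathbb C[t]$-module on which $x_j$ acts as $z_i^jx$. Let $\overline{v_A}\in\bigotimes_i\mathbb C^{a_i}(z_i)$ be the tensor product of lowest weight vectors and $F_s$ the span of all $x^{(1)}_{i_1}\cdots x^{(k)}_{i_k}\overline{v_A}$ with $x^{(j)}\in\mathfrak{sl}_2$, $i_1+\cdots+i_k\le s$. The fusion product is the associated graded $\mathfrak{sl}_2\otimes\mathbb C[t]$-module $M^A=\bigoplus_sF_s/F_{s-1}$; $v_A$ is the image of $\overline{v_A}$ and $u_A$ the image of the tensor product of highest weight vectors. Known facts: up to isomorphism $M^A$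 is independent of the $z_i$ and of the order of the $a_i$; $\mathfrak{sl}_2\otimes t^j$ acts by $0$ for $j\ge n$; $M^A=\mathbb C[e_0,\ldots,e_{n-1}]v_A\simeq\mathbb C[e_0,\ldots,e_{n-1}]/I_A$ with $I_A$ generated by $\sum_{i_1+\cdots+i_k=s}e_{n-1-i_1}\cdots e_{n-1-i_k}$ for $k\ge1$, $s<\sum_{j=1}^n\max(k+1-a_j,0)$; $\dim M^A=\prod a_i$. Schubert variety. $\mathrm G=SL_2(\mathbb C[t]/t^n)$ acts on $M^A$ and on $\mathbb P(M^A)$; $[v]$ denotes the line $\mathbb Cv$. $\mathrm{sh}_A=\overline{\mathrm G\cdot[v_A]}\subset\mathbb P(M^A)$ (and $\mathrm{sh}_{(a_1,\ldots,a_{n-1})}$ is defined in the same way with $n-1$ in place of $n$). The map $\widetilde\pi$. One has $\mathrm G\cdot[v_A]=\{\exp(\sum_{i=0}^{n-1}p_ie_i)[v_A]\}\sqcup\{\exp(\sum_{i=1}^{n-1}q_if_i)[u_A]\}$ ($p_i,q_i\in\mathbb C$), and $\widetilde\pi$ is the $SL_2$-equivariant map $\exp(\sum_{i=0}^{n-1}p_ie_i)[v_A]\mapsto\exp(p_0e_0)[v_A]$, $\exp(\sum_{i=1}^{n-1}q_if_i)[u_A]\mapsto[u_A]$. *)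

(* Defs.v *)
From HB Require Import structures.
From mathcomp Require Import all_boot all_order all_algebra qpoly.
From mathcomp Require Import reals complex mpoly.

Set Implicit Arguments.
Unset Strict Implicit.
Unset Printing Implicit Defensive.

Import GRing.Theory.
Local Open Scope ring_scope.

(** * Projective varieties

A point of P(V) is a line of V, i.e. a one-dimensional [{vspace V}]; subsets of
P(V) are predicates on [{vspace V}], and maps between subsets of projective
spaces are functions on [{vspace V}] whose values outside of the source are
irrelevant. *)

Section Projective.
Context {K : fieldType}.

Definition pset (V : vectType K) := {vspace V} -> Prop.

Definition proj (V : vectType K) : pset V := fun L => \dim L = 1%N.

Definition mpeval (V : vectType K) (p : {mpoly K[\dim {:V}]}) (v : V) : K :=
  p.@[fun i => coord (vbasis {:V}) i v].

(* Polynomial functions on V, homogeneous of degree d. *)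
Definition homfun (V : vectType K) (d : nat) (h : V -> K) : Prop :=
  exists2 p : {mpoly K[\dim {:V}]}, p \is d.-homog & forall v, h v = mpeval p v.

(* Polynomial functions on V1 x V2, homogeneous of bidegree (d1, d2): the
   finite sums of products of homogeneous polynomials on the two factors. *)
Definition bihomfun (V1 V2 : vectType K) (d1 d2 : nat) (h : V1 -> V2 -> K) :
    Prop :=
  exists (r : nat) (p : 'I_r -> {mpoly K[\dim {:V1}]})
         (q : 'I_r -> {mpoly K[\dim {:V2}]}),
    [/\ forall k, p k \is d1.-homog, forall k, q k \is d2.-homog
      & forall v1 v2, h v1 v2 = \sum_k mpeval (p k) v1 * mpeval (q k) v2].

Definition hommap (V W : vectType K) (d : nat) (Phi : V -> W) : Prop :=
  forall i, homfun d (fun v => coord (vbasis {:W}) i (Phi v)).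

Definition bihommap (V1 V2 W : vectType K) (d1 d2 : nat)
    (Phi : V1 -> V2 -> W) : Prop :=
  forall i, bihomfun d1 d2 (fun v1 v2 => coord (vbasis {:W}) i (Phi v1 v2)).

Definition nonvan (V : vectType K) (h : V -> K) : pset V :=
  fun L => exists2 v, v \in L & h v != 0.

Definition nonvan2 (V1 V2 : vectType K) (h : V1 -> V2 -> K)
    (L1 : {vspace V1}) (L2 : {vspace V2}) : Prop :=
  exists v1 v2, [/\ v1 \in L1, v2 \in L2 & h v1 v2 != 0].

Definition zopen (V : vectType K) (U : pset V) : Prop :=
  forall L, proj L -> U L ->
  exists d h, [/\ homfun d h, nonvan h L
                & forall L', proj L' -> nonvan h L' -> U L'].

(* The Zariski topology of P(V1) x P(V2), finer than the product topology. *)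
Definition zopen2 (V1 V2 : vectType K)
    (U : {vspace V1} -> {vspace V2} -> Prop) : Prop :=
  forall L1 L2, proj L1 -> proj L2 -> U L1 L2 ->
  exists d1 d2 h, [/\ bihomfun d1 d2 h, nonvan2 h L1 L2
    & forall L1' L2', proj L1' -> proj L2' -> nonvan2 h L1' L2' -> U L1' L2'].

Definition zclosure (V : vectType K) (S : pset V) : pset V := fun L =>
  proj L /\
  forall d h, homfun d h ->
    (forall L' v, S L' -> v \in L' -> h v = 0) ->
    forall v, v \in L -> h v = 0.

Definition regular (V W : vectType K) (X : pset V)
    (phi : {vspace V} -> {vspace W}) : Prop :=
  forall L, X L ->
  exists (U : pset V) (d : nat) (Phi : V -> W),
    [/\ zopen U, U L, hommap d Phi
      & forall L' v, X L' -> U L' -> v \in L' -> v != 0 ->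
          Phi v != 0 /\ phi L' = <[Phi v]>%VS].

Definition regular2 (V1 V2 W : vectType K) (X : pset V1) (Y : pset V2)
    (phi : {vspace V1} -> {vspace V2} -> {vspace W}) : Prop :=
  forall L1 L2, X L1 -> Y L2 ->
  exists U (d1 d2 : nat) (Phi : V1 -> V2 -> W),
    [/\ zopen2 U, U L1 L2, bihommap d1 d2 Phi
      & forall L1' L2' v1 v2, X L1' -> Y L2' -> U L1' L2' ->
          v1 \in L1' -> v1 != 0 -> v2 \in L2' -> v2 != 0 ->
          Phi v1 v2 != 0 /\ phi L1' L2' = <[Phi v1 v2]>%VS].

Definition isomorphism (V W : vectType K) (X : pset V) (Y : pset W)
    (phi : {vspace V} -> {vspace W}) : Prop :=
  exists psi : {vspace W} -> {vspace V},
    [/\ regular X phi, regular Y psi,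
        forall L, X L -> Y (phi L) /\ psi (phi L) = L
      & forall L, Y L -> X (psi L) /\ phi (psi L) = L].

(* Zariski locally trivial bundle pi : X -> Y with fiber F: over an open
   neighbourhood U of each point of Y, the pair (pi, phi) is an isomorphism from
   pi^-1(U) onto U x F, with inverse psi. *)
Definition locally_trivial_bundle (V W N : vectType K)
    (X : pset V) (Y : pset W) (F : pset N)
    (pi : {vspace V} -> {vspace W}) : Prop :=
  [/\ regular X pi, forall L, X L -> Y (pi L)
    & forall y, Y y ->
      exists U : pset W, [/\ zopen U, U y
        & let YU := fun y' => Y y' /\ U y' in
          let XU := fun L => X L /\ U (pi L) in
          exists (phi : {vspace V} -> {vspace N})
                 (psi : {vspace W} -> {vspace N} -> {vspace V}),
          [/\ regular XU phi, regular2 YU F psi,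
              forall L, XU L -> F (phi L) /\ psi (pi L) (phi L) = L
            & forall y' l, YU y' -> F l ->
              [/\ XU (psi y' l), pi (psi y' l) = y' & phi (psi y' l) = l]]]].

End Projective.

(** * Fusion products

Elements of sl_2 are the traceless 2 x 2 matrices, with e = E_01, f = E_10,
h = E_00 - E_11. *)

Section Fusion.
Context {K : fieldType}.

Definition sl2_e : 'M[K]_2 := delta_mx ord0 ord_max.
Definition sl2_f : 'M[K]_2 := delta_mx ord_max ord0.

(* The a-dimensional irreducible module, with basis w_0, ..., w_(a-1):
     e w_k = w_(k+1),  f w_k = k (a - k) w_(k-1),  h w_k = (2k + 1 - a) w_k.
   [irr_coef a x k l] is the coefficient of w_l in x w_k. *)
Definition irr_coef (a : nat) (x : 'M[K]_2) (k l : 'I_a) : K :=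
  x ord0 ord_max *+ (l == k.+1 :> nat)
  + (x ord_max ord0 * (k * (a - k))%:R) *+ (k == l.+1 :> nat)
  + (x ord0 ord0 * (k.*2.+1%:R - a%:R)) *+ (k == l).

Section Tensor.
Variables (n : nat) (a : 'I_n -> nat) (z : 'I_n -> K).

Definition tindex : finType := {dffun forall i : 'I_n, 'I_(a i)}.

(* The tensor product of the C^(a_i): a vector is its family of coordinates in
   the basis of the tensors of the w_k. *)
Definition tens : vectType K := {ffun tindex -> K^o}.

Definition tsubst (J : tindex) (i : 'I_n) (k : 'I_(a i)) : tindex :=
  [ffun j => dfwith J k j].

(* The action of x (x) t^j, namely sum_i z_i^j x^(i) where x^(i) is x acting on
   the i-th tensor factor. *)
Definition tens_act (x : 'M[K]_2) (j : nat) (u : tens) : tens :=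
  [ffun J : tindex => \sum_(i < n) z i ^+ j *
     \sum_(k < a i) irr_coef x k (J i) * u (tsubst J k)].

Definition low_tens : tens :=
  [ffun J : tindex => [forall i, J i == 0 :> nat]%:R].

Definition high_tens : tens :=
  [ffun J : tindex => [forall i, (J i).+1 == a i]%:R].

Definition word_act (w : seq ('M[K]_2 * nat)) : tens :=
  foldr (fun xi u => tens_act xi.1 xi.2 u) low_tens w.

Definition admissible_word (s : nat) (w : seq ('M[K]_2 * nat)) : bool :=
  all (fun xi => \tr xi.1 == 0) w && (sumn (map snd w) <= s)%N.

(* u belongs to the linear subspace F_s. *)
Definition filt (s : nat) (u : tens) : Prop :=
  exists (r : nat) (c : 'I_r -> K) (w : 'I_r -> seq ('M[K]_2 * nat)),
    (forall k, admissible_word s (w k)) /\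
    u = \sum_k c k *: word_act (w k).

(* u belongs to F_(s-1), with F_(-1) = 0. *)
Definition filt_lt (s : nat) (u : tens) : Prop :=
  if s is s'.+1 then filt s' u else u = 0.

(* The associated graded module of the filtration F: a space M that is the
   direct sum of copies of the F_s / F_(s-1), the quotient map of F_s onto the
   s-th summand being the restriction of [symb s] to F_s, with the induced
   action of sl_2 (x) C[t].  These data determine M up to a unique
   isomorphism; see [fusion_product_exists] below for their existence. *)
Record fusion_product := FusionProduct {
  fp_space :> vectType K;
  symb : nat -> 'Hom(tens, fp_space);
  fp_act : 'M[K]_2 -> nat -> 'End(fp_space);
  symb_ker : forall s u, filt s u -> (symb s u = 0 <-> filt_lt s u);
  symb_span : forall m : fp_space, exists (d : nat) (u : nat -> tens),
    (forall s, filt s (u s)) /\ m = \sum_(s < d) symb s (u s);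
  symb_direct : forall (d : nat) (u : nat -> tens),
    (forall s, filt s (u s)) -> \sum_(s < d) symb s (u s) = 0 ->
    forall s, (s < d)%N -> symb s (u s) = 0;
  fp_actE : forall (x : 'M[K]_2) (j s : nat) (u : tens),
    \tr x = 0 -> filt s u ->
    fp_act x j (symb s u) = symb (s + j) (tens_act x j u)
}.

End Tensor.

(* The exponential series, which stops before k = dim M + 1 when T is nilpotent;
   it is only applied to nilpotent endomorphisms. *)
Definition exp_nil (M : vectType K) (T : 'End(M)) (m : M) : M :=
  \sum_(k < (\dim {:M}).+1) (k`!%:R)^-1 *: iter k T m.

Section Orbits.
Variables (n : nat) (a : 'I_n -> nat) (z : 'I_n -> K).
Variable M : fusion_product a z.

Definition v_low : M := symb M 0 (low_tens a).
Definition u_high : M := symb M 0 (high_tens a).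

Definition exp_e (p : nat -> K) : M -> M :=
  exp_nil (\sum_(0 <= i < n) p i *: fp_act M sl2_e i).
Definition exp_f (p : nat -> K) : M -> M :=
  exp_nil (\sum_(0 <= i < n) p i *: fp_act M sl2_f i).

(* C[t]/(t^n). *)
Definition trunc_poly := {poly %/ ('X^n : {poly K})}.

Definition trunc_coef (p : trunc_poly) (i : nat) : K := (p : {poly K})`_i.

(* The graph of the action of SL_2(C[t]/(t^n)) on M obtained by integrating the
   action of sl_2 (x) C[t]/(t^n): over the local ring C[t]/(t^n) every matrix of
   determinant 1 is a product of elementary matrices 1 + p e and 1 + p f, and
   these act by exp(sum_i p_i e_i) and exp(sum_i p_i f_i). *)
Inductive SL2_act : 'M[trunc_poly]_2 -> (M -> M) -> Prop :=
| SL2_act1 : SL2_act 1%:M id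
| SL2_actE p g T : SL2_act g T ->
    SL2_act ((1%:M + p *: delta_mx ord0 ord_max) *m g)
            (exp_e (trunc_coef p) \o T)
| SL2_actF p g T : SL2_act g T ->
    SL2_act ((1%:M + p *: delta_mx ord_max ord0) *m g)
            (exp_f (trunc_coef p) \o T).

Definition G_orbit : pset M := fun L =>
  exists (g : 'M[trunc_poly]_2) (T : M -> M),
    [/\ \det g = 1, SL2_act g T & L = <[T v_low]>%VS].

(* SL_2 . [v_A], with SL_2 = SL_2(C) embedded in G as the constant matrices. *)
Definition SL2_orbit : pset M := fun L =>
  exists (g : 'M[K]_2) (T : M -> M),
    [/\ \det g = 1, SL2_act (map_mx (fun c => in_qpoly 'X^n c%:P) g) T
      & L = <[T v_low]>%VS].

Definition sh : pset M := zclosure G_orbit.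

(* The graph of the map G . [v_A] -> SL_2 . [v_A]; its two constructors are the
   two cells of G . [v_A]. *)
Inductive pi_tilde : {vspace M} -> {vspace M} -> Prop :=
| pi_tilde_e (p : nat -> K) :
    pi_tilde <[exp_e p v_low]>
             <[exp_nil (p 0%N *: fp_act M sl2_e 0) v_low]>
| pi_tilde_f (q : nat -> K) : q 0%N = 0 ->
    pi_tilde <[exp_f q u_high]> <[u_high]>.

End Orbits.

End Fusion.

Arguments G_orbit {K n a z} M _.
Arguments SL2_orbit {K n a z} M _.
Arguments sh {K n a z} M _.
Arguments pi_tilde {K n a z} M _ _.

Section GradedExistence.
Context {K : fieldType}.

Lemma vspace_of_pred (V : vectType K) (P : V -> Prop) :
  P 0 -> (forall c u v, P u -> P v -> P (c *: u + v)) ->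
  exists U : {vspace V}, forall v, v \in U <-> P v.
Proof.
move=> P0 Plin.
have H k : (exists U : {vspace V}, forall v, v \in U <-> P v) \/
    (exists2 U : {vspace V}, (forall v, v \in U -> P v) & (k <= \dim U)%N).
  elim: k => [|k [|[U UP kU]]]; last 2 first.
  - by left.
  - case: (boolp.EM (exists2 v, P v & v \notin U)) => [[v Pv vU]|nv].
      right; exists (<[v]> + U)%VS.
        move=> w /memv_addP[w1 /vlineP[c ->] [w2 w2U ->]].
        by apply: Plin => //; apply: UP.
      rewrite dimv_disjoint_sum; last first.
        apply/eqP; rewrite -subv0; apply/subvP => w.
        rewrite memv_cap memv0 => /andP[/vlineP[c ->] cvU].
        have [->|c0] := eqVneq c 0; first by rewrite scale0r.
        by move: cvU; rewrite rpredZeq (negPf c0) (negPf vU).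
      rewrite dim_vline; have -> : v != 0 by apply: contraNneq vU => ->; rewrite mem0v.
      by rewrite add1n ltnS.
    left; exists U => v; split; first exact: UP.
    by move=> Pv; case: (boolP (v \in U)) => // vU; case: nv; exists v.
  right; exists 0%VS => // v; rewrite memv0 => /eqP->; exact: P0.
case: (H (\dim {:V}).+1) => // -[U _].
by rewrite ltnNge dimvS ?subvf.
Qed.

Variables (V : vectType K) (F : nat -> {vspace V}).
Hypothesis F_le : forall s, (F s <= F s.+1)%VS.

Lemma filtration_le s t : (s <= t)%N -> (F s <= F t)%VS.
Proof.
move=> /subnK <-; elim: (t - s)%N => [|k IH]; first exact: subvv.
by rewrite addSn; apply: subv_trans IH _.
Qed.

Lemma filtration_stable : exists D, forall s, (D <= s)%N -> F s = F D.
Proof.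
have H k : (exists D, forall s, (D <= s)%N -> F s = F D) \/
    (exists s, (k <= \dim (F s))%N).
  elim: k => [|k [|[D kD]]]; [by right; exists 0 | by left|].
  case: (boolp.EM (exists2 s, (D <= s)%N & F s <> F D)) => [[s Ds FsD]|nF].
    right; exists s; apply: leq_ltn_trans kD _; rewrite ltnNge.
    apply/negP => dim_le; apply: FsD; apply/esym/eqP.
    by rewrite eqEdim filtration_le.
  left; exists D => s Ds; case: (eqVneq (F s) (F D)) => // FsD.
  by case: nF; exists s => //; apply/eqP.
case: (H (\dim {:V}).+1) => // -[s].
by rewrite ltnNge dimvS ?subvf.
Qed.

Definition Fpred s : {vspace V} := if s is s'.+1 then F s' else 0%VS.

Definition lay s : 'End(V) := addv_pi1 (F s) (Fpred s).

Lemma Fpred_le s : (Fpred s <= F s)%VS.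
Proof. by case: s => [|s] /=; [exact: sub0v | exact: F_le]. Qed.

Lemma lay_diff s v : lay s v \in (F s :\: Fpred s)%VS.
Proof. by rewrite /lay /addv_pi1; apply: memv_pi. Qed.

Lemma lay_in s v : lay s v \in F s.
Proof. by rewrite /lay; apply: memv_pi1. Qed.

Lemma lay_in_le s t v : (s <= t)%N -> lay s v \in F t.
Proof. by move=> /filtration_le/subvP; apply; apply: lay_in. Qed.

Lemma lay_sub s v : v \in F s -> v - lay s v \in Fpred s.
Proof.
move=> vF; have vFF : v \in (F s + Fpred s)%VS.
  exact: subvP (addvSl _ _) _ vF.
rewrite -{1}(addv_pi1_pi2 vFF) [X in X - _]addrC addrK; exact: memv_pi2.
Qed.

Lemma lay_ker s v : v \in F s -> (lay s v == 0) = (v \in Fpred s).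
Proof.
move=> vF; apply/eqP/idP => [l0|vP].
  by have := lay_sub vF; rewrite l0 subr0.
have lP : lay s v \in Fpred s.
  rewrite -[lay s v](subrK v) -opprB -[X in X + _]scaleN1r.
  by rewrite rpredD // rpredZ // lay_sub.
have : lay s v \in ((F s :\: Fpred s) :&: Fpred s)%VS.
  by rewrite memv_cap lP lay_diff.
by rewrite capv_diff memv0 => /eqP.
Qed.

Lemma lay_lay s v : lay s (lay s v) = lay s v.
Proof. exact: addv_pi1_proj. Qed.

Variable D : nat.
Hypothesis F_D : forall s, (D <= s)%N -> F s = F D.

Lemma F_sub_D s : (F s <= F D)%VS.
Proof.
by case: (leqP s D) => [/filtration_le //|/ltnW/F_D ->].
Qed.

Lemma lay_big s v : (D < s)%N -> v \in F s -> lay s v = 0.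
Proof.
case: s => // s Ds vF; apply/eqP; rewrite lay_ker //=.
by rewrite (F_D (s := s)) // -(F_D (s := s.+1)) // ltnW.
Qed.

Definition gr_space : vectType K := subvs_of (F D).
Definition gr_symb s : 'Hom(V, gr_space) := (linfun (vsproj (F D)) \o lay s)%VF.

Lemma gr_symbE s v : vsval (gr_symb s v) = lay s v.
Proof.
rewrite comp_lfunE lfunE /= vsprojK //.
exact: subvP (F_sub_D s) _ (lay_in _ _).
Qed.

Lemma gr_symb_ker s v : v \in F s -> (gr_symb s v == 0) = (v \in Fpred s).
Proof.
move=> vF; rewrite -lay_ker // -gr_symbE.
by apply/eqP/eqP => [->|h]; [rewrite linear0 | apply: val_inj; rewrite /= h].
Qed.

Lemma lay_span s v : v \in F s ->
  exists2 u : nat -> V, (forall k, u k \in F k)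
    & v = \sum_(k < s.+1) lay k (u k).
Proof.
elim: s v => [|s IH] v vF.
  exists (fun k => if k == 0%N then v else 0) => [[|k] //|]; first exact: mem0v.
  rewrite big_ord1 /=; apply/eqP; rewrite -subr_eq0 -memv0.
  exact: lay_sub vF.
have [u uF uE] := IH _ (lay_sub vF).
exists (fun k => if k == s.+1 then v else u k) => [k|].
  by case: eqP => [->|_].
rewrite big_ord_recr /= eqxx -[LHS](subrK (lay s.+1 v)); congr (_ + _).
rewrite uE; apply: eq_bigr => k _; rewrite ifN //.
by rewrite neq_ltn (ltn_ord k).
Qed.

Lemma lay_direct d (u : nat -> V) : (forall s, u s \in F s) ->
  \sum_(s < d) lay s (u s) = 0 -> forall s, (s < d)%N -> lay s (u s) = 0.
Proof.
move=> uF; elim: d => [|d IH] // sum0.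
have l0 : lay d (u d) = 0.
  rewrite -lay_lay; apply/eqP; rewrite lay_ker ?lay_in //.
  move: sum0; rewrite big_ord_recr /= => /eqP; rewrite addrC addr_eq0 => /eqP->.
  rewrite rpredN; apply: rpred_sum => k _.
  case: d k {IH} => [[]//|d] k /=.
  by apply: lay_in_le; rewrite -ltnS.
move=> s; rewrite ltnS leq_eqVlt => /orP[/eqP->//|]; apply: IH.
by move: sum0; rewrite big_ord_recr /= l0 addr0.
Qed.

Variables (j : nat) (X : 'End(V)).
Hypothesis XF : forall s v, v \in F s -> X v \in F (s + j).

Fixpoint gr_act_rec k : 'Hom(V, gr_space) :=
  if k is k'.+1 then
    (gr_symb (k + j) \o X \o lay k)%VF + (gr_act_rec k' \o (\1%VF - lay k))%VF
  else (gr_symb j \o X \o lay 0)%VF.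

Definition gr_act : 'End(gr_space) := (gr_act_rec D \o linfun vsval)%VF.

Lemma gr_act_recE k s v : (s <= k)%N ->
  gr_act_rec k (lay s v) = gr_symb (s + j) (X (lay s v)).
Proof.
elim: k => [|k IH]; first by rewrite leqn0 => /eqP-> /=; rewrite !comp_lfunE lay_lay.
rewrite leq_eqVlt => /orP[/eqP->|sk] /=.
  rewrite add_lfunE !comp_lfunE add_lfunE opp_lfunE id_lfunE lay_lay subrr.
  by rewrite linear0 addr0.
rewrite add_lfunE !comp_lfunE add_lfunE opp_lfunE id_lfunE.
have -> : lay k.+1 (lay s v) = 0.
  have lF : lay s v \in F k by apply: lay_in_le.
  by apply/eqP; rewrite lay_ker //; apply: (subvP (F_le _)).
by rewrite subr0 !linear0 add0r IH // comp_lfunE.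
Qed.

Lemma gr_actE s v : v \in F s ->
  gr_act (gr_symb s v) = gr_symb (s + j) (X v).
Proof.
move=> vF; rewrite comp_lfunE lfunE /= gr_symbE.
have XP : X v - X (lay s v) \in Fpred (s + j).
  rewrite -linearB /=; case: s vF => [|s] vF.
    have := lay_sub vF; rewrite /= memv0 => /eqP->.
    by rewrite linear0 mem0v.
  exact: XF (lay_sub vF).
have -> : gr_symb (s + j) (X v) = gr_symb (s + j) (X (lay s v)).
  apply/eqP; rewrite -subr_eq0 -linearB /= gr_symb_ker //.
  by apply: (subvP (Fpred_le _)).
case: (leqP s D) => [|Ds]; first exact: gr_act_recE.
by rewrite lay_big // !linear0.
Qed.

End GradedExistence.

Section FusionExistence.
Context {K : fieldType}.
Variables (n : nat) (a : 'I_n -> nat) (z : 'I_n -> K).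

Lemma tens_act_linear x j : linear (tens_act (a := a) z x j).
Proof.
move=> c u v; apply/ffunP => J; rewrite !ffunE /GRing.scale /= mulr_sumr -big_split.
apply: eq_bigr => i _ /=; rewrite mulrCA -mulrDr; congr (_ * _).
rewrite mulr_sumr -big_split; apply: eq_bigr => k _ /=.
by rewrite !ffunE mulrDr [c * (_ * _)]mulrCA.
Qed.

HB.instance Definition _ x j :=
  GRing.isLinear.Build K (tens (K := K) a) (tens (K := K) a) _
    (tens_act (a := a) z x j) (tens_act_linear x j).

Lemma filt0 s : filt (a := a) z s 0.
Proof.
by exists 0, (fun=> 0), (fun=> [::]); split=> [[]|] //; rewrite big_ord0.
Qed.

Lemma filt_lin s c u v : filt (a := a) z s u -> filt z s v -> filt z s (c *: u + v).
Proof.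
move=> [r1 [c1 [w1 [h1 ->]]]] [r2 [c2 [w2 [h2 ->]]]].
exists (r1 + r2)%N,
  (fun k => match split k with inl k1 => c * c1 k1 | inr k2 => c2 k2 end),
  (fun k => match split k with inl k1 => w1 k1 | inr k2 => w2 k2 end).
split=> [k|]; first by case: (split k).
rewrite big_split_ord scaler_sumr /=; congr (_ + _); apply: eq_bigr => k _.
  by rewrite -[lshift _ _]/(unsplit (inl k)) unsplitK scalerA.
by rewrite -[rshift _ _]/(unsplit (inr k)) unsplitK.
Qed.

Lemma filtS s u : filt (a := a) z s u -> filt z s.+1 u.
Proof.
move=> [r [c [w [h ->]]]]; exists r, c, w; split=> // k.
by have /andP[h1 h2] := h k; rewrite /admissible_word h1 leqW.
Qed.

Lemma filt_act x j s u : \tr x = 0 -> filt (a := a) z s u ->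
  filt z (s + j) (tens_act z x j u).
Proof.
move=> x0 [r [c [w [h ->]]]]; exists r, c, (fun k => (x, j) :: w k); split=> [k|].
  have /andP[h1 h2] := h k.
  by rewrite /admissible_word /= x0 eqxx h1 addnC leq_add2r.
rewrite (linear_sum (tens_act z x j)) /=; apply: eq_bigr => k _.
exact: (linearZZ (tens_act z x j)).
Qed.

Lemma fusion_product_exists : inhabited (fusion_product a z).
Proof.
have [F FP] : exists F : nat -> {vspace tens a}, forall s u, u \in F s <-> filt z s u.
  have H s : exists U : {vspace tens a}, forall u, u \in U <-> filt z s u.
    by apply: vspace_of_pred; [exact: filt0 | exact: filt_lin].
  by have [F FP] := boolp.choice H; exists F.
have F_le s : (F s <= F s.+1)%VS by apply/subvP => u /FP/filtS/FP.
have [D F_D] := filtration_stable F_le.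
have XF x j : \tr x = 0 -> forall s v, v \in F s ->
    linfun (tens_act (a := a) z x j) v \in F (s + j).
  by move=> x0 s v /FP vF; rewrite lfunE; apply/FP/filt_act.
have FpredP s u : u \in Fpred F s <-> filt_lt z s u.
  by case: s => [|s] /=; [rewrite memv0; split=> /eqP | exact: FP].
apply: inhabits; exists (gr_space F D) (gr_symb F D)
  (fun x j => gr_act F D j (linfun (tens_act (a := a) z x j))).
- move=> s u /FP uF; rewrite -FpredP -(gr_symb_ker F_le F_D uF).
  by split=> /eqP.
- move=> m; have [u uF uE] := lay_span (subvsP m).
  exists D.+1, u; split=> [s|]; first exact/FP.
  apply: val_inj; rewrite /= linear_sum /= uE; apply: eq_bigr => k _.
  by rewrite (gr_symbE F_le F_D).
- move=> d u uF sum0 s sd.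
  have {}uF t : u t \in F t by apply/FP.
  apply: val_inj; rewrite /= (gr_symbE F_le F_D).
  apply: (lay_direct F_le uF _ sd).
  have := congr1 vsval sum0; rewrite linear_sum linear0 => sumE.
  apply: etrans sumE; apply: eq_bigr => k _ /=.
  by rewrite (gr_symbE F_le F_D).
- move=> x j s u x0 /FP uF.
  rewrite (gr_actE F_le F_D (XF x j x0) uF).
  by congr (gr_symb F D _ _); rewrite lfunE.
Qed.

End FusionExistence.

(* Main.v *)
(* The open cell of the orbit consists of the lines of E(P) = exp(sum_i P_i e_i) v_A,
   for P a polynomial.  A linear relation between vectors E(P_1), ..., E(P_r)
   holds in M^A if and only if it holds for every product, over k, of Toeplitz
   minors det(P_(j_b - c)) with j_b < #{i | a_i > k + 1}: such a product is the
   lowest order term, along the curves t |-> (t^j P_j), of a linear form on the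
   tensor product, and the minors are numerous enough because
   dim M^A <= a_1 ... a_n.  Let A^- be A with a_n decremented, and A' be A without
   a_n.  Comparing the minors attached to A, A^- and A' when a_n is the strict
   maximum gives linear maps al0, al1 : M^A -> M^(A^-), which send E(P) to E(P) and
   to P_0 E(P) and have no common kernel, and an embedding
   theta : M^(A') -> M^A, which sends E(Q) to E(t Q).  On the cone over sh_A, al0 x
   and al1 x are proportional, and pi is their ratio; exp(-c e_0) moves the fiber
   over [1 : c] into the image of theta and identifies it with sh_(A').  This is
   polynomial in c, hence trivializes pi away from infinity, and a Weyl group
   element of SL_2 carries the trivialization to the other chart. *)

Require Import Defs.
From HB Require Import structures.
From mathcomp Require Import all_boot all_order all_algebra qpoly.
From mathcomp Require Import reals complex mpoly perm zify ring.

Set Implicit Arguments.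
Unset Strict Implicit.
Unset Printing Implicit Defensive.

Import GRing.Theory Num.Theory.
Local Open Scope ring_scope.

(** A fusion product is given here only as an associated graded space. A linear map between two of
    them is therefore prescribed on the spanning vectors E(P), and what must be checked is that
    linear relations are respected; hence the need for a criterion for relations that depends on A
    alone. It comes from counting: there are a_1 ... a_n independent products of minors, and each of
    them extends to a linear form on M^A. The strict maximality of a_n enters at k = a_n - 2: only
    a_n exceeds k + 1, so the Toeplitz matrix attached to this k has size one and contributes a
    factor 1, P_0 or 0, while for A^- it has size zero. This is the origin of al0 and al1. The
    closure sh_A is never described by equations. A vector lies on its cone when every homogeneous
    form that vanishes on all E(P) vanishes at it, and vectors are moved between cones along
    homogeneous polynomial maps. To be such a map, the translation exp(-c e_0), with c a ratio of
    linear forms, is multiplied by a power of its denominator. *)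

Section Homfun.
Context {K : fieldType}.
Implicit Types V W : vectType K.

(** * Homogeneous polynomial functions and affine cones over closures *)

Lemma homfun_ext V d (h h' : V -> K) : h =1 h' -> homfun d h -> homfun d h'.
Proof. by move=> hh [p pd pE]; exists p => // v; rewrite -hh. Qed.

Lemma homfun_cst V (c : K) : homfun 0 (fun _ : V => c).
Proof.
exists (c *: 1) => [|v]; last by rewrite /mpeval mevalZ meval1 mulr1.
by rewrite dhomogZ ?dhomog1.
Qed.

Lemma homfun_linear V (f : {linear V -> K^o}) : homfun 1 f.
Proof.
exists (\sum_(i < \dim {:V}) f (vbasis {:V})`_i *: 'X_i) => [|v].
  by apply: rpred_sum => i _; apply: rpredZ; rewrite dhomogX /= mdeg1.
rewrite {1}(coord_vbasis (memvf v)) linear_sum /mpeval raddf_sum /=.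
apply: eq_bigr => i _.
by rewrite linearZ /= mevalZ mevalXU mulrC.
Qed.

Lemma homfunM V d1 d2 (h1 h2 : V -> K) :
  homfun d1 h1 -> homfun d2 h2 -> homfun (d1 + d2) (fun v => h1 v * h2 v).
Proof.
move=> [p pd pE] [q qd qE]; exists (p * q); first exact: dhomogM.
by move=> v; rewrite pE qE /mpeval mevalM.
Qed.

Lemma homfun_exp V d (h : V -> K) k :
  homfun d h -> homfun (k * d) (fun v => h v ^+ k).
Proof.
move=> hd; elim: k => [|k IH]; first exact: homfun_cst.
have := homfunM hd IH.
by apply: homfun_ext => v; rewrite exprS.
Qed.

Lemma homfun_form V d k (f g : V -> K) : (k <= d)%N -> homfun 1 f -> homfun 1 g ->
  homfun d (fun v => f v ^+ k * g v ^+ (d - k)).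
Proof.
move=> kd hf hg; have dE : (k * 1 + (d - k) * 1)%N = d by rewrite !muln1 subnKC.
by rewrite -[X in homfun X]dE; apply: homfunM; apply: homfun_exp.
Qed.

Lemma homfun_sum V d I (r : seq I) (P : pred I) (h : I -> V -> K) :
  (forall i, P i -> homfun d (h i)) -> homfun d (fun v => \sum_(i <- r | P i) h i v).
Proof.
move=> hd; elim: r => [|i r [p pd pE]].
  by exists 0 => [|v]; [exact: rpred0 | rewrite big_nil /mpeval meval0].
case Pi: (P i); last by exists p => // v; rewrite big_cons Pi.
have [q qd qE] := hd i Pi; exists (q + p); first exact: rpredD.
by move=> v; rewrite big_cons Pi pE qE /mpeval mevalD.
Qed.

Lemma homfun_prod V I (r : seq I) (d : I -> nat) (h : I -> V -> K) :
  (forall i, homfun (d i) (h i)) ->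
  homfun (\sum_(i <- r) d i) (fun v => \prod_(i <- r) h i v).
Proof.
move=> hd; elim: r => [|i r IH].
  by rewrite big_nil; apply: homfun_ext (homfun_cst V 1) => v; rewrite big_nil.
rewrite big_cons; apply: homfun_ext (homfunM (hd i) IH) => v.
by rewrite big_cons.
Qed.

Lemma homfunZ V d (h : V -> K) c : homfun d h -> homfun d (fun v => c * h v).
Proof. by move=> hd; have := homfunM (homfun_cst V c) hd. Qed.

Lemma homfunD V d (h h' : V -> K) :
  homfun d h -> homfun d h' -> homfun d (fun v => h v + h' v).
Proof.
move=> [p pd pE] [q qd qE]; exists (p + q); first exact: rpredD.
by move=> v; rewrite pE qE /mpeval mevalD.
Qed.

Lemma homfun_scale V d (h : V -> K) c v :
  homfun d h -> h (c *: v) = c ^+ d * h v.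
Proof.
move=> [p /dhomogP pd pE]; rewrite !pE /mpeval !mevalE mulr_sumr.
apply: eq_big_seq => m /pd /= md.
rewrite mulrCA; congr (_ * _); rewrite -md /= mdegE -prodrXr -big_split.
by apply: eq_bigr => i _; rewrite linearZ /= exprMn.
Qed.


Lemma homfun_comp V W d e (h : W -> K) (Phi : V -> W) :
  homfun e h -> hommap d Phi -> homfun (e * d) (fun v => h (Phi v)).
Proof.
move=> [p /dhomogP pe pE] Phid.
have aux (m : 'X_{1.. \dim {:W}}) : mdeg m = e ->
    homfun (e * d) (fun v => \prod_i coord (vbasis {:W}) i (Phi v) ^+ m i).
  move=> <-; rewrite mdegE big_distrl /=.
  by apply: homfun_prod => i; apply: homfun_exp; apply: Phid.
(* [homfun_sum] asks for homogeneity of every summand, while only the monomials of the support are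
   known to have degree [e]; the others are replaced by 0. *)
pose F m v := if mdeg m == e then
  p@_m * \prod_i coord (vbasis {:W}) i (Phi v) ^+ m i else 0.
have FH : homfun (e * d) (fun v => \sum_(m <- msupp p) F m v).
  apply: homfun_sum => m _; rewrite /F; case: eqP => [/aux|_].
    exact: homfunZ.
  by exists 0 => [|v]; [exact: rpred0 | rewrite /mpeval meval0].
apply: homfun_ext FH => v; rewrite pE /mpeval mevalE.
by apply: eq_big_seq => m /pe /= me; rewrite /F me eqxx.
Qed.

Lemma hommap_dual V W d (Phi : V -> W) :
  (forall f : {linear W -> K^o}, homfun d (fun v => f (Phi v))) -> hommap d Phi.
Proof. by move=> H i; apply: (H (coord (vbasis {:W}) i)). Qed.

Lemma hommap_linear V W (f : {linear V -> W}) : hommap 1 f.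
Proof.
move=> i.
exact: (homfun_linear [the {linear V -> K^o} of coord (vbasis {:W}) i \o f]).
Qed.

Lemma hommap_lfun V W (f : 'Hom(V, W)) : hommap 1 f.
Proof. exact: hommap_linear. Qed.

Lemma hommap_ext V W d (f g : V -> W) : f =1 g -> hommap d f -> hommap d g.
Proof. by move=> fg fd i; apply: homfun_ext (fd i) => v; rewrite fg. Qed.

Lemma hommapZ V W d e (h : V -> K) (Phi : V -> W) :
  homfun d h -> hommap e Phi -> hommap (d + e) (fun v => h v *: Phi v).
Proof.
move=> hd Phie i; apply: homfun_ext (homfunM hd (Phie i)) => v.
by rewrite linearZ.
Qed.

Lemma hommap_sum V W d I (r : seq I) (P : pred I) (Phi : I -> V -> W) :
  (forall i, P i -> hommap d (Phi i)) ->
  hommap d (fun v => \sum_(i <- r | P i) Phi i v).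
Proof.
move=> H i; have /homfun_ext := homfun_sum r (fun k Pk => H k Pk i).
by apply=> v; rewrite linear_sum.
Qed.

(* The affine cone over the closure of the lines spanned by a family [E]. *)
Definition incone V I (E : I -> V) (x : V) : Prop :=
  forall d h, homfun d h -> (forall i, h (E i) = 0) -> h x = 0.

Lemma incone_id V I (E : I -> V) i : incone E (E i).
Proof. by move=> d h _; apply. Qed.

Lemma incone_scale V I (E : I -> V) c x : incone E x -> incone E (c *: x).
Proof.
by move=> Ex d h hd h0; rewrite (homfun_scale _ _ hd) (Ex _ _ hd h0) mulr0.
Qed.

(** The main tool for moving points between closures: a form that vanishes on the family [F] pulls
    back along [Phi] to a form that vanishes on the family [E]. *)
Lemma incone_map V W I J (E : I -> V) (F : J -> W) d (Phi : V -> W) x :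
  hommap d Phi -> (forall i, incone F (Phi (E i))) -> incone E x ->
  incone F (Phi x).
Proof.
move=> Phid H Ex e h he h0; apply: Ex (homfun_comp he Phid) _ => i.
exact: (H i) he h0.
Qed.

Lemma incone_sub V I J (E : I -> V) (F : J -> V) x :
  (forall i, incone F (E i)) -> incone E x -> incone F x.
Proof. by move=> H Ex d h hd h0; apply: (Ex _ _ hd) => i; apply: (H i) hd h0. Qed.

(** The coordinates of [f] are forms of degree one. *)
Lemma incone_linear V W I (E : I -> V) (f : {linear V -> W}) x :
  incone E x -> (forall i, f (E i) = 0) -> f x = 0.
Proof.
move=> Ex f0; rewrite (coord_vbasis (memvf (f x))) big1 // => i _.
rewrite (Ex _ _ (hommap_linear f i)) ?scale0r // => k.
by rewrite f0 linear0.
Qed.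

Lemma line_gen V (L : {vspace V}) : proj L -> exists2 x, x != 0 & L = <[x]>%VS.
Proof.
move=> L1; have L0 : L != 0%VS by rewrite -dimv_eq0 L1.
exists (vpick L); first by rewrite vpick0.
by apply/esym/eqP; rewrite eqEdim -memvE memv_pick dim_vline vpick0 L0 L1.
Qed.

Lemma proj_line V (x : V) : proj <[x]>%VS <-> x != 0.
Proof. by rewrite /proj dim_vline; case: eqP. Qed.

Lemma line_mem V (x y : V) : y \in <[x]>%VS -> y != 0 ->
  exists2 c, c != 0 & y = c *: x.
Proof.
move=> /vlineP[c ->] cx0; exists c => //.
by apply: contraNneq cx0 => ->; rewrite scale0r.
Qed.

Lemma lineZ V (x : V) c : c != 0 -> <[c *: x]>%VS = <[x]>%VS.
Proof.
move=> c0; apply: subv_anti; rewrite -!memvE memvZ ?memv_line //=.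
by apply/vlineP; exists c^-1; rewrite scalerA mulVf ?scale1r.
Qed.

Lemma line_eq V (x y : V) : x != 0 -> <[x]>%VS = <[y]>%VS ->
  exists2 c, c != 0 & x = c *: y.
Proof. by move=> x0 xy; apply: line_mem => //; rewrite -xy memv_line. Qed.

(** By homogeneity it is enough to test a form at one generator of each line. *)
Lemma zclosure_incone V I (E : I -> V) (S : pset V) x : x != 0 ->
  (forall L, S L <-> exists i, L = <[E i]>%VS) ->
  zclosure S <[x]>%VS <-> incone E x.
Proof.
move=> x0 SE; split=> [[_ H] d h hd h0|H].
  apply: (H d h hd) (memv_line x) => L v /SE[i ->] /vlineP[c ->].
  by rewrite (homfun_scale _ _ hd) h0 mulr0.
split; first exact/proj_line.
move=> d h hd h0 v /vlineP[c ->].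
rewrite (homfun_scale _ _ hd) (H _ _ hd) ?mulr0 // => i.
by apply: (h0 <[E i]>%VS); [apply/SE; exists i | apply: memv_line].
Qed.

Lemma zclosure_proj V (S : pset V) L : zclosure S L -> proj L.
Proof. by case. Qed.

Lemma zopen_nonvan V d (h : V -> K) : homfun d h -> zopen (nonvan h).
Proof. by move=> hd L _ hL; exists d, h; split. Qed.

Lemma nonvan_line V d (h : V -> K) x : homfun d h ->
  nonvan h <[x]>%VS <-> h x != 0.
Proof.
move=> hd; split=> [[v /vlineP[c ->]]|hx]; last by exists x; rewrite ?memv_line.
by rewrite (homfun_scale _ _ hd) mulf_eq0 negb_or => /andP[].
Qed.

End Homfun.

(** * Exponentials of nilpotent endomorphisms *)

Section Nilpotent.
Context {K : numFieldType} {V : vectType K}.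
Implicit Types X Y Z W T : 'End(V).

Definition nilend T := exists B, forall m, iter B T m = 0.

Lemma iterE_add T B k m : (forall m, iter B T m = 0) -> (B <= k)%N ->
  iter k T m = 0.
Proof. by move=> TB /subnK <-; rewrite addnC iterD TB. Qed.

Lemma iter_lin0 T k : iter k T 0 = 0.
Proof. by elim: k => //= k ->; rewrite linear0. Qed.

(** The images of the powers of [T] lose dimension until they stabilize, and by nilpotency they can
    only stabilize at 0. This is why [exp_nil], truncated at dim V, is the whole exponential
    series. *)
Lemma nilp_dim T m : nilend T -> iter (\dim {:V}) T m = 0.
Proof.
move=> [B TB]; pose L k := iter k (fun U => (T @: U)%VS) {:V}%VS.
have iterL k x : iter k T x \in L k.
  by elim: k => [|k IH] /=; rewrite ?memvf // memv_img.
have LB k y : y \in L k -> exists x, y = iter k T x.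
  elim: k y => [|k IH] y /=; first by exists y.
  by move=> /memv_imgP[x /IH[x' ->] ->]; exists x'.
have LS k : (L k.+1 <= L k)%VS.
  elim: k => [|k IH]; first exact: subvf.
  exact: limgS IH.
have L0 : L B = 0%VS.
  apply/eqP; rewrite -subv0; apply/subvP => y /LB[x ->].
  by rewrite TB mem0v.
have dimL k : (\dim (L k) <= \dim {:V} - k)%N.
  elim: k => [|k IH]; first by rewrite subn0 dimvS ?subvf.
  have [Lk|Lk] := eqVneq (L k.+1) (L k).
    have Lj j : L (j + k)%N = L k.
      by elim: j => // j IHj; rewrite addSn -Lk /= -/(L _) IHj.
    rewrite Lk -(Lj B) addnC.
    suff -> : L (k + B)%N = 0%VS by rewrite dimv0.
    by elim: (k) => [|j IHj]; rewrite ?L0 // addSn /= -/(L _) IHj limg0.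
  have : (\dim (L k.+1) < \dim (L k))%N.
    rewrite ltnNge; apply: contra Lk => dk; rewrite eqEdim LS; exact: dk.
  by move=> /leq_trans/(_ IH); rewrite subnS; case: (_ - _)%N.
have := iterL (\dim {:V}) m.
have := dimL (\dim {:V}); rewrite subnn leqn0 dimv_eq0 => /eqP->.
by rewrite memv0 => /eqP.
Qed.

(** Divided powers, for which the binomial formula [dpowD] has no coefficients. *)
Definition dpow k T m := (k`!%:R)^-1 *: iter k T m.

Lemma dpow_lin k T : linear (dpow k T).
Proof.
move=> c u v; rewrite /dpow scalerA mulrC -scalerA -scalerDr; congr (_ *: _).
by elim: k => //= k ->; rewrite linearP.
Qed.

Lemma dpow_scale k T c u : dpow k T (c *: u) = c *: dpow k T u.
Proof.
have := dpow_lin k T c u 0; rewrite !addr0 => ->.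
by rewrite /dpow [iter k T 0](_ : _ = 0) ?scaler0 ?addr0 // iter_lin0.
Qed.

Lemma factr_neq0 k : k`!%:R != 0 :> K.
Proof. by rewrite pnatr_eq0 -lt0n fact_gt0. Qed.

Lemma dpow0 T m : dpow 0 T m = m.
Proof. by rewrite /dpow fact0 invr1 scale1r. Qed.

Lemma dpowS k T m : T (dpow k T m) = k.+1%:R *: dpow k.+1 T m.
Proof.
rewrite /dpow linearZ /= scalerA; congr (_ *: _).
by rewrite factS natrM invfM mulrA divff ?mul1r // pnatr_eq0.
Qed.

Lemma exp_nilE T m B : nilend T -> iter B T m = 0 ->
  exp_nil T m = \sum_(k < B) dpow k T m.
Proof.
move=> nT TB; set D := \dim {:V}.
have TD : iter D.+1 T m = 0 by rewrite iterS nilp_dim // linear0.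
have aux n1 n2 : (n1 <= n2)%N -> iter n1 T m = 0 ->
    \sum_(k < n2) dpow k T m = \sum_(k < n1) dpow k T m.
  move=> n12 Tn1; rewrite -!(big_mkord xpredT (fun k => dpow k T m)).
  rewrite (big_cat_nat (leq0n _) n12) //= [X in _ + X = _]big_nat_cond [X in _ + X = _]big1 ?addr0 // => k.
  rewrite andbT => /andP[/subnK <- _].
  by rewrite /dpow iterD Tn1 iter_lin0 scaler0.
have [h|/ltnW h] := leqP B D.+1; first exact: aux.
by rewrite (aux D.+1 B).
Qed.

Lemma exp_nil_linear T : linear (@exp_nil K V T).
Proof.
move=> c u v; unfold exp_nil; rewrite scaler_sumr -big_split; apply: eq_bigr => k _.
exact: dpow_lin.
Qed.
HB.instance Definition _ T :=
  GRing.isLinear.Build K V V _ (@exp_nil K V T) (exp_nil_linear T).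

Lemma exp_nilZ T c u : exp_nil T (c *: u) = c *: exp_nil T u.
Proof. exact: linearZ. Qed.

Lemma exp_nil_0 T : exp_nil T 0 = 0.
Proof. exact: linear0. Qed.

Lemma exp_nilB T u1 u2 : exp_nil T (u1 - u2) = exp_nil T u1 - exp_nil T u2.
Proof. exact: linearB. Qed.

Lemma exp_nilDr T u1 u2 : exp_nil T (u1 + u2) = exp_nil T u1 + exp_nil T u2.
Proof. exact: linearD. Qed.

Lemma exp_nilN T u : exp_nil T (- u) = - exp_nil T u.
Proof. exact: linearN. Qed.

Lemma nilp0 : nilend 0.
Proof. by exists 1%N => m /=; rewrite zero_lfunE. Qed.

Lemma exp_nil0 (m : V) : exp_nil (0 : 'End(V)) m = m.
Proof.
by rewrite (@exp_nilE _ _ 1) ?big_ord1 ?dpow0 //= ?zero_lfunE //; apply: nilp0.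
Qed.

Lemma exp_nil_fix T m : nilend T -> T m = 0 -> exp_nil T m = m.
Proof. by move=> nT Tm; rewrite (exp_nilE (B := 1)) // big_ord1 dpow0. Qed.

Lemma nilpZ c T : nilend T -> nilend (c *: T).
Proof.
move=> [B TB]; exists B => m.
suff -> : forall k, iter k (c *: T) m = c ^+ k *: iter k T m.
  by rewrite TB scaler0.
elim=> [|k IH] /=; first by rewrite scale1r.
by rewrite IH scale_lfunE linearZ /= scalerA exprS.
Qed.

Lemma dpowZ k c T m : dpow k (c *: T) m = c ^+ k *: dpow k T m.
Proof.
rewrite /dpow scalerA mulrC -scalerA; congr (_ *: _).
elim: k => [|k IH] /=; first by rewrite scale1r.
by rewrite IH scale_lfunE linearZ /= scalerA exprS.
Qed.

Lemma nilpN T : nilend T -> nilend (- T).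
Proof. by move=> /(nilpZ (-1)); rewrite scaleN1r. Qed.

Definition commute_end X Y := forall m, X (Y m) = Y (X m).

Lemma commute_iter X Y k m : commute_end X Y -> X (iter k Y m) = iter k Y (X m).
Proof. by move=> cXY; elim: k => //= k IH; rewrite cXY IH. Qed.

Lemma exp_nil_commute X Y m : commute_end X Y ->
  X (exp_nil Y m) = exp_nil Y (X m).
Proof.
move=> cXY; unfold exp_nil; rewrite linear_sum; apply: eq_bigr => k _.
by rewrite linearZ /= commute_iter.
Qed.

Lemma dpowD X Y k m : commute_end X Y ->
  dpow k (X + Y) m = \sum_(i < k.+1) dpow i X (dpow (k - i) Y m).
Proof.
move=> cXY; elim: k m => [|k IH] m; first by rewrite big_ord1 !dpow0.
have k0 : k.+1%:R != 0 :> K by rewrite pnatr_eq0.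
apply: (scalerI k0); rewrite -dpowS IH add_lfunE !linear_sum -big_split /=.
(* After multiplication by k + 1, the term of index [i] receives [i] copies from the application of
   [X] and k + 1 - [i] copies from that of [Y]. *)
pose F i := (i%:R *: dpow i X (dpow (k.+1 - i) Y m)).
pose G i := ((k.+1 - i)%:R *: dpow i X (dpow (k.+1 - i) Y m)).
rewrite (eq_bigr (fun i : 'I_k.+1 => F i.+1 + G i)) => [|i _]; last first.
  rewrite dpowS; congr (_ + _).
  have -> : Y (dpow i X (dpow (k - i) Y m)) = dpow i X (Y (dpow (k - i) Y m)).
    by rewrite /dpow linearZ /= commute_iter // => v; rewrite cXY.
  by rewrite dpowS /G subSn -1?ltnS // dpow_scale.
rewrite big_split /=.
have -> : \sum_(i < k.+1) F i.+1 = \sum_(i < k.+2) F i.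
  by rewrite [RHS]big_ord_recl /F scale0r add0r.
have -> : \sum_(i < k.+1) G i = \sum_(i < k.+2) G i.
  by rewrite [RHS]big_ord_recr /= /G subnn scale0r addr0.
rewrite -big_split /=; apply: eq_bigr => i _.
by rewrite /F /G -scalerDl -natrD subnKC // -ltnS.
Qed.

Lemma sum_triangle (g : nat -> nat -> V) N :
  \sum_(k < N) \sum_(i < k.+1) g i (k - i)%N =
  \sum_(i < N) \sum_(j < N - i) g i j.
Proof.
elim: N => [|N IH]; first by rewrite !big_ord0.
rewrite big_ord_recr IH /= [RHS]big_ord_recr /= subSnn big_ord1.
rewrite big_ord_recr /= subnn addrA; congr (_ + _).
rewrite -big_split; apply: eq_bigr => i _ /=.
by rewrite subSn ?(ltnW (ltn_ord i)) // big_ord_recr.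
Qed.

(** In the binomial expansion of degree [B + C], every term contains at least [B] factors [X] or at
    least [C] factors [Y]. *)
Lemma nilpD X Y : nilend X -> nilend Y -> commute_end X Y -> nilend (X + Y).
Proof.
move=> [B XB] [C YC] cXY; exists (B + C)%N => m.
have : dpow (B + C) (X + Y) m = 0.
  rewrite dpowD // big1 // => i _; rewrite /dpow.
  have [h|h] := leqP B i; first by rewrite (iterE_add _ XB h) scaler0.
  rewrite (iterE_add m YC) ?scaler0 ?iter_lin0 ?scaler0 //.
  by lia.
by move=> /eqP; rewrite scaler_eq0 invr_eq0 (negPf (factr_neq0 _)) => /eqP.
Qed.

Lemma exp_nilD X Y m : nilend X -> nilend Y -> commute_end X Y ->
  exp_nil (X + Y) m = exp_nil X (exp_nil Y m).
Proof.
move=> nX nY cXY; have nXY := nilpD nX nY cXY; case: (nX) (nY) => [B XB] [C YC].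
have XYBC : iter (B + C) (X + Y) m = 0.
  have [N HN] := nXY; have := nilp_dim m nXY; have [h|h] := leqP (\dim {:V}) (B + C).
    by move=> h0; rewrite -(subnK h) iterD h0 iter_lin0.
  have : dpow (B + C) (X + Y) m = 0.
    rewrite dpowD // big1 // => i _; rewrite /dpow.
    have [h'|h'] := leqP B i; first by rewrite (iterE_add _ XB h') scaler0.
    rewrite (iterE_add m YC) ?scaler0 ?iter_lin0 ?scaler0 //.
    by lia.
  by move=> /eqP; rewrite scaler_eq0 invr_eq0 (negPf (factr_neq0 _)) => /eqP.
rewrite (exp_nilE nXY XYBC).
rewrite (eq_bigr (fun k : 'I_ _ => \sum_(i < k.+1) dpow i X (dpow (k - i) Y m)));
  last by move=> k _; rewrite dpowD.
rewrite (sum_triangle (fun i j => dpow i X (dpow j Y m))).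
rewrite (exp_nilE (B := B + C) nX) ?(iterE_add _ XB (leq_addr _ _)) //.
apply: eq_bigr => i _.
rewrite (exp_nilE (B := C) nY (YC m)).
rewrite (big_morph (dpow i X) (id1 := 0) (op1 := +%R)); first last.
- by rewrite /dpow iter_lin0 scaler0.
- by move=> u v; rewrite -[u]scale1r (dpow_lin i X) !scale1r.
have [h|h] := leqP B i.
  by rewrite !big1 // => j _; rewrite /dpow (iterE_add _ XB h) scaler0.
have Ci : (C <= B + C - i)%N by lia.
rewrite -!(big_mkord xpredT (fun j => dpow i X (dpow j Y m))) (big_cat_nat (leq0n _) Ci) //=.
rewrite [X in _ + X = _]big_nat_cond [X in _ + X = _]big1 ?addr0 // => j.
rewrite andbT => /andP[Cj _].
by rewrite [dpow j Y m]/dpow (iterE_add _ YC Cj) scaler0 /dpow iter_lin0 scaler0.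
Qed.

Lemma exp_nilNK X m : nilend X -> exp_nil X (exp_nil (- X) m) = m.
Proof.
move=> nX; rewrite -exp_nilD ?subrr ?exp_nil0 //; first exact: nilpN.
by move=> u; rewrite !opp_lfunE linearN.
Qed.

Lemma exp_nilKN X m : nilend X -> exp_nil (- X) (exp_nil X m) = m.
Proof. by move=> nX; rewrite -{2}(opprK X) exp_nilNK //; apply: nilpN. Qed.

(* Ad(exp X) Y = Y + [X, Y] + [X, [X, Y]] / 2, the next bracket being 0. *)
Lemma exp_nil_conj X Y Z W m : nilend X ->
  (forall u, X (Y u) = Y (X u) + Z u) ->
  (forall u, X (Z u) = Z (X u) + 2%:R *: W u) ->
  (forall u, X (W u) = W (X u)) ->
  exp_nil X (Y m) = Y (exp_nil X m) + Z (exp_nil X m) + W (exp_nil X m).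
Proof.
move=> nX XY XZ XW.
have D1 : dpow 1 X (Y m) = Y (dpow 1 X m) + Z (dpow 0 X m).
  by rewrite /dpow /= fact0 invr1 !scale1r XY.
have DS k : dpow k.+2 X (Y m) =
    Y (dpow k.+2 X m) + Z (dpow k.+1 X m) + W (dpow k X m).
  elim: k => [|k IH].
    apply: (@scalerI _ _ 2%:R); first by rewrite pnatr_eq0.
    rewrite -dpowS D1 [LHS]linearD /= XY XZ.
    rewrite (dpowS 1) (dpowS 0) [in LHS]linearZ [in Z (1 *: _)]scale1r /=.
    rewrite !scalerDr -!addrA; congr (_ + _).
    by rewrite addrA -mulr2n !scaler_nat.
  have k0 : k.+3%:R != 0 :> K by rewrite pnatr_eq0.
  apply: (scalerI k0); rewrite -dpowS IH [LHS]linearD [in LHS]linearD /= XY XZ XW.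
  rewrite !dpowS; move: (dpow _ X m) (dpow k.+2 X m) (dpow k.+1 X m) => d3 d2 d1.
  rewrite (linearZ _ d3) (linearZ _ d2) (linearZ _ d1) /= !scalerDr -!addrA.
  congr (_ + _); rewrite !addrA -[X in X + _ + _ + _]scale1r -scalerDl.
  rewrite -addrA -scalerDl; congr (_ *: _ + _ *: _).
    by rewrite -natrD.
case: nX (nX) => [B XB] nX.
have XB2 u : iter B.+2 X u = 0 by rewrite (iterE_add _ XB) //; lia.
have XB1 u : iter B.+1 X u = 0 by rewrite (iterE_add _ XB).
rewrite (exp_nilE nX (XB2 (Y m))).
have -> : Y (exp_nil X m) = \sum_(k < B.+2) Y (dpow k X m).
  by rewrite (exp_nilE nX (XB2 m)) linear_sum.
have -> : Z (exp_nil X m) = \sum_(k < B.+1) Z (dpow k X m).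
  by rewrite (exp_nilE nX (XB1 m)) linear_sum.
have -> : W (exp_nil X m) = \sum_(k < B) W (dpow k X m).
  by rewrite (exp_nilE nX (XB m)) linear_sum.
rewrite !big_ord_recl /= D1 !dpow0.
rewrite (eq_bigr _ (fun (i : 'I_B) _ => DS i)) !big_split /=.
rewrite -!addrA; congr (_ + (_ + _)).
by rewrite [LHS]addrCA; congr (_ + _); rewrite addrCA.
Qed.

End Nilpotent.

(** * Polynomial curves in a vector space *)

Section PolyCurve.
Context {K : numFieldType}.
Implicit Types V W : vectType K.

Definition polyfun V (Y : K -> V) :=
  exists B (y : nat -> V), forall c, Y c = \sum_(k < B) c ^+ k *: y k.

(** In characteristic zero the integers 1, 2, ... supply more nonzero roots than the degree
    allows. *)
Lemma poly_eq0_nonzero (q : {poly K}) : (forall c, c != 0 -> q.[c] = 0) -> q = 0.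
Proof.
move=> H; apply/eqP; apply/negPn/negP => q0.
have := @max_poly_roots _ q [seq i.+1%:R | i <- iota 0 (size q)] q0.
rewrite size_map size_iota ltnn => /(_ _ _)/negP; apply=> //.
  apply/allP => _ /mapP[i _ ->]; apply/rootP; apply: H.
  by rewrite pnatr_eq0.
rewrite map_inj_uniq ?iota_uniq // => i j /eqP.
by rewrite eqr_nat => /eqP[].
Qed.

Lemma poly_eq_nonzero (p q : {poly K}) :
  (forall c, c != 0 -> p.[c] = q.[c]) -> p = q.
Proof.
move=> H; apply/eqP; rewrite -subr_eq0; apply/eqP/poly_eq0_nonzero => c c0.
by rewrite hornerD hornerN H // subrr.
Qed.

Lemma polyfun_ext V (Y Z : K -> V) : Y =1 Z -> polyfun Y -> polyfun Z.
Proof. by move=> YZ [B [y yE]]; exists B, y => c; rewrite -YZ. Qed.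

Lemma polyfun_cst V (v : V) : polyfun (fun _ => v).
Proof. by exists 1%N, (fun=> v) => c; rewrite big_ord1 expr0 scale1r. Qed.

Lemma polyfunD V (Y Z : K -> V) :
  polyfun Y -> polyfun Z -> polyfun (fun c => Y c + Z c).
Proof.
move=> [B [y yE]] [C [z zE]].
exists (B + C)%N, (fun k => (if (k < B)%N then y k else 0)
                  + (if (k < C)%N then z k else 0)) => c.
under eq_bigr => k _ do rewrite scalerDr.
rewrite big_split yE zE /=; congr (_ + _); last rewrite addnC.
all: rewrite big_split_ord /= [X in _ + X]big1 ?addr0 => [|i _];
  rewrite ?ltnNge ?leq_addr ?scaler0 //.
all: by apply: eq_bigr => i _; rewrite ?ltn_ord // -?ltnNge ?ltn_ord.
Qed.

Lemma polyfun_sum V I (r : seq I) (P : pred I) (Y : I -> K -> V) :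
  (forall i, P i -> polyfun (Y i)) -> polyfun (fun c => \sum_(i <- r | P i) Y i c).
Proof.
move=> H; elim: r => [|i r IH].
  by apply: polyfun_ext (polyfun_cst 0) => c; rewrite big_nil.
case Pi: (P i); last by apply: polyfun_ext IH => c; rewrite big_cons Pi.
apply: polyfun_ext (polyfunD (H i Pi) IH) => c.
by rewrite big_cons Pi.
Qed.

Lemma polyfunX V (Y : K -> V) j : polyfun Y -> polyfun (fun c => c ^+ j *: Y c).
Proof.
move=> [B [y yE]].
exists (j + B)%N, (fun k => if (k < j)%N then 0 else y (k - j)%N) => c.
rewrite big_split_ord /= big1 ?add0r => [|i _]; last by rewrite ltn_ord scaler0.
rewrite yE scaler_sumr; apply: eq_bigr => i _.
by rewrite ltnNge leq_addr addKn scalerA exprD.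
Qed.

Lemma polyfun_lin V W (f : {linear V -> W}) Y :
  polyfun Y -> polyfun (fun c => f (Y c)).
Proof.
move=> [B [y yE]]; exists B, (fun k => f (y k)) => c.
by rewrite yE linear_sum; apply: eq_bigr => k _; rewrite linearZ.
Qed.

Lemma polyfun_scale V (Y : K -> V) (p : {poly K}) :
  polyfun Y -> polyfun (fun c => p.[c] *: Y c).
Proof.
move=> pY; have : polyfun (fun c => \sum_(i < size p) c ^+ i *: (p`_i *: Y c)).
  apply: polyfun_sum => i _; apply: polyfunX.
  exact: (polyfun_lin [the {linear V -> V} of *:%R p`_i]).
apply: polyfun_ext => c; rewrite horner_coef scaler_suml.
by apply: eq_bigr => i _; rewrite scalerA mulrC.
Qed.

Lemma polyfun_app V W (X : K -> 'Hom(V, W)) Y :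
  polyfun X -> polyfun Y -> polyfun (fun c => X c (Y c)).
Proof.
move=> [B [x xE]] pY.
have : polyfun (fun c => \sum_(i < B) c ^+ i *: x i (Y c)).
  by apply: polyfun_sum => i _; apply: polyfunX; apply: polyfun_lin.
apply: polyfun_ext => c; rewrite xE sum_lfunE; apply: eq_bigr => i _.
by rewrite scale_lfunE.
Qed.

Lemma polyfun_exp V (X : K -> 'End(V)) Y :
  polyfun X -> polyfun Y -> polyfun (fun c => exp_nil (X c) (Y c)).
Proof.
move=> pX pY; apply: polyfun_sum => k _.
apply: (polyfun_lin [the {linear V -> V} of *:%R (k`!%:R^-1 : K)]).
elim: (k : nat) => [|j IH] //; exact: polyfun_app pX IH.
Qed.

Lemma polyfun_coef V (Y : K -> V) : polyfun Y ->
  forall f : {linear V -> K^o}, exists q : {poly K}, forall c, f (Y c) = q.[c].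
Proof.
move=> [B [y yE]] f; exists (\poly_(k < B) f (y k)) => c.
rewrite yE linear_sum horner_poly; apply: eq_bigr => k _.
by rewrite linearZ /= mulrC.
Qed.

Lemma vec_eq0 V (v : V) : (forall f : {linear V -> K^o}, f v = 0) -> v = 0.
Proof.
move=> H; rewrite (coord_vbasis (memvf v)) big1 // => i _.
by rewrite (H (coord (vbasis {:V}) i)) scale0r.
Qed.

Lemma polyfun_coef0 V B (y : nat -> V) :
  (forall c, c != 0 -> \sum_(k < B) c ^+ k *: y k = 0) ->
  forall k, (k < B)%N -> y k = 0.
Proof.
move=> H k kB; apply: vec_eq0 => f.
suff : (\poly_(k < B) f (y k))`_k = 0 by rewrite coef_poly kB.
rewrite (_ : \poly_(k < B) f (y k) = 0) ?coef0 //.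
apply: poly_eq0_nonzero => c /H/(congr1 f).
rewrite linear0 linear_sum horner_poly => sum0; apply: etrans sum0.
by apply: eq_bigr => i _; rewrite linearZ /= mulrC.
Qed.

Lemma polyfun_eq0 V (Y : K -> V) : polyfun Y ->
  (forall c, c != 0 -> Y c = 0) -> forall c, Y c = 0.
Proof.
move=> [B [y yE]] H c; rewrite yE big1 // => k _.
by rewrite (polyfun_coef0 (B := B)) ?scaler0 // => d d0; rewrite -yE H.
Qed.

Lemma polyfun_homfun V (Y : K -> V) d (h : V -> K) : polyfun Y -> homfun d h ->
  exists q : {poly K}, forall c, h (Y c) = q.[c].
Proof.
move=> pY [p _ pE].
have /fin_all_exists[y yE] : forall i : 'I_(\dim {:V}), exists q : {poly K},
    forall c, coord (vbasis {:V}) i (Y c) = q.[c].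
  by move=> i; apply: (polyfun_coef pY (coord (vbasis {:V}) i)).
exists (\sum_(m <- msupp p) (p@_m)%:P * \prod_i y i ^+ m i) => c.
rewrite pE /mpeval mevalE horner_sum; apply: eq_bigr => m _.
rewrite hornerM hornerC horner_prod; congr (_ * _); apply: eq_bigr => i _.
by rewrite horner_exp yE.
Qed.

(** Closures contain limits: a form restricted to the curve is a polynomial in the parameter, and it
    vanishes at all nonzero parameters. *)
Lemma incone_lim V I (E : I -> V) (Y : K -> V) : polyfun Y ->
  (forall c, c != 0 -> incone E (Y c)) -> incone E (Y 0).
Proof.
move=> pY H d h hd h0; have [q qE] := polyfun_homfun pY hd.
rewrite qE (_ : q = 0) ?horner0 //; apply: poly_eq0_nonzero => c c0.
by rewrite -qE; apply: (H c c0) hd h0.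
Qed.

Lemma poly_first_order (p q : {poly K}) a b :
  (forall s, p.[s] = a + s * b + s ^+ 2 * q.[s]) -> p^`().[0] = b.
Proof.
move=> H; have -> : p = a%:P + b *: 'X + 'X^2 * q.
  by apply: poly_eq_nonzero => c _; rewrite !hornerE H; ring.
by rewrite !derivE !hornerE /= ?expr0n /= ?mul0r ?mulr0 ?addr0 ?add0r ?mulr1.
Qed.

(* Uniqueness of the solution of Y' = F Y among polynomial curves; the
   derivative is expressed by a first order expansion. *)
Lemma exp_nil_flow V (F : 'End(V)) (Y : K -> V) : nilend F -> polyfun Y ->
  (forall c, exists2 R : K -> V, polyfun R &
    forall s, Y (c + s) = Y c + s *: F (Y c) + s ^+ 2 *: R s) ->
  Y 1 = exp_nil F (Y 0).
Proof.
(* The coefficients are cut to 0 from [B] on, so that the recursion below also yields [F]^[B]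
   ([Y 0]) = 0 and the exponential stops at [B]. *)
move=> nF [B [y0 yE0]] H; pose y k := if (k < B)%N then y0 k else 0.
have yE c : Y c = \sum_(k < B) c ^+ k *: y k.
  by rewrite yE0; apply: eq_bigr => k _; rewrite /y ltn_ord.
have pY : polyfun Y by exists B, y.
(* These are the coefficients of Y' - F Y. The derivative at [c] is read off the expansion [H] by
   [poly_first_order], one linear form at a time. *)
have yS k : (k < B)%N -> k.+1%:R *: y k.+1 - F (y k) = 0.
  apply: (polyfun_coef0 (y := fun k => k.+1%:R *: y k.+1 - F (y k))) => c _.
  apply: vec_eq0 => f.
  pose q : {poly K} := \poly_(k < B) f (y k).
  have qE d : f (Y d) = q.[d].
    rewrite yE linear_sum horner_poly; apply: eq_bigr => i _.
    by rewrite linearZ /= mulrC.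
  have [R pR RE] := H c; have [r rE] := polyfun_coef pR f.
  have : (q \Po ('X + c%:P))^`().[0] = f (F (Y c)).
    apply: (@poly_first_order _ r (f (Y c))) => s.
    by rewrite horner_comp !hornerE addrC -qE RE !linearD !linearZ /= rE.
  rewrite deriv_comp !derivE addr0 mulr1 horner_comp !hornerE => qF.
  under eq_bigr => k' _ do rewrite scalerBr.
  rewrite sumrB linearB /= [X in _ - f X](_ : _ = F (Y c)); last first.
    by rewrite yE linear_sum; apply: eq_bigr => i _; rewrite linearZ.
  rewrite -qF; apply/eqP; rewrite subr_eq0 linear_sum; apply/eqP.
  rewrite [q^`()](_ : _ = \poly_(k < B) (f (y k.+1) *+ k.+1)).
    rewrite horner_poly; apply: eq_bigr => i _.
    by rewrite scalerA linearZ /= -[f _ *+ _]mulr_natl [RHS]mulrC mulrA. 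
  apply/polyP => i; rewrite coef_deriv !coef_poly.
  case: ltnP => h1; case: ltnP => h2 //; rewrite ?mul0rn //.
    by exfalso; lia.
  by rewrite /y ltnNge h1 linear0 mul0rn.
have yF k : (k <= B)%N -> y k = dpow k F (y 0%N).
  elim: k => [|k IH] kB; first by rewrite dpow0.
  have k0 : k.+1%:R != 0 :> K by rewrite pnatr_eq0.
  apply: (scalerI k0); rewrite -dpowS -IH ?(ltnW kB) //.
  by move/eqP: (yS k kB); rewrite subr_eq0 => /eqP.
have Y0 : Y 0 = y 0%N.
  have [B0|B0] := posnP B; first by rewrite yE /y B0 big_ord0.
  rewrite yE -(prednK B0) big_ord_recl expr0 scale1r big1 ?addr0 // => i _.
  by rewrite expr0n scale0r.
rewrite yE Y0 (exp_nilE (B := B) nF); last first.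
  have := yF B (leqnn B); rewrite {1}/y ltnn => /esym/eqP.
  by rewrite scaler_eq0 invr_eq0 (negPf (factr_neq0 _)) => /eqP.
by apply: eq_bigr => k _; rewrite expr1n scale1r yF // ltnW.
Qed.

End PolyCurve.

(** A module over sl_2 (x) K[t]/(t^n) with a lowest weight vector [cv] of weight -N: [ce P] stands
    for e (x) P, and likewise for [cf] and [ch]. The abstraction lets M^A and M^(A') share the same
    lemmas. *)
Record current (K : numFieldType) (n N : nat) (V : vectType K) := Current {
  ce : {linear {poly K} -> 'End(V)};
  cf : {linear {poly K} -> 'End(V)};
  ch : {linear {poly K} -> 'End(V)};
  cv : V;
  c_ee : forall P Q u, ce P (ce Q u) = ce Q (ce P u);
  c_ff : forall P Q u, cf P (cf Q u) = cf Q (cf P u);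
  c_ef : forall P Q u, ce P (cf Q u) = cf Q (ce P u) + ch (P * Q) u;
  c_he : forall P Q u, ch P (ce Q u) = ce Q (ch P u) + 2%:R *: ce (P * Q) u;
  c_hf : forall P Q u, ch P (cf Q u) = cf Q (ch P u) - 2%:R *: cf (P * Q) u;
  c_e0 : forall P, 'X^n %| P -> ce P = 0;
  c_f0 : forall P, 'X^n %| P -> cf P = 0;
  c_enil : forall P, nilend (ce P);
  c_fnil : forall P, nilend (cf P);
  c_fv : forall P, cf P cv = 0;
  c_hv : forall P, ch P cv = - N%:R * P`_0 *: cv;
  c_eN : iter N.+1 (ce 1) cv = 0
}.

(** * The two cells of the orbit of a lowest weight line and the Moebius action on them *)

Section Moebius.
Context {K : numFieldType} {n N : nat} {V : vectType K} (C : current n.+1 N V).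
Local Notation e := (ce C).
Local Notation f := (cf C).
Local Notation h := (ch C).
Local Notation v := (cv C).
Local Notation Xn := ('X^(n.+1) : {poly K}).
Implicit Types (P Q R S : {poly K}) (u : V) (c s : K).

Lemma dvdp_lin (d a b x y : {poly K}) : d %| x -> d %| y -> d %| a * x + b * y.
Proof. by move=> dx dy; rewrite dvdp_add ?dvdp_mull. Qed.

Lemma modX_coef0 P Q : Xn %| P - Q -> P`_0 = Q`_0.
Proof.
move=> /dvdpP[R PQ]; apply/eqP; rewrite -subr_eq0 -coefB PQ exprSr mulrA coefMX.
by rewrite eqxx.
Qed.

Lemma modX_cancel P Q : P`_0 != 0 -> Xn %| P * Q -> Xn %| Q.
Proof.
move=> P0; rewrite Gauss_dvdpr // coprimep_expl // coprimep_sym.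
by rewrite -['X]subr0 coprimep_XsubC /root horner_coef0.
Qed.

Lemma modX_inv P : P`_0 != 0 -> exists R, Xn %| P * R - 1.
Proof.
move=> P0; have : coprimep Xn P.
  rewrite coprimep_expl // coprimep_sym.
  by rewrite -['X]subr0 coprimep_XsubC /root horner_coef0.
move=> /Bezout_eq1_coprimepP[[a b] /= ab]; exists b.
have -> : P * b - 1 = - a * Xn by rewrite -ab; ring.
by rewrite dvdp_mull.
Qed.

Lemma dvdX_coef0 P : ('X %| P) = (P`_0 == 0).
Proof. by rewrite -['X]subr0 dvdp_XsubCl /root horner_coef0. Qed.

Lemma ce_mod P Q : Xn %| P - Q -> e P = e Q.
Proof. by move=> H; apply/eqP; rewrite -subr_eq0 -linearB /= c_e0. Qed.

Lemma cf_mod P Q : Xn %| P - Q -> f P = f Q.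
Proof. by move=> H; apply/eqP; rewrite -subr_eq0 -linearB /= c_f0. Qed.

(** The vector E(P) of the overview, for an arbitrary [current]. *)
Definition cell P : V := exp_nil (e P) v.

Lemma cell0 : cell 0 = v.
Proof. by rewrite /cell linear0 exp_nil0. Qed.

Lemma exp_eD P Q u : exp_nil (e (P + Q)) u = exp_nil (e P) (exp_nil (e Q) u).
Proof.
rewrite linearD exp_nilD //; try exact: c_enil.
by move=> x; apply: c_ee.
Qed.

Lemma cellD P Q : cell (P + Q) = exp_nil (e P) (cell Q).
Proof. exact: exp_eD. Qed.

Lemma cell_mod P Q : Xn %| P - Q -> cell P = cell Q.
Proof. by move=> H; rewrite /cell (ce_mod H). Qed.

(** Conjugation by exp(e(P)) turns h(Q) into h(Q) - 2 e(QP), and [v] is an eigenvector of h(Q). *)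
Lemma ch_cell Q P : h Q (cell P) = - N%:R * Q`_0 *: cell P + 2%:R *: e (Q * P) (cell P).
Proof.
have := @exp_nil_conj K V (e P) (h Q) (- (2%:R *: e (Q * P))) 0 v (c_enil C P).
rewrite c_hv exp_nilZ -/(cell P) => -> //; first 1 last.
- by move=> u; rewrite opp_lfunE scale_lfunE c_he addrK.
- by move=> u; rewrite !opp_lfunE !scale_lfunE linearN linearZ /= c_ee zero_lfunE scaler0 addr0.
- by move=> u; rewrite !zero_lfunE linear0.
by rewrite opp_lfunE scale_lfunE zero_lfunE addr0 subrK.
Qed.

(** The infinitesimal Moebius action: f(Q) moves P along the vector field - Q P^2, with the constant
    term of N Q P as multiplier. *)
Lemma cf_cell Q P :
  f Q (cell P) = N%:R * (Q * P)`_0 *: cell P - e (Q * P ^+ 2) (cell P).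
Proof.
have QPP : P * Q * P = Q * P ^+ 2 by ring.
have XZ u : e P (h (P * Q) u) = h (P * Q) (e P u) + 2%:R *: (- e (Q * P ^+ 2)) u.
  by rewrite c_he QPP opp_lfunE scalerN addrK.
have XW u : e P ((- e (Q * P ^+ 2)) u) = (- e (Q * P ^+ 2)) (e P u).
  by rewrite !opp_lfunE linearN /= c_ee.
have := exp_nil_conj v (c_enil C P) (c_ef C P Q) XZ XW.
rewrite c_fv exp_nil_0 -/(cell P) ch_cell QPP opp_lfunE -addrA => /esym/eqP.
rewrite addr_eq0 => /eqP->; rewrite (mulrC P Q) scaler_nat mulr2n !addrA addrK.
by rewrite opprD mulNr scaleNr opprK.
Qed.

(** The truncated geometric series of P / (1 + s Q P), which integrates the vector field of
    [cf_cell]. Being polynomial in [s], it yields a curve to which [exp_nil_flow] applies. *)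
Definition mob (m : nat) Q P s : {poly K} :=
  \sum_(k < m) (- s) ^+ k *: (Q ^+ k * P ^+ k.+1).

Lemma mobE m Q P s : (1 + s *: (Q * P)) * mob m Q P s =
  P - P * (- s *: (Q * P)) ^+ m.
Proof.
rewrite /mob; set t := - s *: _; have -> : s *: (Q * P) = - t by rewrite /t scaleNr opprK.
elim: m => [|m IH]; first by rewrite big_ord0 expr0; ring.
rewrite big_ord_recr /= mulrDr IH.
have -> : (- s) ^+ m *: (Q ^+ m * P ^+ m.+1) = P * t ^+ m.
  by rewrite /t exprZn exprMn exprSr mulrA -scalerAr [P * _]mulrC.
by rewrite exprS; ring.
Qed.

Lemma mob_mod m Q P s : 'X %| Q * P ->
  Xn %| (1 + s *: (Q * P)) * mob (n.+1 + m) Q P s - P.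
Proof.
move=> XQP; rewrite mobE addrAC subrr add0r dvdpNr dvdp_mull // exprD dvdp_mulr //.
by rewrite dvdp_exp2r // -mul_polyC dvdp_mull.
Qed.

(** The remainder has to be a polynomial curve for [exp_nil_flow]; [T] may depend on [s] because the
    increments of [mob] do, beyond first order. *)
Lemma exp_nil_second_order (T : K -> 'End(V)) u : (forall s, nilend (T s)) ->
  polyfun T -> exists2 G : K -> V, polyfun G &
  forall s, exp_nil (s *: T s) u = u + s *: T s u + s ^+ 2 *: G s.
Proof.
move=> nT pT; set D := \dim {:V}.
exists (fun s => \sum_(k < D) s ^+ k *: dpow k.+2 (T s) u).
  apply: polyfun_sum => k _; apply: polyfunX.
  apply: (polyfun_lin [the {linear V -> V} of *:%R ((k.+2)`!%:R^-1 : K)]).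
  elim: k.+2 => [|j IH]; [exact: polyfun_cst | exact: polyfun_app pT IH].
move=> s; rewrite (@exp_nilE _ _ _ _ D.+2); last first.
- by rewrite !iterS nilp_dim ?linear0 //; apply: nilpZ.
- exact: nilpZ.
rewrite !big_ord_recl /= !dpowZ addrA dpow0 scale1r.
rewrite /bump /= !add1n expr1 {1}/dpow invr1 scale1r /=; congr (_ + _).
rewrite scaler_sumr; apply: eq_bigr => k _.
by rewrite !add1n dpowZ [RHS]scalerA -exprD.
Qed.

Lemma polyfun_mob (L : {linear {poly K} -> 'End(V)}) m Q P :
  polyfun (fun s => L (mob m Q P s)).
Proof.
have : polyfun (fun s => \sum_(k < m) s ^+ k *: L ((-1) ^+ k *: (Q ^+ k * P ^+ k.+1))).
  by apply: polyfun_sum => k _; apply: polyfunX; apply: polyfun_cst.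
apply: polyfun_ext => s; rewrite linear_sum; apply: eq_bigr => k _ /=.
by rewrite -linearZ /= scalerA -exprMn mulrN1.
Qed.

(** When QP has no constant term, the multiplier of [cf_cell] vanishes, so the curve of the vectors
    E(P / (1 + s Q P)) solves Y' = f(Q) Y and [exp_nil_flow] gives its value at s = 1. The quotient
    is polynomial in s because QP is nilpotent modulo t^(n+1). *)
Lemma moebius_nil Q P R : 'X %| Q * P -> Xn %| (1 + Q * P) * R - P ->
  exp_nil (f Q) (cell P) = cell R.
Proof.
move=> XQP HR.
have unit1 s : (1 + s *: (Q * P))`_0 != 0.
  move: XQP; rewrite dvdX_coef0 coefD coef1 coefZ => /eqP->.
  by rewrite mulr0 addr0 oner_eq0.
(* With n + 2 terms, those of order 0 and 1 in [s] can be split off for every n. *)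
pose Y s := cell (mob n.+2 Q P s).
have mobP s : Xn %| (1 + s *: (Q * P)) * mob n.+2 Q P s - P.
  by have := mob_mod 1 s XQP; rewrite addn1.
have Y0 : Y 0 = cell P.
  apply: cell_mod; have := mobP 0; by rewrite scale0r addr0 mul1r.
have Y1 : Y 1 = cell R.
  apply: cell_mod; apply: (modX_cancel (unit1 1)).
  have -> : (1 + 1 *: (Q * P)) * (mob n.+2 Q P 1 - R) =
    1 * ((1 + 1 *: (Q * P)) * mob n.+2 Q P 1 - P) +
    (-1) * ((1 + Q * P) * R - P) by rewrite scale1r; ring.
  exact: dvdp_lin.
rewrite -Y0 -Y1; apply/esym/exp_nil_flow; first exact: c_fnil.
  by apply: polyfun_exp; [apply: polyfun_mob | apply: polyfun_cst].
move=> c; set P' := mob n.+2 Q P c.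
have XQP' : 'X %| Q * P'.
  rewrite /P' /mob mulr_sumr; apply: (big_ind (fun p => 'X %| p)).
  - exact: dvdp0.
  - by move=> p q; apply: dvdp_add.
  move=> k _; rewrite -mul_polyC exprS.
  move: (_ ^+ k)%:P (Q ^+ k) (P ^+ k) => a b d.
  have -> : Q * (a * (b * (P * d))) = a * b * d * (Q * P) by ring.
  exact: dvdp_mull.
(* The flow property: the curve is restarted from the point P' reached at time [c]. *)
have mobP' s : Y (c + s) = cell (mob n.+2 Q P' s).
  apply: cell_mod; apply: (modX_cancel (unit1 (c + s))).
  have H1 := mobP (c + s); have H2 := mobP c; rewrite -/P' in H2.
  have H3 : Xn %| (1 + s *: (Q * P')) * mob n.+2 Q P' s - P'.
    by have := mob_mod 1 s XQP'; rewrite addn1.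
  move: H1 H2 H3; rewrite -!mul_polyC !polyCD.
  move: (mob _ _ _ _) (mob _ _ _ _) => S2 S1 H1 H2 H3.
  have -> : (1 + (c%:P + s%:P) * (Q * P)) * (S1 - S2) =
    ((1 + (c%:P + s%:P) * (Q * P)) * S1 - P) -
     (((1 + c%:P * (Q * P)) * ((1 + s%:P * (Q * P')) * S2 - P') -
      (s%:P * Q * S2 - 1) * ((1 + c%:P * (Q * P)) * P' - P))) by ring.
  by rewrite dvdp_sub ?dvdp_mull // dvdp_sub ?dvdp_mull.
(* The first order part - Q P'^2 is the vector field at P'; [t] collects the higher orders. *)
pose t s := \sum_(k < n) s ^+ k *: ((-1) ^+ k *: (Q ^+ k.+2 * P' ^+ k.+3)).
pose U s := - (Q * P' ^+ 2) + s *: t s.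
have mobU s : mob n.+2 Q P' s = s *: U s + P'.
  rewrite /mob !big_ord_recl /= /bump /= !add1n !expr0 !expr1 scale1r mul1r.
  rewrite addrC scalerDr scalerN scaleNr; congr (_ + _ + _).
  rewrite /t !scaler_sumr; apply: eq_bigr => k _; rewrite !add1n !scalerA.
  by congr (_ *: _); rewrite -[- s]mulN1r exprMn !exprS; ring.
have pet : polyfun (fun s => e (t s)).
  have : polyfun (fun s => \sum_(k < n) s ^+ k *: e ((-1) ^+ k *: (Q ^+ k.+2 * P' ^+ k.+3))).
    by apply: polyfun_sum => k _; apply: polyfunX; apply: polyfun_cst.
  apply: polyfun_ext => s; rewrite /t linear_sum; apply: eq_bigr => k _ /=.
  by rewrite [RHS]linearZ.
have pU : polyfun (fun s => e (U s)).
  apply: polyfun_ext (polyfunD (polyfun_cst (- e (Q * P' ^+ 2))) (polyfunX 1 pet)).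
  by move=> s; rewrite /U linearD linearN linearZ.
have [G pG GE] := exp_nil_second_order (cell P') (fun s => c_enil C (U s)) pU.
exists (fun s => e (t s) (cell P') + G s).
  by apply: polyfunD => //; apply: polyfun_app pet (polyfun_cst _).
move=> s; rewrite mobP' mobU cellD linearZ /= GE /Y -/P' cf_cell.
move: XQP'; rewrite dvdX_coef0 => /eqP->; rewrite mulr0 scale0r add0r.
rewrite /U linearD linearN linearZ /= add_lfunE opp_lfunE scale_lfunE.
by rewrite !scalerDr !addrA scalerA -expr2.
Qed.

Definition weight_vec k := dpow k (e 1) v.

(** A highest weight vector; u_A is a nonzero multiple of it by [u_highE]. *)
Definition top := weight_vec N.

Lemma ce_top : e 1 top = 0.
Proof.
apply: (scalerI (factr_neq0 N)); rewrite scaler0 -linearZ /top /weight_vec /dpow.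
by rewrite scalerA divff ?scale1r ?factr_neq0 // -iterS c_eN.
Qed.

Lemma ch_weight k : h 1 (weight_vec k) = (k.*2%:R - N%:R) *: weight_vec k.
Proof.
elim: k => [|k IH].
  by rewrite /weight_vec dpow0 c_hv coef1 mulr1 sub0r.
have k0 : k.+1%:R != 0 :> K by rewrite pnatr_eq0.
apply: (scalerI k0); rewrite -linearZ /= -dpowS c_he -/(weight_vec k) IH mul1r.
rewrite linearZ /= dpowS !scalerA -scalerDl; congr (_ *: _).
by rewrite doubleS -!natr1; ring.
Qed.

Lemma cf_weight k : f 1 (weight_vec k.+1) = (N%:R - k%:R) *: weight_vec k.
Proof.
have fe u : f 1 (e 1 u) = e 1 (f 1 u) - h 1 u by rewrite c_ef mul1r addrK.
elim: k => [|k IH].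
  have := dpowS 0 (e 1) v; rewrite scale1r /weight_vec => <-.
  rewrite fe dpow0 c_fv linear0 -[v](dpow0 (e 1)) ch_weight /weight_vec.
  by rewrite dpow0 sub0r -scaleNr; rewrite double0 sub0r opprK subr0.
have k0 : k.+2%:R != 0 :> K by rewrite pnatr_eq0.
apply: (scalerI k0); rewrite -linearZ /= -dpowS fe -/(weight_vec _) IH.
rewrite linearZ /= dpowS -/(weight_vec _) ch_weight -scaleNr !scalerA -scalerDl.
congr (_ *: _); rewrite -mulrDl; congr (_ / _).
by rewrite -addnn natrD -!natr1; ring.
Qed.

Lemma dpow_cf_top k : (k <= N)%N -> dpow k (f 1) top = weight_vec (N - k).
Proof.
elim: k => [|k IH] kN; first by rewrite dpow0 subn0.
have k0 : k.+1%:R != 0 :> K by rewrite pnatr_eq0.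
apply: (scalerI k0); rewrite -dpowS IH ?(ltnW kN) //.
rewrite -(subnSK kN) cf_weight; congr (_ *: _).
by rewrite -natrB ?leq_subr // subKn.
Qed.

Lemma iter_cf_top : iter N.+1 (f 1) top = 0.
Proof.
apply: (scalerI (factr_neq0 N)); rewrite scaler0.
have -> : iter N.+1 (f 1) top = f 1 (N`!%:R *: dpow N (f 1) top).
  by rewrite /dpow scalerA divff ?factr_neq0 // scale1r.
by rewrite dpow_cf_top // subnn /weight_vec dpow0 linearZ /= c_fv !scaler0.
Qed.

Lemma ce_const c : e c%:P = c *: e 1.
Proof. by rewrite -alg_polyC linearZ. Qed.

Lemma cf_const c : f c%:P = c *: f 1.
Proof. by rewrite -alg_polyC linearZ. Qed.

Lemma cell_const c : cell c%:P = \sum_(k < N.+1) c ^+ k *: weight_vec k.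
Proof.
rewrite /cell ce_const.
rewrite (@exp_nilE _ _ _ _ N.+1); first by apply: eq_bigr => k _; rewrite dpowZ.
  exact/nilpZ/c_enil.
apply: (scalerI (factr_neq0 N.+1)).
have := dpowZ N.+1 c (e 1) v; rewrite {2}/dpow c_eN scaler0 scaler0 => /eqP.
by rewrite scaler_eq0 invr_eq0 (negPf (factr_neq0 _)) => /eqP->.
Qed.

Lemma exp_cf_top c :
  exp_nil (f c%:P) top = \sum_(k < N.+1) c ^+ k *: weight_vec (N - k).
Proof.
rewrite cf_const.
rewrite (@exp_nilE _ _ _ _ N.+1).
- by apply: eq_bigr => k _; rewrite dpowZ dpow_cf_top // -ltnS.
- exact/nilpZ/c_fnil.
apply: (scalerI (factr_neq0 N.+1)).
have := dpowZ N.+1 c (f 1) top; rewrite {2}/dpow iter_cf_top scaler0 scaler0 => /eqP.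
by rewrite scaler_eq0 invr_eq0 (negPf (factr_neq0 _)) => /eqP->.
Qed.

(** Both sides run along the same rational normal curve, from opposite ends: reversing the sum
    replaces c by 1/c. *)
Lemma cell_const_top c : c != 0 ->
  cell c%:P = c ^+ N *: exp_nil (f (c^-1)%:P) top.
Proof.
move=> c0; rewrite cell_const exp_cf_top scaler_sumr.
rewrite (reindex_inj rev_ord_inj) /=; apply: eq_bigr => k _.
rewrite subSS [RHS]scalerA; congr (_ *: _).
have -> : c ^+ N = c ^+ (N - k) * c ^+ k by rewrite -exprD subnK // -ltnS.
by rewrite exprVn mulfK ?expf_neq0.
Qed.

Lemma exp_nil_intertwine (T X Y : 'End(V)) u : (forall x, T (X x) = Y (T x)) ->
  T (exp_nil X u) = exp_nil Y (T u).
Proof.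
move=> H; rewrite /exp_nil linear_sum; apply: eq_bigr => k _.
rewrite linearZ /=; congr (_ *: _); elim: (k : nat) => //= j <-; exact: H.
Qed.

(** The action of the matrix with rows (0, 1) and (-1, 0), written as a product of elementary
    matrices. *)
Definition weyl : 'End(V) :=
  (linfun (exp_nil (e 1)) \o linfun (exp_nil (- f 1)) \o linfun (exp_nil (e 1)))%VF.

Lemma weylE u : weyl u = exp_nil (e 1) (exp_nil (- f 1) (exp_nil (e 1) u)).
Proof. by rewrite !comp_lfunE !lfunE. Qed.

Lemma exp_e1_f P u : exp_nil (e 1) (f P u) =
  f P (exp_nil (e 1) u) + h P (exp_nil (e 1) u) - e P (exp_nil (e 1) u).
Proof.
rewrite (@exp_nil_conj K V (e 1) (f P) (h P) (- e P)) ?opp_lfunE //.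
- exact: c_enil.
- by move=> x; rewrite c_ef mul1r.
- by move=> x; rewrite c_he mulr1 opp_lfunE scalerN addrK.
- by move=> x; rewrite !opp_lfunE linearN /= c_ee.
Qed.

Lemma exp_e1_h P u : exp_nil (e 1) (h P u) =
  h P (exp_nil (e 1) u) - 2%:R *: e P (exp_nil (e 1) u).
Proof.
rewrite (@exp_nil_conj K V (e 1) (h P) (- (2%:R *: e P)) 0).
- by rewrite zero_lfunE addr0 opp_lfunE scale_lfunE.
- exact: c_enil.
- by move=> x; rewrite c_he mulr1 opp_lfunE scale_lfunE addrK.
- by move=> x; rewrite !opp_lfunE !scale_lfunE linearN linearZ /= c_ee zero_lfunE scaler0 addr0.
- by move=> x; rewrite !zero_lfunE linear0.
Qed.

Lemma exp_e1_e P u : exp_nil (e 1) (e P u) = e P (exp_nil (e 1) u).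
Proof. by rewrite exp_nil_commute // => x; apply: c_ee. Qed.

Lemma exp_f1_f P u : exp_nil (- f 1) (f P u) = f P (exp_nil (- f 1) u).
Proof. by rewrite exp_nil_commute // => x; rewrite !opp_lfunE linearN /= c_ff. Qed.

Lemma exp_f1_e P u : exp_nil (- f 1) (e P u) =
  e P (exp_nil (- f 1) u) + h P (exp_nil (- f 1) u) - f P (exp_nil (- f 1) u).
Proof.
rewrite (@exp_nil_conj K V (- f 1) (e P) (h P) (- f P)) ?opp_lfunE //.
- exact/nilpN/c_fnil.
- by move=> x; rewrite !opp_lfunE linearN /= c_ef mulr1 opprD addrNK.
- move=> x; rewrite !opp_lfunE linearN /= c_hf mulr1 scalerN.
  by rewrite opprB addrAC subrr add0r.
- by move=> x; rewrite !opp_lfunE !linearN /= c_ff.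
Qed.

Lemma exp_f1_h P u : exp_nil (- f 1) (h P u) =
  h P (exp_nil (- f 1) u) - 2%:R *: f P (exp_nil (- f 1) u).
Proof.
rewrite (@exp_nil_conj K V (- f 1) (h P) (- (2%:R *: f P)) 0).
- by rewrite zero_lfunE addr0 opp_lfunE scale_lfunE.
- exact/nilpN/c_fnil.
- move=> x; rewrite !opp_lfunE scale_lfunE linearN /= c_hf mulr1.
  by rewrite opprB addrAC subrr add0r.
- by move=> x; rewrite !opp_lfunE !scale_lfunE !linearN linearZ /= c_ff zero_lfunE scaler0 addr0.
- by move=> x; rewrite !zero_lfunE linear0.
Qed.

Lemma weyl_sum (a b c : V) : a + (b - 2%:R *: a) - (c + b - a) = - c.
Proof.
have -> : a + (b - 2%:R *: a) = b - a.
  by rewrite scaler_nat mulr2n opprD addrCA !addrA addrK.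
by rewrite -[c + b - a]addrA opprD addrCA subrr addr0.
Qed.

Lemma weyl_e P u : weyl (e P u) = - f P (weyl u).
Proof.
rewrite !weylE exp_e1_e exp_f1_e exp_nilB exp_nilDr exp_e1_e exp_e1_h exp_e1_f.
exact: weyl_sum.
Qed.

Lemma weyl_f P u : weyl (f P u) = - e P (weyl u).
Proof.
rewrite !weylE exp_e1_f exp_nilB (exp_nilDr (- f 1))  exp_f1_f exp_f1_h exp_f1_e weyl_sum.
by rewrite exp_nilN exp_e1_e.
Qed.

Lemma weyl_exp_e P u : weyl (exp_nil (e P) u) = exp_nil (f (- P)) (weyl u).
Proof. by apply: exp_nil_intertwine => x; rewrite weyl_e linearN opp_lfunE. Qed.

Lemma weyl_exp_f P u : weyl (exp_nil (f P) u) = exp_nil (e (- P)) (weyl u).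
Proof. by apply: exp_nil_intertwine => x; rewrite weyl_f linearN opp_lfunE. Qed.

(** By [cell_const_top] at c = 1, exp(e_0) v = exp(f_0) top; the factor exp(-f_0) undoes the latter,
    and e_0 kills [top]. *)
Lemma weyl_v : weyl v = top.
Proof.
rewrite weylE.
have -> : exp_nil (e 1) v = exp_nil (f 1) top.
  have := cell_const_top (oner_neq0 K).
  by rewrite /cell invr1 expr1n scale1r polyC1.
rewrite exp_nilKN; last exact: c_fnil.
by rewrite exp_nil_fix ?ce_top //; apply: c_enil.
Qed.

Definition cocell P := exp_nil (f P) top.

Lemma weyl_cell P : weyl (cell P) = cocell (- P).
Proof. by rewrite weyl_exp_e weyl_v. Qed.

Lemma moebius_nil_top Q P R : 'X %| P * Q -> Xn %| (1 + P * Q) * R - Q ->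
  exp_nil (e P) (cocell Q) = cocell R.
Proof.
move=> XPQ HR.
have := @moebius_nil (- P) (- Q) (- R).
rewrite mulrNN => /(_ XPQ); rewrite mulrN -opprD dvdpNr => /(_ HR).
by move=> /(congr1 weyl); rewrite weyl_exp_f !weyl_cell !opprK.
Qed.

(** The transition P -> 1/P between the charts. In P = c + y with y nilpotent, the constant c is
    inverted by [cell_const_top], and y acts on the result through [moebius_nil_top]. *)
Lemma cell_cocell P R : Xn %| P * R - 1 ->
  cell P = P`_0 ^+ N *: cocell R.
Proof.
move=> PR; have P0 : P`_0 != 0.
  have := modX_coef0 PR; rewrite coef1 coefM big_ord1 => /eqP.
  by apply: contraL => /eqP->; rewrite mul0r eq_sym oner_eq0.
set c := P`_0; pose y := P - c%:P.
have y0 : y`_0 = 0 by rewrite coefB coefC /= subrr.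
rewrite -[P](subrK c%:P) -/y cellD cell_const_top // exp_nilZ.
rewrite (@moebius_nil_top _ y R) //.
  by rewrite dvdX_coef0 coefM big_ord1 y0 mul0r.
have -> : (1 + y * (c^-1)%:P) * R - (c^-1)%:P = (c^-1)%:P * (P * R - 1).
  have cK : (c^-1)%:P * c%:P = 1 :> {poly K} by rewrite -polyCM mulVf.
  apply/eqP; rewrite -subr_eq0 (_ : _ - _ = (1 - (c^-1)%:P * c%:P) * R).
    by rewrite cK subrr mul0r.
  by rewrite /y; ring.
exact: dvdp_mull.
Qed.

Lemma weyl_cell_inv P R : Xn %| P * R - 1 ->
  weyl (cell P) = (- P`_0) ^+ N *: cell (- R).
Proof.
move=> PR; rewrite weyl_cell.
have RP : Xn %| (- R) * (- P) - 1 by rewrite mulrNN mulrC.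
rewrite (cell_cocell RP) scalerA coefN -exprMn mulrNN.
have := modX_coef0 PR; rewrite coef1 coefM big_ord1 /= => ->.
by rewrite expr1n scale1r.
Qed.

Lemma polyfun_cell P : polyfun (fun c => cell (P + c%:P)).
Proof.
apply: polyfun_exp (polyfun_cst _).
have : polyfun (fun c => e P + c ^+ 1 *: e 1).
  by apply: polyfunD; [apply: polyfun_cst | apply/polyfunX/polyfun_cst].
by apply: polyfun_ext => c; rewrite linearD /= ce_const.
Qed.

Lemma polyfun_cocell P : polyfun (fun c => cocell (P + c%:P)).
Proof.
apply: polyfun_exp (polyfun_cst _).
have : polyfun (fun c => f P + c ^+ 1 *: f 1).
  by apply: polyfunD; [apply: polyfun_cst | apply/polyfunX/polyfun_cst].
by apply: polyfun_ext => c; rewrite linearD /= cf_const.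
Qed.

(* Identities between polynomial functions of P only have to be checked for P_0 != 0. *)
Lemma cell_generic (W : vectType K) (Y : {poly K} -> W) P :
  polyfun (fun c => Y (P + c%:P)) -> (forall Q, Q`_0 != 0 -> Y Q = 0) -> Y P = 0.
Proof.
move=> pY Y0; have [P0|/Y0//] := eqVneq (P`_0) 0.
rewrite -[P]addr0 -polyC0; apply: (polyfun_eq0 pY) => c c0.
by apply: Y0; rewrite coefD coefC P0 add0r.
Qed.

(** For P_0 != 0 the substitution P -> -1/P is made twice, and the two multipliers combine to
    (-1)^N. *)
Lemma weyl2_cell P : weyl (weyl (cell P)) = (-1) ^+ N *: cell P.
Proof.
apply/eqP; rewrite -subr_eq0; apply/eqP.
apply: (@cell_generic V (fun P => weyl (weyl (cell P)) - (-1) ^+ N *: cell P)) => [|Q Q0].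
  apply: polyfunD.
    exact: (polyfun_lin weyl (polyfun_lin weyl (polyfun_cell P))).
  apply: (polyfun_lin [the {linear V -> V} of -%R]).
  exact: (polyfun_lin [the {linear V -> V} of *:%R ((-1) ^+ N : K)] (polyfun_cell P)).
have [R QR] := modX_inv Q0.
have RQ : Xn %| (- R) * (- Q) - 1 by rewrite mulrNN mulrC.
rewrite (weyl_cell_inv QR) linearZ /= (weyl_cell_inv RQ) !opprK scalerA -exprMn.
rewrite coefN opprK mulNr.
have := modX_coef0 QR; rewrite coef1 coefM big_ord1 /= => ->.
by rewrite subrr.
Qed.

(** For Q_0 != 0 the vector is a multiple of a cell vector; the remaining ones are limits of
    these. *)
Lemma incone_cocell Q : incone cell (cocell Q).
Proof.
have gen P : P`_0 != 0 -> incone cell (cocell P).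
  move=> P0; have [R PR] := modX_inv P0.
  have RP : Xn %| R * P - 1 by rewrite mulrC.
  have R0 : R`_0 != 0.
    have := modX_coef0 PR; rewrite coef1 coefM big_ord1 => /eqP.
    by apply: contraL => /eqP->; rewrite mulr0 eq_sym oner_eq0.
  have -> : cocell P = (R`_0 ^+ N)^-1 *: cell R.
    by rewrite (cell_cocell RP) scalerA mulVf ?scale1r // expf_neq0.
  exact/incone_scale/incone_id.
have [Q0|/gen//] := eqVneq (Q`_0) 0.
rewrite -[Q]addr0 -polyC0; apply: (incone_lim (polyfun_cocell Q)) => c c0.
by apply: gen; rewrite coefD coefC Q0 add0r.
Qed.

Lemma incone_weyl x : incone cell x -> incone cell (weyl x).
Proof.
apply: (incone_map (hommap_lfun weyl)) => P.
by rewrite weyl_cell; apply: incone_cocell.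
Qed.

(** Here (B, D) is the second column of a matrix g of G, which determines the line of g v: it has
    the coordinate B/D in the first chart if D is a unit, and D/B in the second one if B is a unit.
    The scalar is left free because only lines matter. *)
Definition in_orbit (B D : {poly K}) (x : V) : Prop :=
  (D`_0 != 0 /\ exists c P, [/\ c != 0, Xn %| P * D - B & x = c *: cell P]) \/
  (B`_0 != 0 /\ exists c Q, [/\ c != 0, Xn %| Q * B - D & x = c *: cocell Q]).

Lemma in_orbit_incone B D x : in_orbit B D x -> incone cell x.
Proof.
case=> [[_ [c [P [_ _ ->]]]]|[_ [c [P [_ _ ->]]]]]; apply: incone_scale.
  exact: incone_id.
exact: incone_cocell.
Qed.

Lemma in_orbit_exp_e P B D x : in_orbit B D x ->
  in_orbit (B + P * D) D (exp_nil (e P) x).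
Proof.
case=> [[D0 [c [Q [c0 QD ->]]]]|[B0 [c [Q [c0 QB ->]]]]].
  left; split=> //; exists c, (P + Q); split=> //; last by rewrite exp_nilZ cellD.
  by rewrite (_ : _ - _ = Q * D - B) //; ring.
have Q0D : D`_0 = Q`_0 * B`_0 by rewrite -(modX_coef0 QB) coefM big_ord1.
(* If D is a unit too, the vector is rewritten in the first chart, where exp(e(P)) is a translation;
   otherwise Q has no constant term and [moebius_nil_top] applies. *)
have [D0|D0] := eqVneq (D`_0) 0; last first.
  left; split=> //.
  have Q0 : Q`_0 != 0 by apply: contraNneq D0 => Q0; rewrite Q0D Q0 mul0r.
  have [R QR] := modX_inv Q0.
  have RQ : Xn %| R * Q - 1 by rewrite mulrC.
  have R0 : R`_0 != 0.
    have := modX_coef0 QR; rewrite coef1 coefM big_ord1 => /eqP.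
    by apply: contraL => /eqP->; rewrite mulr0 eq_sym oner_eq0.
  exists (c * (R`_0 ^+ N)^-1), (P + R); split.
  - by rewrite mulf_neq0 ?invr_eq0 ?expf_neq0.
  - have -> : (P + R) * D - (B + P * D) = B * (R * Q - 1) + (- R) * (Q * B - D) by ring.
    exact: dvdp_lin.
  - rewrite cellD (cell_cocell RQ) !exp_nilZ [RHS]scalerA -mulrA mulVf ?mulr1 //.
    by rewrite expf_neq0.
have Q0 : Q`_0 = 0.
  by apply/eqP; move: Q0D; rewrite D0 => /esym/eqP; rewrite mulf_eq0 (negPf B0) orbF.
have PQ0 : (P * Q)`_0 = 0 by rewrite coefM big_ord1 Q0 mulr0.
have u0 : (1 + P * Q)`_0 != 0 by rewrite coefD coef1 PQ0 addr0 oner_eq0.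
have [S uS] := modX_inv u0.
have RS : Xn %| (1 + P * Q) * (S * Q) - Q.
  by rewrite (_ : _ - _ = Q * ((1 + P * Q) * S - 1)) ?dvdp_mull //; ring.
right; split.
  by rewrite coefD coefM big_ord1 D0 mulr0 addr0.
exists c, (S * Q); split=> //; last first.
  by rewrite exp_nilZ (@moebius_nil_top _ _ (S * Q)) // dvdX_coef0 PQ0.
have -> : S * Q * (B + P * D) - D =
  B * ((1 + P * Q) * (S * Q) - Q) + (1 - S * Q * P) * (Q * B - D) by ring.
exact: dvdp_lin.
Qed.

Lemma in_orbit_weyl B D x : in_orbit B D x -> in_orbit (- D) B (weyl x).
Proof.
case=> [[D0 [c [Q [c0 QD ->]]]]|[B0 [c [Q [c0 QB ->]]]]].
  right; split; first by rewrite coefN oppr_eq0.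
  exists c, (- Q); split=> //; last by rewrite linearZ /= weyl_cell.
  by rewrite mulrNN.
left; split=> //; exists (c * (-1) ^+ N), (- Q); split.
- by rewrite mulf_neq0 // expf_neq0 // oppr_eq0 oner_eq0.
- by rewrite mulNr -opprD dvdpNr.
- by rewrite linearZ /= -[Q in LHS]opprK -weyl_cell weyl2_cell scalerA.
Qed.

Lemma weyl_inj : injective weyl.
Proof.
move=> x y; rewrite !weylE => /(congr1 (exp_nil (- e 1))).
rewrite !exp_nilKN; try exact: c_enil.
move=> /(congr1 (exp_nil (f 1))); rewrite !exp_nilNK; try exact: c_fnil.
by move=> /(congr1 (exp_nil (- e 1))); rewrite !exp_nilKN; try exact: c_enil.
Qed.

Lemma in_orbit_weyl_inv B D x : in_orbit (- D) B (weyl x) -> in_orbit B D x.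
Proof.
case=> [[B0 [c [Q [c0 QB wx]]]]|[D0 [c [Q [c0 QD wx]]]]].
  right; split=> //; exists (c * (-1) ^+ N), (- Q); split.
  - by rewrite mulf_neq0 // expf_neq0 // oppr_eq0 oner_eq0.
  - by rewrite mulNr -opprD dvdpNr -[D]opprK.
  apply: weyl_inj; rewrite wx linearZ /= -weyl_cell weyl2_cell scalerA -mulrA.
  by rewrite -exprMn mulrNN mulr1 expr1n mulr1.
left; split; first by move: D0; rewrite coefN oppr_eq0.
exists c, (- Q); split=> //; first by rewrite mulNr -mulrN.
by apply: weyl_inj; rewrite wx linearZ /= weyl_cell opprK.
Qed.

(** Conjugation by [weyl] turns f into -e, which reduces this to [in_orbit_exp_e]. *)
Lemma in_orbit_exp_f P B D x : in_orbit B D x ->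
  in_orbit B (D + P * B) (exp_nil (f P) x).
Proof.
move=> /in_orbit_weyl/(in_orbit_exp_e (- P)) H; apply: in_orbit_weyl_inv.
by rewrite weyl_exp_f opprD -mulNr.
Qed.

Lemma in_orbit_v : in_orbit 0 1 v.
Proof.
left; split; first by rewrite coef1 oner_eq0.
by exists 1, 0; rewrite oner_eq0 mul0r subr0 dvdp0 cell0 scale1r.
Qed.

End Moebius.

(** * The irreducible modules of sl_2 *)

Section IrrCoef.
Context {K : numFieldType} (a : nat).

Definition sl2_h : 'M[K]_2 := delta_mx ord0 ord0 - delta_mx ord_max ord_max.

Lemma irr_coef_e (k l : 'I_a) : irr_coef (@sl2_e K) k l = (l == k.+1 :> nat)%:R.
Proof. by rewrite /irr_coef !mxE /= !mul0r !mul0rn !addr0. Qed.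

Lemma irr_coef_f (k l : 'I_a) :
  irr_coef (@sl2_f K) k l = (k * (a - k))%:R *+ (k == l.+1 :> nat).
Proof. by rewrite /irr_coef !mxE /= mul1r !mul0r !mul0rn add0r addr0. Qed.

Lemma irr_coef_h (k l : 'I_a) :
  irr_coef sl2_h k l = (k.*2.+1%:R - a%:R) *+ (k == l).
Proof. by rewrite /irr_coef !mxE /= !subr0 mul1r !mul0r !mul0rn !add0r. Qed.

Definition irr_bracket (x y w : 'M[K]_2) := forall k l : 'I_a,
  \sum_(m < a) irr_coef x m l * irr_coef y k m =
  \sum_(m < a) irr_coef y m l * irr_coef x k m + irr_coef w k l.

Lemma irr_bracket_he : irr_bracket sl2_h (@sl2_e K) (2%:R *: @sl2_e K).
Proof.
move=> k l; rewrite (bigD1 l) //= big1 ?addr0 => [|m ml]; last first.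
  by rewrite irr_coef_h (negPf ml) mul0r.
rewrite [X in _ = X + _](bigD1 k) //= [X in _ = _ + X + _]big1 ?addr0 => [|m mk]; last first.
  by rewrite irr_coef_h eq_sym (negPf mk) mulr0.
have -> : irr_coef (2%:R *: @sl2_e K) k l = 2%:R * irr_coef (@sl2_e K) k l.
  by rewrite /irr_coef !mxE /= !(mulr0, mul0r, mul0rn, addr0) mulr1 mulr_natr mulrb; case: eqP => _; rewrite ?mulr1n ?mulr0.
rewrite !irr_coef_h !irr_coef_e !eqxx !mulr1n; case: eqP => [->|_].
  by rewrite doubleS -!natr1; ring.
by rewrite !(mulr0, mul0r) addr0.
Qed.

Lemma irr_bracket_hf : irr_bracket sl2_h (@sl2_f K) (- 2%:R *: @sl2_f K).
Proof.
move=> k l; rewrite (bigD1 l) //= big1 ?addr0 => [|m ml]; last first.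
  by rewrite irr_coef_h (negPf ml) mul0r.
rewrite [X in _ = X + _](bigD1 k) //= [X in _ = _ + X + _]big1 ?addr0 => [|m mk]; last first.
  by rewrite irr_coef_h eq_sym (negPf mk) mulr0.
have -> : irr_coef (- 2%:R *: @sl2_f K) k l = - 2%:R * irr_coef (@sl2_f K) k l.
  by rewrite /irr_coef !mxE /= !(mulr0, mul0r, mul0rn, addr0, add0r) mulr1 mul1r -mulrnAr.
rewrite !irr_coef_h !irr_coef_f !eqxx !mulr1n; case: eqP => [->|_].
  by rewrite doubleS -!natr1; ring.
by rewrite mulr0n; ring.
Qed.

Lemma irr_bracket_ef : irr_bracket (@sl2_e K) (@sl2_f K) sl2_h.
Proof.
move=> k l.
have -> : \sum_(m < a) irr_coef (@sl2_e K) m l * irr_coef (@sl2_f K) k m =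
    (k * (a - k))%:R *+ (k == l).
  case: k => [[|k] ka].
    by rewrite mul0n mul0rn big1 // => m _; rewrite irr_coef_f /= mulr0.
  rewrite (bigD1 (Ordinal (ltnW ka))) //= big1 ?addr0 => [|m mk].
    by rewrite irr_coef_e irr_coef_f /= eqxx mulr1n -val_eqE /= eq_sym mulr_natl mulrb.
  rewrite irr_coef_f /= eqSS (_ : (k == m)%N = false) ?mulr0 //.
  by move: mk; rewrite -val_eqE /= eq_sym => /negPf.
have -> : \sum_(m < a) irr_coef (@sl2_f K) m l * irr_coef (@sl2_e K) k m =
    (k.+1 * (a - k.+1))%:R *+ (k == l).
  have [ka|ka] := ltnP k.+1 a.
    rewrite (bigD1 (Ordinal ka)) //= big1 ?addr0 => [|m mk].
      by rewrite irr_coef_e irr_coef_f /= eqxx mulr1 eqSS -val_eqE.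
    rewrite irr_coef_e; case: eqP => [mE|_]; last by rewrite mulr0.
    by move: mk; rewrite -val_eqE /= mE eqxx.
  (* At the highest vector, which e kills, the expected coefficient (k + 1)(a - k - 1) is 0 as
     well. *)
  rewrite (_ : a - k.+1 = 0)%N; last by lia.
  rewrite muln0 mul0rn big1 // => m _; rewrite irr_coef_e.
  case: eqP => [mE|_]; last by rewrite mulr0.
  by have := ltn_ord m; rewrite mE ltnNge ka.
rewrite irr_coef_h -mulrnDl; congr (_ *+ _).
have ka : (k.+1 <= a)%N by [].
rewrite !natrM !natrB ?(ltnW ka) //; rewrite -addnn -!natr1 natrD; ring.
Qed.

Lemma irr_bracket_xx x : irr_bracket x x 0.
Proof. by move=> k l; rewrite /irr_coef !mxE !mul0r !mul0rn !addr0. Qed.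

End IrrCoef.

(** * Commutation relations on the tensor product of evaluation modules *)

Section Tens.
Context {K : numFieldType} {n : nat} {a : 'I_n -> nat}.
Local Notation T := (tens (K := K) a).
Implicit Types (x y : 'M[K]_2) (u : T) (J : tindex a).

Definition fac i x u : T :=
  [ffun J : tindex a => \sum_(k < a i) irr_coef x k (J i) * u (tsubst J k)].

Lemma fac_linear i x : linear (fac i x).
Proof.
move=> c u v; apply/ffunP => J; rewrite !ffunE /GRing.scale /= mulr_sumr -big_split.
by apply: eq_bigr => k _; rewrite !ffunE mulrDr mulrCA.
Qed.
HB.instance Definition _ i x := GRing.isLinear.Build K T T _ (fac i x) (fac_linear i x).

Lemma tsubst_in J i (k : 'I_(a i)) : tsubst J k i = k.
Proof. by rewrite ffunE dfwith_in. Qed.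

Lemma tsubst_out J i (k : 'I_(a i)) j : i != j -> tsubst J k j = J j.
Proof. by move=> ij; rewrite ffunE dfwith_out. Qed.

Lemma tsubst2 J i (k m : 'I_(a i)) : tsubst (tsubst J m) k = tsubst J k.
Proof.
apply/ffunP => j; have [<-|ij] := eqVneq i j; first by rewrite !tsubst_in.
by rewrite !tsubst_out.
Qed.

Lemma tsubstC J i j (k : 'I_(a i)) (m : 'I_(a j)) : i != j ->
  tsubst (tsubst J m) k = tsubst (tsubst J k) m.
Proof.
move=> ij; apply/ffunP => l; have [il|il] := eqVneq i l.
  by subst l; rewrite tsubst_in tsubst_out 1?eq_sym // tsubst_in.
have [jl|jl] := eqVneq j l; first by subst l; rewrite tsubst_in tsubst_out // tsubst_in.
by rewrite !tsubst_out.
Qed.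

Lemma fac_comm i j x y u : i != j -> fac i x (fac j y u) = fac j y (fac i x u).
Proof.
move=> ij; apply/ffunP => J; rewrite !ffunE.
under eq_bigr => k _.
  rewrite ffunE mulr_sumr.
  under eq_bigr => m _ do rewrite tsubst_out // mulrCA -(tsubstC _ _ _ ij).
  over.
rewrite exchange_big; apply: eq_bigr => m _; rewrite ffunE mulr_sumr.
by apply: eq_bigr => k _; rewrite tsubst_out 1?eq_sym // mulrCA.
Qed.

Lemma fac_bracket i x y w u : @irr_bracket K (a i) x y w ->
  fac i x (fac i y u) = fac i y (fac i x u) + fac i w u.
Proof.
move=> B; have aux (x' y' : 'M[K]_2) J : fac i x' (fac i y' u) J =
    \sum_(k < a i) (\sum_(m < a i) irr_coef x' m (J i) * irr_coef y' k m) * u (tsubst J k).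
  rewrite ffunE; under eq_bigr => m _.
    rewrite ffunE mulr_sumr tsubst_in.
    under eq_bigr => k _ do rewrite tsubst2 mulrA.
    over.
  by rewrite exchange_big; apply: eq_bigr => k _; rewrite mulr_suml.
apply/ffunP => J; rewrite [RHS]ffunE !aux [fac i w u J]ffunE -big_split.
by apply: eq_bigr => k _; rewrite B mulrDl.
Qed.

Section Points.
Variable z : 'I_n -> K.
Local Notation act := (tens_act (a := a) z).

Lemma tens_actE x j u : act x j u = \sum_i z i ^+ j *: fac i x u.
Proof.
by apply/ffunP => J; rewrite ffunE sum_ffunE; apply: eq_bigr => i _; rewrite !ffunE.
Qed.

(** Operators on distinct factors commute, and on the factor p the two scalars multiply to z_p^(i +
    j). *)
Lemma tens_act_bracket x y w i j u : (forall l, @irr_bracket K (a l) x y w) ->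
  act x i (act y j u) = act y j (act x i u) + act w (i + j) u.
Proof.
move=> B; rewrite ![act x i _]tens_actE ![act y j _]tens_actE [act w _ _]tens_actE.
rewrite (eq_bigr (fun p => \sum_q (z p ^+ i * z q ^+ j) *: fac p x (fac q y u))); last first.
  by move=> p _; rewrite linear_sum scaler_sumr; apply: eq_bigr => q _; rewrite linearZ scalerA.
rewrite [X in X + _](eq_bigr (fun q => \sum_p (z p ^+ i * z q ^+ j) *: fac q y (fac p x u))); last first.
  by move=> q _; rewrite linear_sum scaler_sumr; apply: eq_bigr => p _; rewrite linearZ scalerA mulrC.
rewrite [X in X + _]exchange_big -big_split; apply: eq_bigr => p _ /=.
rewrite (bigD1 p) //= [X in _ = X + _](bigD1 p) //= (fac_bracket _ (B p)) scalerDr.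
rewrite -exprD addrAC; congr (_ + _ + _); apply: eq_bigr => q qp.
by rewrite fac_comm // eq_sym.
Qed.

Lemma tens_act_decomp x j u : act x j u = x ord0 ord_max *: act sl2_e j u +
  x ord_max ord0 *: act sl2_f j u + x ord0 ord0 *: act sl2_h j u.
Proof.
rewrite !tens_actE !scaler_sumr -!big_split; apply: eq_bigr => i _ /=.
apply/ffunP => J; rewrite !ffunE /GRing.scale /= !mulr_sumr -!big_split.
apply: eq_bigr => k _ /=; rewrite irr_coef_e irr_coef_f irr_coef_h /irr_coef.
by do 3!case: eqP => _; rewrite ?mulr1n ?mulr0n; ring.
Qed.

End Points.
End Tens.

(** * The filtration, words in the e_j, and homogeneous components of exponentials *)

Section Words.
Context {K : numFieldType} {n : nat} {a : 'I_n -> nat} (z : 'I_n -> K).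
Local Notation T := (tens (K := K) a).
Local Notation act := (tens_act (a := a) z).
Local Notation low := (low_tens (K := K) a).
Implicit Types (u : T) (J : tindex a) (phi : {linear T -> K^o}).

Lemma tr_e : \tr (@sl2_e K) = 0.
Proof. by rewrite /mxtrace !big_ord_recl big_ord0 !mxE /= !addr0. Qed.

Lemma tr_f : \tr (@sl2_f K) = 0.
Proof. by rewrite /mxtrace !big_ord_recl big_ord0 !mxE /= !addr0. Qed.

Lemma tr_h : \tr (@sl2_h K) = 0.
Proof. by rewrite /mxtrace !big_ord_recl big_ord0 !mxE /= !subr0 sub0r addr0 subrr. Qed.

Lemma tens_act_scale c x j u : act (c *: x) j u = c *: act x j u.
Proof. by rewrite !(tens_act_decomp _ (c *: x)) (tens_act_decomp _ x) !mxE !scalerDr !scalerA. Qed.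

Lemma tens_act0 j u : act 0 j u = 0.
Proof. by rewrite tens_act_decomp !mxE !scale0r !addr0. Qed.

Lemma tens_actZr c x j u : act x j (c *: u) = c *: act x j u.
Proof. exact: linearZ. Qed.

Lemma act_ee i j u : act (@sl2_e K) i (act (@sl2_e K) j u) = act (@sl2_e K) j (act (@sl2_e K) i u).
Proof.
rewrite (@tens_act_bracket _ _ _ _ _ _ 0) ?tens_act0 ?addr0 // => l.
exact: irr_bracket_xx.
Qed.

Lemma act_ff i j u : act (@sl2_f K) i (act (@sl2_f K) j u) = act (@sl2_f K) j (act (@sl2_f K) i u).
Proof.
rewrite (@tens_act_bracket _ _ _ _ _ _ 0) ?tens_act0 ?addr0 // => l.
exact: irr_bracket_xx.
Qed.

Lemma act_ef i j u : act (@sl2_e K) i (act (@sl2_f K) j u) =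
  act (@sl2_f K) j (act (@sl2_e K) i u) + act (@sl2_h K) (i + j) u.
Proof. by apply: tens_act_bracket => l; apply: irr_bracket_ef. Qed.

Lemma act_he i j u : act (@sl2_h K) i (act (@sl2_e K) j u) =
  act (@sl2_e K) j (act (@sl2_h K) i u) + 2%:R *: act (@sl2_e K) (i + j) u.
Proof. by rewrite -tens_act_scale; apply: tens_act_bracket => l; apply: irr_bracket_he. Qed.

Lemma act_hf i j u : act (@sl2_h K) i (act (@sl2_f K) j u) =
  act (@sl2_f K) j (act (@sl2_h K) i u) - 2%:R *: act (@sl2_f K) (i + j) u.
Proof.
rewrite -scaleNr -tens_act_scale.
by apply: tens_act_bracket => l; apply: irr_bracket_hf.
Qed.

Lemma low_tsubst J i (k : 'I_(a i)) : low (tsubst J k) != 0 -> k = 0%N :> nat.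
Proof.
rewrite ffunE; case: (boolP [forall l, tsubst J k l == 0%N :> nat]); last by rewrite eqxx.
move=> /forallP H _.
by apply/eqP; have := H i; rewrite tsubst_in.
Qed.

Lemma fac_f_low i : fac i (@sl2_f K) low = 0.
Proof.
apply/ffunP => J; rewrite !ffunE big1 // => k _.
have [->|/low_tsubst k0] := eqVneq (low (tsubst J k)) 0; first by rewrite mulr0.
by rewrite irr_coef_f k0 mul0n mul0rn mul0r.
Qed.

Lemma tsubst_id J i : tsubst J (J i) = J.
Proof.
apply/ffunP => j; have [<-|ij] := eqVneq i j; first by rewrite tsubst_in.
by rewrite tsubst_out.
Qed.

Lemma fac_h_low i : fac i (@sl2_h K) low = (1 - (a i)%:R) *: low.
Proof.
apply/ffunP => J; rewrite ffunE (bigD1 (J i)) //= big1 ?addr0 => [|k kJ]; last first.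
  by rewrite irr_coef_h (negPf kJ) mul0r.
rewrite irr_coef_h eqxx mulr1n tsubst_id [RHS]ffunE /GRing.scale /=.
have [->|] := eqVneq (low J) 0; first by rewrite !mulr0.
by rewrite -{1}(tsubst_id J i) => /low_tsubst->.
Qed.

Lemma act_f_low j : act (@sl2_f K) j low = 0.
Proof. by rewrite tens_actE big1 // => i _; rewrite fac_f_low scaler0. Qed.

Lemma act_h_low j :
  act (@sl2_h K) j low = (\sum_i z i ^+ j * (1 - (a i)%:R)) *: low.
Proof.
by rewrite tens_actE scaler_suml; apply: eq_bigr => i _; rewrite fac_h_low scalerA.
Qed.

Definition eword (I : seq nat) : T := foldr (fun j u => act (@sl2_e K) j u) low I.

(* Membership in the span of the e-words of degree at most s, tested on linear forms. *)
Definition espan s u := forall phi,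
  (forall I, (sumn I <= s)%N -> phi (eword I) = 0) -> phi u = 0.

Lemma espanD s u v : espan s u -> espan s v -> espan s (u + v).
Proof. by move=> Hu Hv phi H; rewrite linearD /= Hu // Hv // addr0. Qed.

Lemma espanZ s c u : espan s u -> espan s (c *: u).
Proof. by move=> Hu phi H; rewrite linearZ /= Hu // scaler0. Qed.

Lemma espan_mono s t u : (s <= t)%N -> espan s u -> espan t u.
Proof. by move=> st Hu phi H; apply: Hu => I /leq_trans/(_ st)/H. Qed.

Lemma espan_word I : espan (sumn I) (eword I).
Proof. by move=> phi; apply. Qed.

Lemma espan_act s j x u : (forall I, espan (sumn I + j) (act x j (eword I))) ->
  espan s u -> espan (s + j) (act x j u).
Proof.
move=> H Hu phi phi0.
apply: (Hu [the {linear T -> K^o} of phi \o act x j]) => I Is /=.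
by apply: (espan_mono _ (H I)) phi0; rewrite leq_add2r.
Qed.

Lemma espan_e s j u : espan s u -> espan (s + j) (act (@sl2_e K) j u).
Proof. by apply: espan_act => I; rewrite addnC; apply: (@espan_word (j :: I)). Qed.

Lemma espan_h_word j I : espan (sumn I + j) (act (@sl2_h K) j (eword I)).
Proof.
elim: I => [|i I IH] /=.
  by rewrite act_h_low; apply/espanZ/(espan_mono (leq0n _))/(@espan_word [::]).
rewrite act_he; apply: espanD.
  by rewrite [(i + _)%N]addnC addnAC; apply: espan_e.
apply: espanZ; apply: (espan_mono _ (@espan_word ((j + i)%N :: I))).
by rewrite /=; lia.
Qed.

(** The operator f is moved to the right until it kills the lowest vector; the commutators h (x)
    t^(i + j) preserve the total degree. *)
Lemma espan_f_word j I : espan (sumn I + j) (act (@sl2_f K) j (eword I)).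
Proof.
elim: I => [|i I IH] /=.
  by rewrite act_f_low => phi _; rewrite linear0.
have -> : act (@sl2_f K) j (act (@sl2_e K) i (eword I)) =
   act (@sl2_e K) i (act (@sl2_f K) j (eword I)) + (-1) *: act (@sl2_h K) (i + j) (eword I).
  by rewrite act_ef scaleN1r addrK.
apply: espanD.
  by rewrite [(i + _)%N]addnC addnAC; apply: espan_e.
apply: espanZ; rewrite [(i + sumn I)%N]addnC -addnA; exact: espan_h_word.
Qed.

(** A filtered Poincare-Birkhoff-Witt argument: applied to words in the e_j, the operators f and h
    raise the degree by no more than their own. *)
Lemma filt_espan s u : filt z s u -> espan s u.
Proof.
move=> [r [c [w [wP ->]]]] phi phi0; rewrite linear_sum big1 // => k _.
rewrite linearZ; have /andP[wt ws] := wP k.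
suff -> : phi (word_act a z (w k)) = 0 by rewrite /= scaler0.
apply: (espan_mono ws) phi0; elim: (w k) {wt ws} => [|[x j] w' IH] /=.
  exact: (@espan_word [::]).
rewrite addnC tens_act_decomp; apply: espanD; [apply: espanD|]; apply: espanZ.
- exact: espan_e.
- by apply: espan_act IH => I; apply: espan_f_word.
- by apply: espan_act IH => I; apply: espan_h_word.
Qed.

Lemma filt_low s : filt (a := a) z s low.
Proof.
exists 1%N, (fun=> 1), (fun=> [::]); split=> //.
by rewrite big_ord1 scale1r.
Qed.

Lemma filt_mono s t u : (s <= t)%N -> filt (a := a) z s u -> filt z t u.
Proof. by move=> /subnK <-; elim: (t - s)%N => // k IH /IH; apply: filtS. Qed.

Lemma filt_sum s I (r : seq I) (P : pred I) (F : I -> T) :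
  (forall i, P i -> filt z s (F i)) -> filt z s (\sum_(i <- r | P i) F i).
Proof.
move=> H; apply: big_ind => [|x y fx fy|//]; first exact: filt0.
by rewrite -[x]scale1r; apply: filt_lin.
Qed.

Lemma filtZ s c u : filt (a := a) z s u -> filt z s (c *: u).
Proof. by move=> fu; rewrite -[_ *: _]addr0; apply: filt_lin => //; apply: filt0. Qed.

Lemma filt_eword I : filt (a := a) z (sumn I) (eword I).
Proof.
elim: I => [|j I IH] /=; first exact: filt_low.
by rewrite addnC; apply: filt_act IH; apply: tr_e.
Qed.

Definition size_index J := (\sum_i J i)%N.

Lemma size_tsubst J i (k : 'I_(a i)) :
  (size_index (tsubst J k) + J i = size_index J + k)%N.
Proof.
rewrite /size_index (bigD1 i) //= [in RHS](bigD1 i) //= tsubst_in.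
rewrite [LHS]addnAC [RHS]addnAC; congr (_ + _)%N; first by rewrite addnC.
by apply: eq_bigr => j ji; rewrite tsubst_out // eq_sym.
Qed.

Lemma size_index_le J : (size_index J <= \sum_i (a i).-1)%N.
Proof. by apply: leq_sum => i _; have := ltn_ord (J i); lia. Qed.

(** Vectors supported in large weights, and in small weights for [f_level]. Each e, respectively
    each f, raises the level by one, which bounds the nilpotency order uniformly. *)
Definition e_level k u := forall J, (size_index J < k)%N -> u J = 0.
Definition f_level k u := forall J, (\sum_i (a i).-1 < size_index J + k)%N -> u J = 0.

Lemma e_level_act k j u : e_level k u -> e_level k.+1 (act (@sl2_e K) j u).
Proof.
move=> H J Jk; rewrite ffunE big1 // => i _; rewrite big1 ?mulr0 // => m _.
rewrite irr_coef_e; case: eqP => [Jm|_]; last by rewrite mul0r.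
by rewrite H ?mulr0 //; have := size_tsubst J m; lia.
Qed.

Lemma f_level_act k j u : f_level k u -> f_level k.+1 (act (@sl2_f K) j u).
Proof.
move=> H J Jk; rewrite ffunE big1 // => i _; rewrite big1 ?mulr0 // => m _.
rewrite irr_coef_f; case: eqP => [Jm|_]; last by rewrite mul0r.
by rewrite H ?mulr0 //; have := size_tsubst J m; lia.
Qed.

Lemma e_level_top u : e_level (\sum_i (a i).-1).+1 u -> u = 0.
Proof. by move=> H; apply/ffunP => J; rewrite H ?ffunE // ltnS size_index_le. Qed.

Lemma f_level0 u : f_level 0 u.
Proof. by move=> J; rewrite addn0 ltnNge size_index_le. Qed.

Lemma f_level_top u : f_level (\sum_i (a i).-1).+1 u -> u = 0.
Proof. by move=> H; apply/ffunP => J; rewrite H ?ffunE // addnS ltnS leq_addl. Qed.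

(* The homogeneous components of degree s of the vectors [dpow k _ low]. *)
Fixpoint ecomp (P : {poly K}) k s : T :=
  if k is k'.+1 then
    (k'.+1%:R)^-1 *: \sum_(j < s.+1) P`_j *: act (@sl2_e K) j (ecomp P k' (s - j)%N)
  else if s is 0 then low else 0.

Lemma filt_comp P k s : filt z s (ecomp P k s).
Proof.
elim: k s => [|k IH] s; first by case: s => [|s]; [apply: filt_low | apply: filt0].
rewrite [ecomp _ _ _]/=; apply: filtZ; apply: filt_sum => j _; apply: filtZ.
have js : (s - j + j <= s)%N by rewrite subnK // -ltnS.
by apply: (filt_mono js); apply: filt_act; [exact: tr_e | exact: IH].
Qed.

(** Used with [symb M] for [sigma] and with the multiplication by t^s on the tensor product, so that
    the same components describe E(P) and the curves in the tensor product. The bound on [S] makes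
    the sum exhaust all degrees that occur. *)
Lemma dpow_comp (V : vectType K) (sigma : nat -> {linear T -> V})
    (X : nat -> 'End(V)) (P : {poly K}) (nP : (size P <= n)%N) :
  (forall s j u, filt z s u -> X j (sigma s u) = sigma (s + j)%N (act (@sl2_e K) j u)) ->
  forall k S, (k * n < S)%N ->
  dpow k (\sum_(j < n) P`_j *: X j) (sigma 0%N low) = \sum_(s < S) sigma s (ecomp P k s).
Proof.
move=> HX; elim=> [|k IH] S kS.
  case: S kS => // S _; rewrite dpow0 big_ord_recl big1 ?addr0 // => s _.
  by rewrite linear0.
have k0 : k.+1%:R != 0 :> K by rewrite pnatr_eq0.
apply: (scalerI k0); rewrite -dpowS.
pose g j s := P`_j *: sigma (s + j)%N (act (@sl2_e K) j (ecomp P k s)).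
rewrite scaler_sumr (eq_bigr (fun s : 'I_S => \sum_(j < s.+1) g j (s - j)%N)); last first.
  move=> s _ /=; rewrite linearZ /= scalerA divff // scale1r linear_sum.
  by apply: eq_bigr => j _; rewrite linearZ /= /g subnK // -ltnS.
rewrite (sum_triangle g).
have nS : (n <= S)%N by move: kS; rewrite mulSn; lia.
rewrite -(big_mkord xpredT (fun j => \sum_(s < S - j) g j s)) (big_cat_nat (leq0n _) nS) /=.
rewrite [X in _ = _ + X]big_nat_cond [X in _ = _ + X]big1 ?addr0; last first.
  move=> j; rewrite andbT => /andP[nj _]; apply: big1 => s _.
  by rewrite /g nth_default ?scale0r // (leq_trans nP).
rewrite big_mkord sum_lfunE; apply: eq_bigr => j _.
rewrite scale_lfunE (IH (S - j)%N); last first.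
  by have := ltn_ord j; move: kS; rewrite mulSn; lia.
rewrite linear_sum scaler_sumr; apply: eq_bigr => s _.
by rewrite /= HX; [|exact: filt_comp].
Qed.

End Words.

(** The inverse of a Vandermonde matrix: the weights [L] recover the coefficient of index j of a
    polynomial of degree less than m from its values. *)
Lemma dual_points (K : fieldType) m (x : 'I_m -> K) : injective x ->
  exists L : 'I_m -> 'I_m -> K,
  forall j l : 'I_m, \sum_i L i j * x i ^+ l = (l == j)%:R.
Proof.
move=> xI; pose A := Vandermonde m (\row_i x i).
have uA : A \in unitmx.
  rewrite unitmxE det_Vandermonde unitfE; apply/prodf_neq0 => i _.
  apply/prodf_neq0 => j ij; rewrite !mxE subr_eq0.
  by apply: contraTneq ij => /xI->; rewrite ltnn.
exists (fun i j => invmx A i j) => j l.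
have := congr1 (fun M : 'M_m => M l j) (mulmxV uA); rewrite !mxE => <-.
by apply: eq_bigr => i _; rewrite !mxE mulrC.
Qed.

(** * Linear forms on the tensor product and their order along curves *)

Section TensCoords.
Context {K : numFieldType} {n : nat} {a : 'I_n -> nat} (z : 'I_n -> K).
Local Notation T := (tens (K := K) a).
Local Notation act := (tens_act (a := a) z).
Local Notation low := (low_tens (K := K) a).
Local Notation N := (\sum_i (a i).-1)%N.
Implicit Types (u : T) (J : tindex a) (q : nat -> K).

(** The length [m] is free, because on the tensor product, unlike on M, the operators e_j with j >=
    n need not vanish. *)
Definition XT m q : 'End(T) :=
  \sum_(j < m) q j *: linfun [the {linear T -> T} of act (@sl2_e K) j].

Lemma XTE m q u : XT m q u = \sum_(j < m) q j *: act (@sl2_e K) j u.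
Proof. by rewrite sum_lfunE; apply: eq_bigr => j _; rewrite scale_lfunE lfunE. Qed.

Lemma eq_XT m q q' : (forall l, (l < m)%N -> q l = q' l) -> XT m q = XT m q'.
Proof. by move=> H; apply: eq_bigr => l _; rewrite H. Qed.

Lemma e_levelD k u v : e_level k u -> e_level k v -> e_level k (u + v).
Proof. by move=> Hu Hv J Jk; rewrite ffunE Hu // Hv // addr0. Qed.

Lemma e_levelZ k c u : e_level k u -> e_level k (c *: u).
Proof. by move=> Hu J Jk; rewrite ffunE Hu // scaler0. Qed.

Lemma XT_top m q u : iter N.+1 (XT m q) u = 0.
Proof.
apply: e_level_top.
elim: N.+1 => [|k IH]; first by move=> J.
rewrite iterS XTE; apply: big_ind => [J _||j _]; first by rewrite ffunE.
  exact: e_levelD.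
by apply: e_levelZ; apply: e_level_act.
Qed.

Lemma XT_nil m q : nilend (XT m q).
Proof. by exists N.+1 => u; apply: XT_top. Qed.

Lemma XT_comm m q m' q' : commute_end (XT m q) (XT m' q').
Proof.
move=> u; rewrite !XTE.
rewrite (eq_bigr (fun j : 'I_m => \sum_(i < m') (q j * q' i) *: act (@sl2_e K) j (act (@sl2_e K) i u))); last first.
  by move=> j _; rewrite linear_sum scaler_sumr; apply: eq_bigr => i _; rewrite linearZ scalerA.
rewrite exchange_big; apply: eq_bigr => i _; rewrite linear_sum scaler_sumr.
by apply: eq_bigr => j _; rewrite linearZ scalerA mulrC /= act_ee.
Qed.

Definition monval (y : 'I_n -> K) J : K := \prod_i (y i ^+ J i / (J i)`!%:R).

Definition pts m q i : K := \sum_(j < m) q j * z i ^+ j.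

Lemma XT_coord m q u J : XT m q u J =
  \sum_i pts m q i * \sum_(k < a i) (J i == k.+1 :> nat)%:R * u (tsubst J k).
Proof.
rewrite XTE sum_ffunE.
under [RHS]eq_bigr => i _ do rewrite mulr_suml.
rewrite exchange_big; apply: eq_bigr => j _; rewrite !ffunE /GRing.scale /= mulr_sumr.
apply: eq_bigr => i _; rewrite mulrA; congr (_ * _); apply: eq_bigr => k _.
by rewrite irr_coef_e.
Qed.

Lemma monval_tsubst y J i (k : 'I_(a i)) : J i = k.+1 :> nat ->
  y i * monval y (tsubst J k) = (J i)%:R * monval y J.
Proof.
move=> Jk; rewrite /monval !(bigD1 (P := xpredT) i) //= tsubst_in Jk !mulrA.
congr (_ * _); last by apply: eq_bigr => j ji; rewrite tsubst_out // eq_sym.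
rewrite factS natrM invfM exprS; field.
by rewrite nat1r !pnatr_eq0 -lt0n fact_gt0.
Qed.

(** On each factor e shifts the basis, so the coordinates are divided powers of the values of the
    curve [q] at the z_i. *)
Lemma dpow_XT k m q J :
  dpow k (XT m q) low J = (size_index J == k)%:R * monval (pts m q) J.
Proof.
elim: k J => [|k IH] J.
  rewrite dpow0 ffunE /size_index sum_nat_eq0 /=.
  case: (boolP [forall i, _]) => [/forallP H|_]; last by rewrite mul0r.
  rewrite mul1r /monval big1 // => i _.
  by rewrite (eqP (H i)) expr0 fact0 divr1.
have k0 : k.+1%:R != 0 :> K by rewrite pnatr_eq0.
have := congr1 (fun u : T => u J) (dpowS k (XT m q) low).
rewrite [RHS]ffunE XT_coord => H; apply: (mulfI k0); rewrite -[LHS]H {H}.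
rewrite (eq_bigr (fun i => (size_index J == k.+1)%:R * monval (pts m q) J * (J i)%:R)).
  rewrite -mulr_sumr -natr_sum -/(size_index J) mulrC.
  by case: eqP => [->//|_]; rewrite !mul0r !mulr0.
move=> i _; case E : (nat_of_ord (J i)) => [|j].
  by rewrite mulr0 big1 ?mulr0 // => k' _; rewrite mul0r.
have ja : (j < a i)%N by rewrite -ltnS -E ltnW // ltnS.
rewrite (bigD1 (Ordinal ja)) //= eqxx mul1r big1 ?addr0; last first.
  by move=> k' k'j; rewrite eqSS eq_sym (_ : (k' == j :> nat) = false) ?mul0r //; apply: negPf k'j.
rewrite IH mulrCA monval_tsubst // E -mulrA [_ * j.+1%:R]mulrC.
congr (_%:R * _); congr (nat_of_bool _).
by have /= := size_tsubst J (Ordinal ja); rewrite E; lia.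
Qed.

Lemma exp_XT m q J : exp_nil (XT m q) low J = monval (pts m q) J.
Proof.
have nX := XT_nil m q.
rewrite (exp_nilE (B := N.+1) nX); last first.
  have : dpow N.+1 (XT m q) low = 0.
    apply/ffunP => I; rewrite dpow_XT ffunE ltn_eqF ?mul0r //.
    by rewrite ltnS size_index_le.
  by move=> /eqP; rewrite scaler_eq0 invr_eq0 (negPf (factr_neq0 _)) => /eqP.
rewrite sum_ffunE (bigD1 (Ordinal (n := N.+1) (size_index_le J))) //= big1 ?addr0.
  by rewrite dpow_XT eqxx mul1r.
move=> k kJ; rewrite dpow_XT (_ : (_ == _) = false) ?mul0r //.
by apply: negbTE; apply: contra kJ => /eqP kJ; apply/eqP/val_inj.
Qed.

(* The coordinates of exp(sum_j q_j e_j) low are the monomials in the values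
   [pts m q i] of the curve q at the z_i, of degree less than a_i in the i-th. *)
Definition representable (F : ('I_n -> K) -> K) :=
  exists lam : 'Hom(T, K^o), forall m q, lam (exp_nil (XT m q) low) = F (pts m q).

Lemma representable_sum I (r : seq I) (c : I -> K) (F : I -> ('I_n -> K) -> K) :
  (forall i, representable (F i)) ->
  representable (fun y => \sum_(i <- r) c i * F i y).
Proof.
move=> H; elim: r => [|i r [lam lamE]].
  by exists 0 => m q; rewrite big_nil zero_lfunE.
have [mu muE] := H i; exists (c i *: mu + lam) => m q.
by rewrite big_cons add_lfunE scale_lfunE lamE muE.
Qed.

Definition tcoord J u : K^o := u J.

Lemma tcoord_linear J : linear (tcoord J).
Proof. by move=> c u v; rewrite /tcoord !ffunE. Qed.
HB.instance Definition _ J :=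
  GRing.isLinear.Build K T K^o _ (tcoord J) (tcoord_linear J).

Lemma representable_mon (k : 'I_n -> nat) : (forall i, k i < a i)%N ->
  representable (fun y => \prod_i y i ^+ k i).
Proof.
move=> ka; pose J : tindex a := [ffun i => Ordinal (ka i)].
exists (\prod_i (k i)`!%:R *: linfun (tcoord J)) => m q.
rewrite scale_lfunE lfunE /= /tcoord exp_XT /GRing.scale /= -big_split; apply: eq_bigr => i _.
by rewrite ffunE /= mulrC divfK // pnatr_eq0 -lt0n fact_gt0.
Qed.

Lemma representable_mpoly (p : {mpoly K[n]}) :
  (forall mm, mm \in msupp p -> forall i, (mm i < a i)%N) ->
  representable (fun y => p.@[y]).
Proof.
move=> H.
have [|lam lamE] := @representable_sum _ (msupp p)
    (fun mm => if mm \in msupp p then p@_mm else 0)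
    (fun mm y => if mm \in msupp p then \prod_i y i ^+ mm i else 0).
  move=> mm; case mmp: (mm \in msupp p); first exact: representable_mon (H _ mmp).
  by exists 0 => m q; rewrite zero_lfunE.
exists lam => m q; rewrite lamE mevalE; apply: eq_big_seq => mm ->.
by [].
Qed.

(** The notion dual to the filtration: along these curves e_j has degree j, and a form of order at
    least d kills every F_s with s < d by [order_ge_filt]. *)
Definition order_ge (d : nat) (lam : {linear T -> K^o}) := forall m q,
  exists R : {poly K}, forall t,
  lam (exp_nil (XT m (fun j => t ^+ j * q j)) low) = t ^+ d * R.[t].

Lemma polyfun_XT m q : polyfun (fun t => XT m (fun j => t ^+ j * q j)).
Proof.
apply: polyfun_sum => j _.
apply: polyfun_ext (polyfunX j (polyfun_cst (q j *: linfun [the {linear T -> T} of act (@sl2_e K) j]))).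
by move=> t; rewrite scalerA.
Qed.

(** Adding s to q_j changes the exponent by s t^j e_j. The part linear in s of the resulting values
    is t^j times the value of [lam] on e_j applied to the curve, and it is still divisible by
    t^d. *)
Lemma order_ge_act d j lam : (j <= d)%N -> order_ge d lam ->
  order_ge (d - j) [the {linear T -> K^o} of lam \o act (@sl2_e K) j].
Proof.
move=> jd H m q.
have pF : polyfun (fun t => exp_nil (XT m (fun j => t ^+ j * q j)) low).
  by apply: polyfun_exp; [apply: polyfun_XT | apply: polyfun_cst].
have [F FE] := polyfun_coef pF [the {linear T -> K^o} of lam \o act (@sl2_e K) j].
(* The weights [v] pick the coefficient of s out of the values at s = 0, ..., D - 1 of a polynomial
   of degree less than D. The choice of D exceeds both 1 and the nilpotency order of e_j. *)
pose D := (\dim {:T}).+2.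
have [v vE] : exists v : 'I_D -> K, forall l : 'I_D,
    \sum_i v i * (i%:R) ^+ l = (l == 1%N :> nat)%:R.
  have [|L LE] := @dual_points K D (fun i => i%:R).
    by move=> i k /eqP; rewrite eqr_nat => /eqP/val_inj.
  by exists (fun i => L i (Ordinal (isT : 1 < D)%N)) => l; rewrite LE.
pose qs s l := (if (l < m)%N then q l else 0) + s * (l == j)%:R.
pose M := maxn m j.+1.
have /fin_all_exists[R RE] (i : 'I_D) := H M (qs i%:R).
have XTs s t : XT M (fun l => t ^+ l * qs s l) =
    (s * t ^+ j) *: linfun [the {linear T -> T} of act (@sl2_e K) j] +
    XT m (fun l => t ^+ l * q l).
  rewrite /XT (eq_bigr (fun l : 'I_M =>
     (if (l < m)%N then (t ^+ l * q l) *: linfun [the {linear T -> T} of act (@sl2_e K) l] else 0) +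
     (if l == j :> nat then (s * t ^+ l) *: linfun [the {linear T -> T} of act (@sl2_e K) l] else 0))).
    have jM : (j < M)%N by rewrite leq_maxr.
    rewrite big_split addrC /= -!big_mkcond; congr (_ + _); last by rewrite (big_pred1 (Ordinal jM)).
    by rewrite [RHS](big_ord_widen M (fun l => (t ^+ l * q l) *: linfun [the {linear T -> T} of act (@sl2_e K) l])) ?leq_maxl.
  move=> l _; rewrite /qs mulrDr scalerDl; congr (_ + _).
    by case: ifP => // _; rewrite mulr0 scale0r.
  by case: eqP => _ /=; [rewrite mulr1 mulrC | rewrite !mulr0 scale0r].
have nE : nilend (linfun [the {linear T -> T} of act (@sl2_e K) j]).
  have := XT_nil j.+1 (fun l => (l == j)%:R); congr nilend.
  rewrite /XT big_ord_recr /= eqxx scale1r big1 ?add0r // => l _.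
  by rewrite ltn_eqF // scale0r.
have key t : t ^+ j * F.[t] = t ^+ d * (\sum_i v i *: R i).[t].
  rewrite horner_sum mulr_sumr -FE.
  rewrite (eq_bigr (fun i => v i * lam (exp_nil (XT M (fun l => t ^+ l * qs i%:R l)) low))); last first.
    by move=> i _; rewrite RE hornerZ mulrCA.
  set E0 := exp_nil (XT m _) low.
  have nE' : nilend (t ^+ j *: linfun [the {linear T -> T} of act (@sl2_e K) j]).
    exact: nilpZ.
  rewrite (eq_bigr (fun i : 'I_D => \sum_(l < D) (v i * i%:R ^+ l) *
     lam (dpow l (t ^+ j *: linfun [the {linear T -> T} of act (@sl2_e K) j]) E0))).
    rewrite exchange_big /=.
    under [RHS]eq_bigr => l _ do rewrite -mulr_suml vE.
    rewrite (bigD1 (Ordinal (isT : 1 < D)%N)) //= big1 ?addr0 => [|l l1]; last first.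
      by rewrite (_ : (l == 1 :> nat)%N = false) ?mul0r //; apply: negbTE.
    by rewrite mul1r /dpow invr1 scale1r /= scale_lfunE lfunE linearZ.
  move=> i _; rewrite XTs exp_nilD //; first last.
  - move=> u; rewrite !scale_lfunE !linearZ /=; congr (_ *: _).
    have := XT_comm j.+1 (fun l => (l == j)%:R) m (fun l => t ^+ l * q l) u.
    rewrite !(XTE j.+1) !big_ord_recr /= !eqxx !scale1r !big1 ?add0r ?lfunE // => l _;
    by rewrite ltn_eqF // scale0r.
  - exact: XT_nil.
  - exact: nilpZ.
  rewrite -/E0 -scalerA (@exp_nilE _ _ _ _ D); last first.
  + rewrite /D iterS iterS nilp_dim ?linear0 //; exact: nilpZ.
  + exact: nilpZ.
  rewrite linear_sum mulr_sumr; apply: eq_bigr => l _.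
  by rewrite dpowZ linearZ /= mulrA.
exists (\sum_i v i *: R i) => t /=; rewrite [LHS]FE.
have : 'X^j * F = 'X^j * ('X^(d - j) * \sum_i v i *: R i).
  apply: poly_eq_nonzero => s _; rewrite mulrA -exprD subnKC // !hornerM !hornerXn.
  exact: key.
have Xj0 : 'X^j != 0 :> {poly K} by rewrite expf_neq0 // polyX_eq0.
by move=> /(mulfI Xj0)->; rewrite hornerM hornerXn.
Qed.

Lemma order_ge_low d lam : (0 < d)%N -> order_ge d lam -> lam low = 0.
Proof.
move=> d0 /(_ 0%N (fun=> 0))[R /(_ 0)].
by rewrite /XT big_ord0 exp_nil0 => ->; rewrite expr0n gtn_eqF // mul0r.
Qed.

(** Each letter e_j of a word is moved into the form, at the cost of j in the order. *)
Lemma order_ge_filt d lam s u : (s < d)%N -> order_ge d lam -> filt z s u ->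
  lam u = 0.
Proof.
move=> sd H /filt_espan; apply=> I Is.
have {sd Is} : (sumn I < d)%N by apply: leq_ltn_trans sd.
elim: I d lam H => [|j I IH] d lam H /= Id; first exact: order_ge_low H.
apply: (IH (d - j)%N [the {linear T -> K^o} of lam \o act (@sl2_e K) j]); last by lia.
by apply: order_ge_act => //; lia.
Qed.

End TensCoords.

(** * Minors of Toeplitz matrices as functions of a polynomial *)

Section ToeplitzMinors.
Context {K : numFieldType}.
Implicit Types (P Q : {poly K}) (w : {poly K} -> K) (m : nat -> nat).

(** The minor with rows 0, ..., s - 1 and columns j_0, ..., j_(s-1) of the upper triangular Toeplitz
    matrix of P; the columns may be unordered or repeated. *)
Definition tmin (s : nat) (j : nat -> nat) P : K :=
  \det (\matrix_(a < s, b < s) if (a <= j b)%N then P`_(j b - a) else 0).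

Lemma tmin_ext s j j' P : (forall b, (b < s)%N -> j b = j' b) ->
  tmin s j P = tmin s j' P.
Proof. by move=> H; congr (\det _); apply/matrixP => a b; rewrite !mxE H. Qed.

Lemma tmin_nil j P : tmin 0 j P = 1. Proof. exact: det_mx00. Qed.

(** The column of index 0 is P_0 times the first basis vector; deleting it together with the first
    row shifts the other columns by one. *)
Lemma tmin_cons0 s j P :
  tmin s.+1 (fun b => if b is b'.+1 then (j b').+1 else 0%N) P = P`_0 * tmin s j P.
Proof.
rewrite /tmin (expand_det_col _ ord0) big_ord_recl big1 ?addr0 => [|i _].
  rewrite mxE /cofactor expr0 mul1r; congr (_ * \det _).
  by apply/matrixP => a b; rewrite !mxE /= /bump /= !add1n ltnS subSS.
by rewrite mxE mul0r.
Qed.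

Lemma tmin_shift s j Q : tmin s (fun b => (j b).+1) (Q * 'X) = tmin s j Q.
Proof.
congr (\det _); apply/matrixP => a b; rewrite !mxE coefMX.
case: (leqP a (j b)) => [ab|ab]; first by rewrite (leqW ab) subSn.
by case: ifP => // ab'; rewrite (_ : (j b).+1 - a = 0)%N //; lia.
Qed.

Lemma tmin_hole s j Q b : (b < s)%N -> j b = 0%N -> tmin s j (Q * 'X) = 0.
Proof.
move=> bs jb; rewrite /tmin (expand_det_col _ (Ordinal bs)) big1 // => i _.
by rewrite mxE /= jb leqn0; case: eqP => [->|_]; rewrite ?subn0 ?coefMX mul0r.
Qed.

(** The column of index 0 is supported in the first row, so a second copy of it makes the minor
    vanish. *)
Lemma tmin_zeros s j : (forall b, (b < s)%N -> j b = 0%N) ->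
  [\/ forall P, tmin s j P = 1, forall P, tmin s j P = P`_0 | forall P, tmin s j P = 0].
Proof.
case: s => [|[|s]] j0; first by constructor 1 => P; rewrite tmin_nil.
  by constructor 2 => P; rewrite /tmin det_mx11 mxE j0.
constructor 3 => P; rewrite /tmin (expand_det_row _ (Ordinal (ltn0Sn s : 1 < s.+2)%N)).
by rewrite big1 // => i _; rewrite mxE j0 // mul0r.
Qed.

Lemma tmin_poly s j P : exists q : {poly K}, forall c, tmin s j (P + c%:P) = q.[c].
Proof.
exists (\det (\matrix_(a < s, b < s) if (a <= j b)%N then
   (P`_(j b - a))%:P + (if (j b - a == 0)%N then 'X else 0) else 0)) => c.
rewrite -[RHS]/(horner_eval c _) -det_map_mx; congr (\det _).
apply/matrixP => a b; rewrite !mxE; case: ifP => _; last by rewrite raddf0.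
rewrite /= /horner_eval coefD coefC; by case: eqP => _; rewrite !hornerE.
Qed.

(* The functions spanning the dual of a fusion product: [m k] is the number of
   the a_i greater than k + 1, and one minor of the upper triangular Toeplitz
   matrix of size [m k] is chosen for each k. *)
Definition minors B m w := exists (s : nat -> nat) (j : nat -> nat -> nat),
  (forall k b, (k < B)%N -> (b < s k)%N -> (j k b < m k)%N) /\
  forall P, w P = \prod_(k < B) tmin (s k) (j k) P.

Lemma minors1 B m : minors B m (fun=> 1).
Proof.
exists (fun=> 0%N), (fun _ _ => 0%N); split=> // P.
by rewrite big1 // => k _; rewrite tmin_nil.
Qed.

Lemma minors_mono B m m' w : (forall k, (k < B)%N -> (m k <= m' k)%N) ->
  minors B m w -> minors B m' w.
Proof.
move=> mm' [s [j [jm wE]]]; exists s, j; split=> // k b kB bs.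
exact: leq_trans (jm k b kB bs) (mm' k kB).
Qed.

Lemma minors_poly B m w P : minors B m w ->
  exists q : {poly K}, forall c, w (P + c%:P) = q.[c].
Proof.
move=> [s [j [_ wE]]].
have /fin_all_exists[q qE] (k : 'I_B) := tmin_poly (s k) (j k) P.
exists (\prod_k q k) => c; rewrite wE horner_prod; apply: eq_bigr => k _.
exact: qE.
Qed.

Lemma minors_lift B m w' : minors B (fun k => (m k).-1) w' ->
  exists2 w, minors B m w & forall Q, w (Q * 'X) = w' Q.
Proof.
move=> [s [j [jm wE]]].
exists (fun P => \prod_(k < B) tmin (s k) (fun b => (j k b).+1) P).
  exists s, (fun k b => (j k b).+1); split=> // k b kB bs.
  by have := jm k b kB bs; lia.
by move=> Q; rewrite wE; apply: eq_bigr => k _; rewrite tmin_shift.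
Qed.

(** A minor that uses the column of index 0 vanishes at the multiples of X; in all others each
    column index drops by one. *)
Lemma minors_restrict B m w : minors B m w ->
  (forall Q, w (Q * 'X) = 0) \/ minors B (fun k => (m k).-1) (fun Q => w (Q * 'X)).
Proof.
move=> [s [j [jm wE]]].
have [/existsP[k /existsP[b /eqP jkb]]|] :=
    boolP [exists k : 'I_B, exists b : 'I_(s k), j k b == 0%N].
  left=> Q; rewrite wE (bigD1 k) //= (tmin_hole _ (ltn_ord b)) ?mul0r //.
move=> /existsPn H; right; exists s, (fun k b => (j k b).-1); split=> [k b kB bs|Q].
  have /existsPn/(_ (Ordinal bs))/= := H (Ordinal kB).
  by have := jm k b kB bs; lia.
rewrite wE; apply: eq_bigr => k _; rewrite -[RHS]tmin_shift; apply: tmin_ext => b bs.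
have /existsPn/(_ (Ordinal bs))/= := H k.
by move=> h; rewrite prednK // lt0n.
Qed.

Lemma minors_incr B m m' k0 w : (k0 < B)%N -> m' k0 = (m k0).+1 ->
  (forall k, k != k0 -> m' k = m k) -> minors B m w ->
  minors B m' (fun P => P`_0 * w P).
Proof.
move=> k0B mk0 mk [s [j [jm wE]]].
exists (fun k => if k == k0 then (s k).+1 else s k).
exists (fun k => if k == k0 then fun b => if b is b'.+1 then (j k b').+1 else 0%N
        else j k); split=> [k b kB|P].
  case: eqP => [->|/eqP kk0]; last by rewrite mk //; apply: jm.
  by rewrite mk0; case: b => // b; rewrite !ltnS; apply: jm.
rewrite wE [RHS](bigD1 (Ordinal k0B)) //= eqxx tmin_cons0 -mulrA; congr (_ * _).
rewrite (bigD1 (Ordinal k0B)) //=; congr (_ * _).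
by apply: eq_bigr => k; rewrite -val_eqE /= => /negPf->.
Qed.

(** In a matrix of size one the only column index is 0, and [tmin_zeros] lists the resulting
    factors. *)
Lemma minors_decr B m m' k0 w : (k0 < B)%N -> m' k0 = 1%N -> m k0 = 0%N ->
  (forall k, k != k0 -> m' k = m k) -> minors B m' w ->
  exists2 w1, minors B m w1 &
  [\/ w =1 w1, w =1 (fun P => P`_0 * w1 P) | w =1 (fun=> 0)].
Proof.
move=> k0B mk0 mk0' mk [s [j [jm wE]]].
exists (fun P => \prod_(k < B) tmin (if k == k0 :> nat then 0 else s k)%N (j k) P).
  exists (fun k => if k == k0 then 0%N else s k), j; split=> // k b kB.
  by case: eqP => // /eqP kk0; rewrite -mk //; apply: jm.
have j0 b : (b < s k0)%N -> j k0 b = 0%N.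
  by move=> /(jm k0 b k0B); rewrite mk0; case: (j k0 b).
have E P : w P = tmin (s k0) (j k0) P *
    \prod_(k < B) tmin (if k == k0 :> nat then 0 else s k)%N (j k) P.
  rewrite wE [X in _ = _ * X](bigD1 (Ordinal k0B)) //= eqxx tmin_nil mul1r.
  rewrite (bigD1 (Ordinal k0B)) //=; congr (_ * _).
  by apply: eq_bigr => k; rewrite -val_eqE /= => /negPf->.
case: (tmin_zeros j0) => h.
- by constructor 1 => P; rewrite E h mul1r.
- by constructor 2 => P; rewrite E h.
- by constructor 3 => P; rewrite E h mul0r.
Qed.

Definition indep N (w : 'I_N -> {poly K} -> K) :=
  forall c : 'I_N -> K, (forall P, \sum_i c i * w i P = 0) -> forall i, c i = 0.

(** The conjugate partition of A without its first part. *)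
Definition column (A : seq nat) k := count (fun x => (k.+1 < x)%N) A.

Lemma column_perm A A' k : perm_eq A A' -> column A k = column A' k.
Proof. by move=> /seq.permP; apply. Qed.

(** Induction along x p = p + (x - 1) p, where x is a largest part and p the product of the other
    ones. The first p functions are lifted from A without x and are seen at the multiples of X; the
    others are P_0 times those of A with x lowered by one, and vanish there. *)
Lemma minors_indep A B N : all (fun x => (x <= B.+1)%N) A -> N = (\prod_(x <- A) x)%N ->
  exists2 w : 'I_N -> {poly K} -> K, (forall i, minors B (column A) (w i)) & indep w.
Proof.
have [S] := ubnP (sumn A); elim: S => // S IH in A N *; rewrite ltnS => AS AB.
case: (boolP (all (fun x => (x <= 1)%N) A)) => [A1|].
  have : (\prod_(x <- A) x <= 1)%N.
    elim: (A) A1 => [|x A' IHA] /=; first by rewrite big_nil.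
    by move=> /andP[x1 /IHA h]; rewrite big_cons -[1%N]muln1 leq_mul.
  move=> N1 NE; rewrite -NE in N1; exists (fun _ _ => 1) => [i|c H i].
    exact: minors1.
  case: N NE N1 c H i => [|[|//]] _ _ c H i; first by case: i.
  by have := H 0; rewrite big_ord1 mulr1 (ord1 i).
rewrite -has_predC => /hasP[x0 x0A /= x01].
have [x xA xmax] : exists2 x, x \in A & all (fun y => (y <= x)%N) A.
  have h : (index x0 A < size A)%N by rewrite index_mem.
  have [i _ imax] := @arg_maxnP _ (Ordinal h) xpredT (fun i => nth 0%N A i) isT.
  exists (nth 0%N A i); first exact: mem_nth.
  by apply/(all_nthP 0%N) => k kA; apply: (imax (Ordinal kA)).
have x2 : (1 < x)%N.
  rewrite -ltnNge in x01; by apply: leq_trans x01 _; apply: (allP xmax).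
have Ax := perm_to_rem xA; set A' := rem x A in Ax.
have A'x : all (fun y => (y <= x)%N) A'.
  by apply/allP => y /mem_rem/(allP xmax).
have xB : (x <= B.+1)%N by exact: (allP AB).
have A'B : all (fun y => (y <= B.+1)%N) A'.
  by apply/allP => y /mem_rem/(allP AB).
have sumA : sumn A = (x + sumn A')%N by rewrite (perm_sumn Ax).
rewrite (perm_big _ Ax) big_cons => NE.
set p' := (\prod_(y <- A') y)%N in NE.
have NE2 : N = (p' + x.-1 * p')%N by rewrite NE; case: (x) x2 => // y _; rewrite mulSn.
have S1 : (sumn A' < S)%N by lia.
have S2 : (sumn (x.-1 :: A') < S)%N by rewrite /=; lia.
have B2 : all (fun y => (y <= B.+1)%N) (x.-1 :: A') by rewrite /= A'B andbT; lia.
have [w' w'M w'I] := IH A' p' S1 A'B erefl.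
have [|w'' w''M w''I] := IH (x.-1 :: A') (x.-1 * p')%N S2 B2; first by rewrite big_cons.
(* As x is a largest part, the columns of index at least x - 1 are empty, so removing x lowers every
   nonempty column by one. *)
have lift i : exists w, minors B (column A) w /\ forall Q, w (Q * 'X) = w' i Q.
  have [|w wM wE] := @minors_lift B (column A) (w' i); last by exists w.
  apply: minors_mono (w'M i) => k _; rewrite (column_perm k Ax) /column /=.
  case: ltnP => // xk; rewrite add0n.
  suff -> : count (fun y => (k.+1 < y)%N) A' = 0%N by [].
  apply/eqP; rewrite -leqn0 leqNgt -has_count; apply/hasPn => y /(allP A'x) /=.
  by lia.
have /fin_all_exists[l /all_and2[lM lE]] := lift.
have rM i : minors B (column A) (fun P => P`_0 * w'' i P).
  apply: (@minors_incr B (column (x.-1 :: A')) _ x.-2) (w''M i).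
  - by lia.
  - rewrite (column_perm _ Ax) /column /= (_ : x.-2.+1 < x)%N; last by lia.
    by rewrite (_ : (x.-2.+1 < x.-1)%N = false) //; lia.
  - move=> k kx; rewrite (column_perm _ Ax) /column /=.
    by congr (nat_of_bool _ + _)%N; lia.
clear NE; subst N; exists (fun i => match split i with
    | inl i1 => l i1 | inr i2 => fun P => P`_0 * w'' i2 P end).
  by move=> i; case: (split i).
move=> c H.
have {}H P : \sum_i c (lshift _ i) * l i P +
    P`_0 * (\sum_i c (rshift _ i) * w'' i P) = 0.
  rewrite -[RHS](H P) big_split_ord mulr_sumr; congr (_ + _); apply: eq_bigr => i _.
    by rewrite -[lshift _ _]/(unsplit (inl i)) unsplitK.
  by rewrite -[rshift _ _]/(unsplit (inr i)) unsplitK mulrCA.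
(* At the multiples of X the second half vanishes, and the first one is independent by induction. *)
have c1 : forall i, c (lshift _ i) = 0.
  apply: w'I => Q; have := H (Q * 'X); rewrite coefMX eqxx mul0r addr0 => sum0.
  by rewrite -[RHS]sum0; apply: eq_bigr => i _; rewrite lE.
(* The factor P_0 cancels where it is nonzero; the case P_0 = 0 follows because the functions are
   polynomial in the constant term. *)
have c2 : forall i, c (rshift _ i) = 0.
  apply: w''I => P.
  have H2 Q : Q`_0 != 0 -> \sum_i c (rshift _ i) * w'' i Q = 0.
    move=> Q0; have := H Q; rewrite big1 ?add0r => [|i _]; last by rewrite c1 mul0r.
    by move=> /eqP; rewrite mulf_eq0 (negPf Q0) => /eqP.
  have /fin_all_exists[q qE] i := minors_poly (P - (P`_0)%:P) (w''M i).
  have q0 : \sum_i c (rshift _ i) *: q i = 0.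
    apply: poly_eq0_nonzero => d d0; rewrite -[RHS](H2 (P - (P`_0)%:P + d%:P)).
      by rewrite horner_sum; apply: eq_bigr => i _; rewrite hornerZ qE.
    by rewrite !coefD coefN !coefC eqxx subrr add0r.
  have := congr1 (fun r => r.[P`_0]) q0; rewrite horner0 horner_sum => sum0.
  by rewrite -[RHS]sum0; apply: eq_bigr => i _; rewrite hornerZ -qE subrK.
move=> i; rewrite -(splitK i); case: (split i) => j; [exact: c1 | exact: c2].
Qed.

End ToeplitzMinors.

(** * Bounds on the degree in each variable *)

Section DegreeBounds.
Context {K : fieldType} {n : nat}.
Implicit Types (p : {mpoly K[n]}) (b : 'I_n -> nat).

Definition deg_le b p := forall mm, mm \in msupp p -> forall i, (mm i <= b i)%N.

Lemma deg_le_sum b I (r : seq I) (P : pred I) (F : I -> {mpoly K[n]}) :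
  (forall i, P i -> deg_le b (F i)) -> deg_le b (\sum_(i <- r | P i) F i).
Proof.
move=> H; apply: big_ind => [mm|x y Hx Hy mm|//]; first by rewrite msupp0.
by move=> /msuppD_le; rewrite mem_cat => /orP[/Hx|/Hy].
Qed.

Lemma deg_leZ b c p : deg_le b p -> deg_le b (c *: p).
Proof. by move=> H mm /msuppZ_le/H. Qed.

Lemma deg_leM b1 b2 p q : deg_le b1 p -> deg_le b2 q ->
  deg_le (fun i => b1 i + b2 i)%N (p * q).
Proof.
move=> H1 H2 mm /msuppM_le/allpairsP[[m1 m2] /= [/H1 h1 /H2 h2 ->]] i.
by rewrite mnmDE leq_add.
Qed.

Lemma deg_le_weak b1 b2 p : (forall i, (b1 i <= b2 i)%N) -> deg_le b1 p -> deg_le b2 p.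
Proof. by move=> H Hp mm /Hp h i; apply: leq_trans (h i) (H i). Qed.

Lemma deg_le1 b : deg_le b 1.
Proof. by move=> mm; rewrite msupp1 inE => /eqP-> i; rewrite mnm0E. Qed.

Lemma deg_le_prod I (r : seq I) (b : I -> 'I_n -> nat) (F : I -> {mpoly K[n]}) :
  (forall k, deg_le (b k) (F k)) ->
  deg_le (fun i => \sum_(k <- r) b k i)%N (\prod_(k <- r) F k).
Proof.
move=> H; elim: r => [|k r IH]; first by rewrite big_nil; apply: deg_le1.
rewrite big_cons; apply: deg_le_weak (deg_leM (H k) IH) => i.
by rewrite big_cons.
Qed.

(* A determinant whose columns' entries are linear forms sum_i c_(a,i) L_(i,b) X_i
   has degree at most 1 in each variable, by the Cauchy-Binet expansion. *)
Lemma deg_le_det m s (g : 'I_m -> 'I_n) (c : 'I_s -> 'I_m -> K) (L : 'I_m -> 'I_s -> K) :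
  injective g ->
  deg_le (fun i => (i \in codom g) : nat)
    (\det (\matrix_(x < s, y < s) \sum_i (c x i * L i y) *: 'X_(g i))).
Proof.
move=> gI.
have -> : \det (\matrix_(x < s, y < s) \sum_i (c x i * L i y) *: 'X_(g i)) =
  \sum_(phi : {ffun 'I_s -> 'I_m})
    (\prod_x c x (phi x) * \det (\matrix_(x, y) L (phi x) y)) *:
    \prod_x 'X_(g (phi x)) :> {mpoly K[n]}.
  rewrite /determinant.
  under [LHS]eq_bigr => sg _.
    under eq_bigr => x _ do rewrite mxE.
    rewrite bigA_distr_bigA /= mulr_sumr.
    over.
  rewrite exchange_big; apply: eq_bigr => phi _ /=.
  rewrite mulr_sumr scaler_suml; apply: eq_bigr => sg _.
  rewrite scaler_prod big_split /= mulr_sign.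
  have -> : \prod_x (\matrix_(x < s, y < s) L (phi x) y) x (sg x) =
      \prod_x L (phi x) (sg x) by apply: eq_bigr => x _; rewrite mxE.
  by rewrite mulrCA -[RHS]scalerA scaler_sign.
apply: deg_le_sum => phi _.
have [/injectiveP phiI|/injectivePn[x [y xy phixy]]] := boolP (injectiveb phi); last first.
  rewrite [\det _](determinant_alternate xy) ?mulr0 ?scale0r => [mm|k].
    by rewrite msupp0.
  by rewrite !mxE phixy.
apply: deg_leZ => mm.
have -> : \prod_x 'X_(g (phi x)) = 'X_[\sum_x U_(g (phi x))] :> {mpoly K[n]}.
  by rewrite (big_morph _ (@mpolyXD _ K) (@mpolyX0 _ K)).
rewrite msuppX inE => /eqP-> i; rewrite mnm_sumE.
have [/codomP[k ik]|ig] := boolP (i \in codom g); last first.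
  rewrite big1 // => x _; rewrite mnm1E; case: eqP => // gi.
  by rewrite -gi codom_f in ig.
have [/existsP[x /eqP xk]|/existsPn kphi] := boolP [exists x, phi x == k].
  rewrite (bigD1 x) //= big1 ?addn0 ?mnm1E ?leq_b1 // => y yx.
  by rewrite mnm1E ik -xk (inj_eq gI) (inj_eq phiI) (negPf yx).
by rewrite big1 // => x _; rewrite mnm1E ik (inj_eq gI) (negPf (kphi x)).
Qed.

End DegreeBounds.

(** * Minors as lowest order terms of linear forms on the tensor product *)

Section MinorsRep.
Context {K : numFieldType} {n : nat} {a : 'I_n -> nat} (z : 'I_n -> K).
Hypothesis zI : injective z.
Hypothesis a_gt0 : forall i, (0 < a i)%N.

Definition acol k := column [seq a i | i <- enum 'I_n] k.

Lemma acolE k : acol k = #|[pred i | (k.+1 < a i)%N]|.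
Proof.
rewrite /acol /column count_map cardE -size_filter enumT /enum_mem.
by congr (size _); apply: eq_filter => i.
Qed.

(* The lowest order term along t |-> (t^j p_j) of a suitable polynomial in the
   values at the z_i is the given Toeplitz minor. *)
Lemma tmin_lowest k s j : (forall b, (b < s)%N -> (j b < acol k)%N) ->
  exists f : {mpoly K[n]}, exists c d : nat,
  deg_le (fun i => (k.+1 < a i)%N : nat) f /\ forall m (p : nat -> K), exists q : {poly K},
    q.[0] = tmin s j (\poly_(l < m) p l) /\ forall t, t ^+ c * f.@[pts z m (fun l => t ^+ l * p l)] = t ^+ d * q.[t].
Proof.
rewrite acolE; set S := [pred i | _]; move=> jS.
pose g : 'I_#|S| -> 'I_n := enum_val.
have gI : injective g by apply: enum_val_inj.
have gS i : g i \in S by apply: enum_valP.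
(* Weights at the points z_i with a_i > k + 1, which extract the coefficients of index less than the
   number of these points; by [jS] every j_b is such an index. *)
have [L LE] := @dual_points K #|S| (z \o g) (inj_comp zI gI).
pose jb (y : 'I_s) : 'I_#|S| := Ordinal (jS y (ltn_ord y)).
exists (\det (\matrix_(x < s, y < s) \sum_i (z (g i) ^+ x * L i (jb y)) *: 'X_(g i))).
exists (\sum_(x < s) x)%N, (\sum_(y < s) j y)%N; split.
  have := @deg_le_det _ _ #|S| s g (fun (x : 'I_s) i => z (g i) ^+ x)
    (fun i y => L i (jb y)) gI.
  apply: deg_le_weak => i.
  case: (boolP (i \in codom g)) => // /codomP[k' ->].
  by have := gS k'; rewrite inE => ->.
move=> m p.
pose mu r y := \sum_i L i (jb y) * z (g i) ^+ r.
have muE r y : (r < #|S|)%N -> mu r y = (r == j y)%:R.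
  by move=> rS; rewrite /mu (LE (jb y) (Ordinal rS)).
pose P := \poly_(l < m) p l.
(* The terms with x + l >= #|S|, where [mu] is no longer a Kronecker delta. Their order in t exceeds
   j_y, so they disappear at t = 0. *)
pose rho (x y : 'I_s) : {poly K} := \sum_(l < m | (#|S| <= x + l)%N)
  (p l * mu (x + l)%N y) *: 'X^(x + l - (j y).+1)%N.
have jy (y : 'I_s) : (j y < #|S|)%N := jS y (ltn_ord y).
pose Q : 'M[{poly K}]_s := \matrix_(x, y)
  ((if (x <= j y)%N then P`_(j y - x) else 0)%:P + 'X * rho x y).
exists (\det Q); split.
  rewrite -[LHS]/(horner_eval 0 _) -det_map_mx; congr (\det _).
  apply/matrixP => x y; rewrite !mxE /= /horner_eval hornerD hornerM hornerX mul0r.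
  by rewrite addr0 hornerC.
move=> t; rewrite -[(\det Q).[t]]/(horner_eval t _) -!det_map_mx.
rewrite -!prodrXr.
(* The powers of t are absorbed into the determinants: t^x into row x on the left, t^(j_y) into
   column y on the right. *)
have -> : \prod_(x < s) t ^+ x = \det (diag_mx (\row_(x < s) t ^+ x)).
  by rewrite det_diag; apply: eq_bigr => x _; rewrite mxE.
have -> : \prod_(y < s) t ^+ j y = \det (diag_mx (\row_(y < s) t ^+ j y)).
  by rewrite det_diag; apply: eq_bigr => x _; rewrite mxE.
rewrite -det_mulmx [RHS]mulrC -det_mulmx; congr (\det _).
apply/matrixP => x y; rewrite mul_diag_mx mul_mx_diag !mxE /= /horner_eval.
rewrite rmorph_sum /= mulr_sumr.
rewrite (eq_bigr (fun i => \sum_(l < m) p l * t ^+ (x + l)%N * (L i (jb y) * z (g i) ^+ (x + l)%N))); last first.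
  move=> i _; rewrite mevalZ mevalXU /pts !mulr_sumr; apply: eq_bigr => l _.
  by rewrite !exprD; ring.
rewrite exchange_big /= (eq_bigr (fun l : 'I_m => p l * t ^+ (x + l)%N * mu (x + l)%N y)); last first.
  by move=> l _; rewrite mulr_sumr.
rewrite (bigID (fun l : 'I_m => (#|S| <= x + l)%N)) /= addrC hornerD mulrDl; congr (_ + _).
  rewrite hornerC (eq_bigr (fun l : 'I_m => if (x + l == j y)%N then p l * t ^+ j y else 0)).
    rewrite -big_mkcondr /=; case: (leqP x (j y)) => xj; last first.
      by rewrite mul0r big1 // => l /andP[_ /eqP]; lia.
    rewrite coef_poly; case: ltnP => jm.
      rewrite (big_pred1 (Ordinal jm)) // => l; apply/andP/eqP => [[_ /eqP h]|->].
        by apply: val_inj => /=; lia.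
      by rewrite /= subnKC // -ltnNge jy.
    by rewrite mul0r big1 // => l /andP[_ /eqP]; have := ltn_ord l; lia.
  move=> l; rewrite -ltnNge => xl; rewrite muE //.
  by case: eqP => [->|_]; rewrite ?mulr1 ?mulr0.
rewrite hornerM hornerX horner_sum mulr_sumr mulr_suml; apply: eq_bigr => l Sl.
rewrite hornerZ hornerXn; have := jy y => jS'.
have -> : t ^+ (x + l)%N = t * t ^+ (x + l - (j y).+1)%N * t ^+ j y.
  by rewrite -exprS -exprD; congr (_ ^+ _); lia.
by ring.
Qed.

Lemma minors_lowest B w : minors B acol w ->
  exists f : {mpoly K[n]}, exists c d : nat,
  (forall mm, mm \in msupp f -> forall i, (mm i < a i)%N) /\
  forall m (p : nat -> K), exists q : {poly K},
    q.[0] = w (\poly_(l < m) p l) /\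
    forall t, t ^+ c * f.@[pts z m (fun l => t ^+ l * p l)] = t ^+ d * q.[t].
Proof.
move=> [s [j [jm wE]]].
have H (k : 'I_B) := @tmin_lowest k (s k) (j k) (fun b => jm k b (ltn_ord k)).
have /fin_all_exists[f /fin_all_exists[c /fin_all_exists[d fcd]]] := H.
exists (\prod_k f k), (\sum_k c k)%N, (\sum_k d k)%N; split.
  move=> mm mmf i.
  have := @deg_le_prod _ _ _ (index_enum _) _ _ (fun k => (fcd k).1) mm mmf i.
  move=> h; apply: leq_ltn_trans h _; rewrite -(prednK (a_gt0 i)) ltnS.
  elim: B {jm wE H f c d fcd mmf} => [|B IH]; first by rewrite big_ord0.
  (* At most a_i - 1 indices k satisfy k + 1 < a_i, and this is the degree that
     [representable_mpoly] allows. *)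
  have -> : forall B A, (\sum_(k < B) (k.+1 < A)%N = minn B A.-1)%N.
    by elim=> [|b IHb] A; rewrite ?big_ord0 ?min0n // big_ord_recr /= IHb; lia.
  exact: geq_minr.
move=> m p; have /fin_all_exists[q qP] := fun k => (fcd k).2 m p.
exists (\prod_k q k); split.
  by rewrite horner_prod wE; apply: eq_bigr => k _; rewrite (qP k).1.
move=> t; rewrite !expr_sum rmorph_prod /= horner_prod -!big_split.
by apply: eq_bigr => k _; exact: (qP k).2.
Qed.

Lemma representable_minors B w : minors B acol w ->
  (forall m (p : nat -> K), w (\poly_(l < m) p l) = 0) \/
  exists d (lam : {linear tens a -> K^o}), order_ge z d lam /\
  forall m (p : nat -> K), exists q : {poly K}, q.[0] = w (\poly_(l < m) p l) /\
    forall t, lam (exp_nil (XT z m (fun l => t ^+ l * p l)) (low_tens a)) =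
      t ^+ d * q.[t].
Proof.
move=> /minors_lowest[f [c [d [/representable_mpoly fa H]]]].
have [lam lamE] := fa z.
have F m p : exists F : {poly K}, forall t,
    lam (exp_nil (XT z m (fun l => t ^+ l * p l)) (low_tens a)) = F.[t].
  apply: (polyfun_coef _ lam); apply: polyfun_exp; first exact: polyfun_XT.
  exact: polyfun_cst.
(* If c > d, the polynomial q is divisible by t, so its value at 0, which is that of [w], is 0. *)
have [cd|dc] := leqP c d; [right; exists (d - c)%N, lam | left=> m p].
  have G m p : exists q : {poly K}, q.[0] = w (\poly_(l < m) p l) /\
    forall t, lam (exp_nil (XT z m (fun l => t ^+ l * p l)) (low_tens a)) =
      t ^+ (d - c) * q.[t].
    have [q [q0 qE]] := H m p; have [Fp FE] := F m p; exists q; split=> // t.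
    have : 'X^c * Fp = 'X^c * ('X^(d - c) * q).
      apply: poly_eq_nonzero => s _; rewrite mulrA -exprD subnKC // !hornerM !hornerXn.
      by rewrite -FE lamE qE.
    have Xc0 : 'X^c != 0 :> {poly K} by rewrite expf_neq0 // polyX_eq0.
    by move=> /(mulfI Xc0) E; rewrite FE E hornerM hornerXn.
  by split=> // m p; have [q [_ qE]] := G m p; exists q.
have [q [q0 qE]] := H m p; have [Fp FE] := F m p.
have : 'X^d * ('X^(c - d) * Fp) = 'X^d * q.
  apply: poly_eq_nonzero => s _; rewrite mulrA -exprD subnKC ?(ltnW dc) //.
  by rewrite !hornerM !hornerXn -FE lamE qE.
have Xd0 : 'X^d != 0 :> {poly K} by rewrite expf_neq0 // polyX_eq0.
move=> /(mulfI Xd0) E; rewrite -q0 -E hornerM hornerXn expr0n.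
by rewrite subn_eq0 leqNgt dc mul0r.
Qed.

End MinorsRep.

(** * The fusion product as a module over the truncated current algebra *)

Section Fusion.
Context {K : numFieldType} {n : nat} {a : 'I_n.+1 -> nat} {z : 'I_n.+1 -> K}.
Variable M : fusion_product a z.
Hypothesis zI : injective z.
Hypothesis a_gt0 : forall i, (0 < a i)%N.
Local Notation T := (tens (K := K) a).
Local Notation act := (tens_act (a := a) z).
Local Notation low := (low_tens (K := K) a).
Local Notation N := (\sum_i (a i).-1)%N.
Implicit Types (u : T) (m : M) (P Q : {poly K}) (x y w : 'M[K]_2).

Lemma fp_bracket x y w i j m : \tr x = 0 -> \tr y = 0 -> \tr w = 0 ->
  (forall i j u, act x i (act y j u) = act y j (act x i u) + act w (i + j) u) ->
  fp_act M x i (fp_act M y j m) = fp_act M y j (fp_act M x i m) + fp_act M w (i + j)%N m.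
Proof.
move=> x0 y0 w0 H; have [d [u [uF ->]]] := symb_span m.
rewrite !linear_sum -big_split; apply: eq_bigr => s _ /=.
rewrite !fp_actE //; try exact: filt_act.
by rewrite H linearD /= [(s + j + i)%N]addnAC addnA.
Qed.

Lemma fp_scale c x j m : \tr x = 0 -> fp_act M (c *: x) j m = c *: fp_act M x j m.
Proof.
move=> x0; have [d [u [uF ->]]] := symb_span m.
rewrite !linear_sum; apply: eq_bigr => s _ /=.
rewrite !fp_actE ?linearZ /= ?x0 ?mulr0 //.
by rewrite tens_act_scale linearZ.
Qed.

Lemma tr_scale c x : \tr x = 0 -> \tr (c *: x) = 0.
Proof. by rewrite linearZ /= => ->; rewrite mulr0. Qed.

(** On the tensor product t^j may be replaced by its remainder modulo the product of the t - z_i.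
    Thus x (x) t^j raises the filtration by at most n, which is less than j, and its symbol
    vanishes. *)
Lemma fp_high x j m : (n < j)%N -> \tr x = 0 -> fp_act M x j m = 0.
Proof.
move=> nj x0; have [d [u [uF ->]]] := symb_span m.
rewrite linear_sum big1 // => s _ /=; rewrite fp_actE //.
have F1 : filt z (s + n) (act x j (u s)).
  pose q := \prod_i ('X - (z i)%:P).
  have q_monic : q \is monic by apply: monic_prod => i _; apply: monicXsubC.
  pose r := 'X^j %% q.
  have rz i : r.[z i] = z i ^+ j.
    have := congr1 (fun p => p.[z i]) (divp_eq 'X^j q).
    rewrite hornerD hornerM hornerXn (_ : q.[z i] = 0) ?mulr0 ?add0r //.
    by rewrite horner_prod (bigD1 i) //= !hornerE subrr mul0r.
  have sr : (size r <= n.+1)%N.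
    have : (size r < size q)%N by rewrite ltn_modp monic_neq0.
    by rewrite size_prod_XsubC /index_enum -enumT size_enum_ord.
  have -> : act x j (u s) = \sum_(l < n.+1) r`_l *: act x l (u s).
    rewrite tens_actE.
    rewrite (eq_bigr (fun i => \sum_(l < n.+1) (r`_l * z i ^+ l) *: fac i x (u s))).
      rewrite exchange_big; apply: eq_bigr => l _.
      by rewrite tens_actE scaler_sumr; apply: eq_bigr => i _; rewrite scalerA.
    by move=> i _; rewrite -scaler_suml -rz (horner_coef_wide _ sr).
  apply: filt_sum => l _; apply: filtZ; apply: (filt_mono (s := s + l)).
    by rewrite leq_add2l -ltnS.
  exact: filt_act.
apply/(symb_ker M (filt_act _ x0 (uF s))).
case: j nj F1 => // j nj F1; rewrite addnS /=.
by apply: filt_mono F1; rewrite leq_add2l -ltnS.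
Qed.

Definition op x P : 'End(M) := \sum_(i < n.+1) P`_i *: fp_act M x i.

Lemma opE x P m : op x P m = \sum_(i < n.+1) P`_i *: fp_act M x i m.
Proof. by rewrite sum_lfunE; apply: eq_bigr => i _; rewrite scale_lfunE. Qed.

Lemma op_linear x : linear (op x).
Proof.
move=> c P Q; rewrite /op scaler_sumr -big_split; apply: eq_bigr => i _.
by rewrite coefD coefZ scalerDl scalerA.
Qed.
HB.instance Definition _ x :=
  GRing.isLinear.Build K {poly K} 'End(M) _ (op x) (op_linear x).

Lemma op_mod x P : 'X^(n.+1) %| P -> op x P = 0.
Proof.
move=> /dvdpP[Q ->]; rewrite /op big1 // => i _.
by rewrite coefMXn ltn_ord scale0r.
Qed.

(** The terms of P Q beyond t^n, which [op] cuts off, act by 0 according to [fp_high]. *)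
Lemma op_mul x P Q m : \tr x = 0 ->
  op x (P * Q) m = \sum_(i < n.+1) \sum_(j < n.+1) (P`_i * Q`_j) *: fp_act M x (i + j)%N m.
Proof.
move=> x0; rewrite opE.
pose g i j := (P`_i * Q`_j) *: fp_act M x (i + j)%N m.
rewrite (eq_bigr (fun s : 'I_n.+1 => \sum_(i < s.+1) g i (s - i)%N)); last first.
  move=> s _; rewrite coefM scaler_suml; apply: eq_bigr => i _.
  by rewrite /g subnKC // -ltnS.
rewrite (sum_triangle g); apply: eq_bigr => i _.
rewrite -!(big_mkord xpredT (fun j => g i j)).
rewrite [RHS](big_cat_nat (n := n.+1 - i) (leq0n _)) ?leq_subr //=.
rewrite [X in _ = _ + X]big_nat_cond [X in _ = _ + X]big1 ?addr0 // => j.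
rewrite andbT => /andP[hj _]; rewrite /g fp_high ?scaler0 //.
by move: hj; rewrite leq_subLR.
Qed.

Lemma op_bracket x y w c P Q m : \tr x = 0 -> \tr y = 0 -> \tr w = 0 ->
  (forall i j u, act x i (act y j u) = act y j (act x i u) + act (c *: w) (i + j) u) ->
  op x P (op y Q m) = op y Q (op x P m) + c *: op w (P * Q) m.
Proof.
move=> x0 y0 w0 H.
have dbl x' y' P' Q' : op x' P' (op y' Q' m) =
    \sum_(i < n.+1) \sum_(j < n.+1) (P'`_i * Q'`_j) *: fp_act M x' i (fp_act M y' j m).
  rewrite opE; apply: eq_bigr => i _; rewrite opE linear_sum scaler_sumr.
  by apply: eq_bigr => j _; rewrite linearZ scalerA.
rewrite !dbl op_mul // scaler_sumr [X in X + _]exchange_big -big_split.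
apply: eq_bigr => i _ /=; rewrite scaler_sumr -big_split; apply: eq_bigr => j _ /=.
rewrite (fp_bracket _ _ _ x0 y0 (tr_scale c w0) H) fp_scale // scalerDr mulrC.
by rewrite !scalerA mulrC [c * _]mulrC.
Qed.

(** A level [L] on the tensor product is carried over to M through linear forms, because a vector of
    M is only accessible as a sum of symbols. *)
Lemma fp_nil x P (L : nat -> T -> Prop) B : \tr x = 0 -> (forall u, L 0%N u) ->
  (forall k j u, L k u -> L k.+1 (act x j u)) -> (forall u, L B u -> u = 0) ->
  forall m, iter B (op x P) m = 0.
Proof.
move=> x0 L0 LS LB.
pose lev k m := forall phi : {linear M -> K^o},
  (forall s u, filt z s u -> L k u -> phi (symb M s u) = 0) -> phi m = 0.
have lev0 m : lev 0%N m.
  move=> phi H; have [d [u [uF ->]]] := symb_span m.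
  by rewrite linear_sum big1 // => s _; apply: H.
have levS k m : lev k m -> lev k.+1 (op x P m).
  move=> Hm phi H; apply: (Hm [the {linear M -> K^o} of phi \o op x P]) => s u fu Lu /=.
  rewrite opE linear_sum big1 // => i _; rewrite linearZ fp_actE //=.
  by rewrite H ?scaler0 //; [apply: filt_act | apply: LS].
move=> m; have : lev B (iter B (op x P) m) by elim: B {LB} => //= B /levS.
move=> H; apply: vec_eq0 => phi; apply: H => s u _ /LB->.
by rewrite !linear0.
Qed.

Lemma e_top_nil P m : iter N.+1 (op (@sl2_e K) P) m = 0.
Proof.
apply: (fp_nil P (tr_e (K := K)) (L := e_level)) m => //.
- by move=> k j u; apply: e_level_act.
- exact: e_level_top.
Qed.

Lemma f_top_nil P m : iter N.+1 (op (@sl2_f K) P) m = 0.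
Proof.
apply: (fp_nil P (tr_f (K := K)) (L := f_level)) m.
- exact: f_level0.
- by move=> k j u; apply: f_level_act.
- exact: f_level_top.
Qed.

Lemma op_f_low P : op (@sl2_f K) P (v_low M) = 0.
Proof.
rewrite opE big1 // => i _; rewrite /v_low fp_actE ?tr_f //; last exact: filt_low.
by rewrite act_f_low linear0 scaler0.
Qed.

Lemma op_h_low P : op (@sl2_h K) P (v_low M) = - N%:R * P`_0 *: v_low M.
Proof.
rewrite opE big_ord_recl big1 ?addr0 => [|i _].
  rewrite /v_low fp_actE ?tr_h //; last exact: filt_low.
  rewrite act_h_low linearZ scalerA mulrC; congr (_ * _ *: _).
  rewrite natr_sum -sumrN; apply: eq_bigr => i _; rewrite expr0 mul1r.
  by rewrite -{1}(prednK (a_gt0 i)) -natr1; ring.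
(* In positive degree, h maps the lowest tensor to a multiple of itself. This lies in F_0, so its
   symbol in that degree is 0. *)
rewrite /v_low fp_actE ?tr_h //; last exact: filt_low.
apply/eqP; rewrite scaler_eq0; apply/orP; right; apply/eqP.
apply/(symb_ker M (filt_act _ (tr_h (K := K)) (filt_low z 0))) => /=.
by rewrite act_h_low; apply: filtZ; apply: filt_low.
Qed.

Let te := tr_e (K := K).
Let tf := tr_f (K := K).
Let th := tr_h (K := K).

Lemma op_ee P Q m : op (@sl2_e K) P (op (@sl2_e K) Q m) = op (@sl2_e K) Q (op (@sl2_e K) P m).
Proof.
rewrite (op_bracket (c := 0) (w := 0) P Q m te te (mxtrace0 _ _)) ?scale0r ?addr0 //.
by move=> i j u; rewrite ?scale0r tens_act0 addr0 act_ee.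
Qed.

Lemma op_ff P Q m : op (@sl2_f K) P (op (@sl2_f K) Q m) = op (@sl2_f K) Q (op (@sl2_f K) P m).
Proof.
rewrite (op_bracket (c := 0) (w := 0) P Q m tf tf (mxtrace0 _ _)) ?scale0r ?addr0 //.
by move=> i j u; rewrite ?scale0r tens_act0 addr0 act_ff.
Qed.

Lemma op_ef P Q m : op (@sl2_e K) P (op (@sl2_f K) Q m) =
  op (@sl2_f K) Q (op (@sl2_e K) P m) + op (@sl2_h K) (P * Q) m.
Proof.
rewrite (op_bracket (c := 1) P Q m te tf th) ?scale1r //.
by move=> i j u; rewrite ?scale1r act_ef.
Qed.

Lemma op_he P Q m : op (@sl2_h K) P (op (@sl2_e K) Q m) =
  op (@sl2_e K) Q (op (@sl2_h K) P m) + 2%:R *: op (@sl2_e K) (P * Q) m.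
Proof.
rewrite (op_bracket (c := 2%:R) P Q m th te te) //.
by move=> i j u; rewrite tens_act_scale act_he.
Qed.

Lemma op_hf P Q m : op (@sl2_h K) P (op (@sl2_f K) Q m) =
  op (@sl2_f K) Q (op (@sl2_h K) P m) - 2%:R *: op (@sl2_f K) (P * Q) m.
Proof.
rewrite (op_bracket (c := - 2%:R) P Q m th tf tf) ?scaleNr //.
by move=> i j u; rewrite -scaleNr tens_act_scale scaleNr act_hf.
Qed.

Definition fusion_current : current n.+1 N M :=
  @Current K n.+1 N M
    [the {linear {poly K} -> 'End(M)} of op (@sl2_e K)]
    [the {linear {poly K} -> 'End(M)} of op (@sl2_f K)]
    [the {linear {poly K} -> 'End(M)} of op (@sl2_h K)]
    (v_low M) op_ee op_ff op_ef op_he op_hf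
    (@op_mod _) (@op_mod _)
    (fun P => ex_intro _ N.+1 (e_top_nil P))
    (fun P => ex_intro _ N.+1 (f_top_nil P))
    op_f_low op_h_low (e_top_nil 1 (v_low M)).
Local Notation E := (cell fusion_current).

(** This is the derivative of phi(E(P + s Q)) at s = 0. *)
Lemma cell_dual_act (phi : {linear M -> K^o}) Q :
  (forall P, phi (E P) = 0) -> forall P, phi (op (@sl2_e K) Q (E P)) = 0.
Proof.
move=> H P.
have [G pG GE] := exp_nil_second_order (T := fun _ : K => ce fusion_current Q) (E P)
  (fun _ => c_enil fusion_current Q) (polyfun_cst _).
have [r rE] := polyfun_coef pG phi.
have := @poly_first_order K 0 r 0 (phi (op (@sl2_e K) Q (E P))).
rewrite deriv0 horner0 => -> // s; rewrite horner0 add0r -rE.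
have := H (s *: Q + P); rewrite cellD [ce _ (s *: Q)]linearZ GE => H'.
by rewrite -[LHS]H' !linearD !linearZ /= H add0r.
Qed.

Lemma fp_act_X j m : fp_act M (@sl2_e K) j m = op (@sl2_e K) 'X^j m.
Proof.
have [jn|nj] := leqP j n; last by rewrite fp_high // op_mod ?zero_lfunE // dvdp_exp2l.
rewrite opE (bigD1 (inord j)) //= inordK // coefXn eqxx scale1r big1 ?addr0 // => i ij.
rewrite coefXn (_ : (i == j :> nat) = false) ?scale0r //.
by apply: contraNF ij => /eqP <-; rewrite inord_val.
Qed.

(** By repeated differentiation, a form that kills every E(P) kills all words in the e_j applied to
    v, and these span M by [filt_espan]. *)
Lemma cell_span (phi : {linear M -> K^o}) : (forall P, phi (E P) = 0) ->
  forall m, phi m = 0.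
Proof.
move=> H m; have [d [u [uF ->]]] := symb_span m.
rewrite linear_sum big1 // => s _ /=.
apply: (filt_espan (uF s) (phi := [the {linear T -> K^o} of phi \o symb M s])) => I Is /=.
move: Is; rewrite leq_eqVlt => /orP[/eqP<-|Is]; last first.
  rewrite (_ : symb M s (eword z I) = 0) ?linear0 //.
  apply/(symb_ker M (filt_mono (ltnW Is) (filt_eword z I))).
  by case: (s : nat) Is => // s' Is /=; apply: filt_mono (filt_eword z I).
have -> : symb M (sumn I) (eword z I) =
    foldr (fun j m => op (@sl2_e K) 'X^j m) (v_low M) I.
  elim: I => [|j I IH] //=; rewrite -IH -fp_act_X fp_actE ?te //; last exact: filt_eword.
  by rewrite addnC.
have : forall P, phi (E P) = 0 by [].
elim: I phi H => [|j I IH] phi H _ /=; first by have := H 0; rewrite cell0.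
apply: (IH [the {linear M -> K^o} of phi \o op (@sl2_e K) 'X^j]) => P;
exact: cell_dual_act.
Qed.

Lemma cell_trunc P : E P = E (take_poly n.+1 P).
Proof.
apply: cell_mod; rewrite -{1}(poly_take_drop n.+1 P) addrAC subrr add0r.
exact: dvdp_mull.
Qed.

(** The components shared by M and the tensor product: [cell_hcomp] and [exp_XT_hcomp] differ only
    in that the symbol of degree s replaces the factor t^s. *)
Definition hcomp P s : T := \sum_(k < N.+1) ecomp z P k s.

Lemma filt_hcomp P s : filt z s (hcomp P s).
Proof. by apply: filt_sum => k _; apply: filt_comp. Qed.

Lemma cell_hcomp P S : (size P <= n.+1)%N -> (N * n.+1 < S)%N ->
  E P = \sum_(s < S) symb M s (hcomp P s).
Proof.
move=> sP NS; rewrite -[E P]/(exp_nil (op (@sl2_e K) P) (v_low M)).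
rewrite (exp_nilE (c_enil fusion_current P) (e_top_nil P (v_low M))).
rewrite (eq_bigr (fun s : 'I_S => \sum_(k < N.+1) symb M s (ecomp z P k s))); last first.
  by move=> s _; rewrite linear_sum.
rewrite exchange_big; apply: eq_bigr => k _ /=.
apply: (dpow_comp (sigma := symb M) (X := fp_act M (@sl2_e K)) sP).
  by move=> s j u fu; rewrite fp_actE ?te.
by apply: leq_ltn_trans NS; rewrite leq_mul2r -ltnS ltn_ord orbT.
Qed.

Lemma exp_XT_hcomp P S t : (size P <= n.+1)%N -> (N * n.+1 < S)%N ->
  exp_nil (XT z n.+1 (fun l => t ^+ l * P`_l)) low =
  \sum_(s < S) t ^+ s *: hcomp P s.
Proof.
move=> sP NS; rewrite (exp_nilE (XT_nil _ _ _) (XT_top _ _ _ low)).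
rewrite (eq_bigr (fun s : 'I_S => \sum_(k < N.+1) t ^+ s *: ecomp z P k s)); last first.
  by move=> s _; rewrite scaler_sumr.
rewrite exchange_big; apply: eq_bigr => k _ /=.
have kS : (k * n.+1 < S)%N.
  by apply: leq_ltn_trans NS; rewrite leq_mul2r -ltnS ltn_ord orbT.
pose X j : 'End(T) := t ^+ j *: linfun [the {linear T -> T} of act (@sl2_e K) j].
have XE s j u : filt z s u -> X j (t ^+ s *: u) = t ^+ (s + j) *: act (@sl2_e K) j u.
  by move=> _; rewrite scale_lfunE lfunE /= tens_actZr scalerA -exprD addnC.
have := @dpow_comp K n.+1 a z T (fun s => [the {linear T -> T} of *:%R (t ^+ s)]) X P sP XE _ _ kS.
rewrite /= expr0 scale1r => <-; congr (dpow _ _ _); apply: eq_bigr => j _.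
by rewrite scalerA mulrC.
Qed.

Lemma minors_take B g P : minors B (acol (a := a)) g ->
  g P = g (take_poly n.+1 P).
Proof.
move=> [s [j [jm wE]]]; rewrite !wE; apply: eq_bigr => k _.
congr (\det _); apply/matrixP => x y; rewrite !mxE; case: ifP => // xj.
rewrite coef_take_poly (_ : (j k y - x < n.+1)%N) //.
apply: leq_ltn_trans (leq_subr _ _) _.
have := jm k y (ltn_ord k) (ltn_ord y) => /leq_trans; apply.
by rewrite acolE; apply: leq_trans (max_card _) _; rewrite card_ord.
Qed.

(** A relation puts the component of degree d of the combination into F_(d-1), where the form [lam]
    of order d vanishes. On [hcomp] this form reads off the coefficient of lowest order, which is
    [g]. *)
Lemma relation_minors B g r (c : 'I_r -> K) (P : 'I_r -> {poly K}) :
  minors B (acol (a := a)) g -> \sum_i c i *: E (P i) = 0 ->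
  \sum_i c i * g (P i) = 0.
Proof.
move=> gM rel; pose P' i := take_poly n.+1 (P i).
have sP i : (size (P' i) <= n.+1)%N by apply: size_take_poly.
have {}rel : \sum_i c i *: E (P' i) = 0.
  by rewrite -[RHS]rel; apply: eq_bigr => i _; rewrite [in RHS]cell_trunc.
rewrite (eq_bigr (fun i => c i * g (P' i))); last first.
  by move=> i _; rewrite (minors_take _ gM).
have [w0|[d [lam [lamd H]]]] := representable_minors zI a_gt0 gM.
  by rewrite big1 // => i _; rewrite /P' /take_poly w0 mulr0.
pose S := (N * n.+1 + d).+1.
have NS : (N * n.+1 < S)%N by rewrite ltnS leq_addr.
have dS : (d < S)%N by rewrite ltnS leq_addl.
pose u s : T := \sum_i c i *: hcomp (P' i) s.
have uF s : filt z s (u s).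
  by apply: filt_sum => i _; apply/filtZ/filt_hcomp.
have symb0 : symb M d (u d) = 0.
  apply: (symb_direct (d := S) uF) => //.
  rewrite -[RHS]rel.
  rewrite (eq_bigr (fun s : 'I_S => \sum_i c i *: symb M s (hcomp (P' i) s))); last first.
    by move=> s _; rewrite linear_sum; apply: eq_bigr => i _; rewrite linearZ.
  rewrite exchange_big; apply: eq_bigr => i _.
  by rewrite (cell_hcomp (sP i) NS) scaler_sumr.
have lam0 : lam (u d) = 0.
  move: symb0 => /(symb_ker M (uF d)); case: (d) lamd => [|d'] lamd /=.
    by move=> ->; rewrite linear0.
  exact: (order_ge_filt (leqnn _) lamd).
rewrite -[RHS]lam0 linear_sum; apply: eq_bigr => i _; rewrite linearZ /=.
congr (_ * _); have [q [qE q0]] := H n.+1 (fun l => (P i)`_l).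
rewrite /P' /take_poly -qE.
have PE : \poly_(l < n.+1) (P i)`_l = P' i by [].
have E1 : \poly_(s < S) lam (hcomp (P' i) s) = 'X^d * q.
  apply: poly_eq_nonzero => t _; rewrite hornerM hornerXn -q0.
  have -> : XT (a := a) z n.+1 (fun l => t ^+ l * (P i)`_l) = XT z n.+1 (fun l => t ^+ l * (P' i)`_l).
    by apply: eq_XT => l ln; rewrite coef_take_poly ln.
  rewrite (exp_XT_hcomp t (sP i) NS) linear_sum horner_poly; apply: eq_bigr => s _.
  by rewrite linearZ mulrC.
have := congr1 (fun p : {poly K} => p`_d) E1.
by rewrite coef_poly dS coefXnM ltnn subnn horner_coef0 => ->.
Qed.

(** M is exhausted by the sums of its first graded pieces, and the piece of degree d, a quotient of
    F_d by F_(d-1), adds at most the difference of their dimensions. *)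
Lemma dim_fusion : (\dim {:M} <= \prod_i a i)%N.
Proof.
have [F FP] : exists F : nat -> {vspace T}, forall s u, u \in F s <-> filt z s u.
  have H s : exists U : {vspace T}, forall u, u \in U <-> filt z s u.
    by apply: vspace_of_pred; [exact: filt0 | exact: filt_lin].
  by have [F FP] := boolp.choice H; exists F.
pose G d := (\sum_(s < d) symb M s @: F s)%VS.
have dimG d : (\dim (G d) <= \dim (if d is d'.+1 then F d' else 0%VS))%N.
  elim: d => [|d IH]; first by rewrite /G big_ord0 !dimv0.
  rewrite /G big_ord_recr /=; apply: leq_trans (dimv_add_leqif _ _) _.
  have := limg_ker_dim (symb M d) (F d) => <-; rewrite leq_add2r.
  apply: leq_trans IH _; apply: dimvS; case: d => [|d]; first exact: sub0v.
  apply/subvP => u ud; rewrite memv_cap memv_ker; apply/andP; split.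
    exact/FP/filtS/FP.
  apply/eqP/(symb_ker M); first exact/filtS/FP.
  exact/FP.
have dimT : (\dim {:T} <= \prod_i a i)%N.
  rewrite dimvf /dim /= muln1 card_dep_ffun.
  by rewrite foldrE big_map big_enum /=; under eq_bigr => i _ do rewrite card_ord.
apply: leq_trans dimT.
have mG m : exists d, m \in G d.
  have [d [u [uF ->]]] := symb_span m; exists d; apply: memv_sumr => s _.
  by apply: memv_img; apply/FP.
have GS d d' : (d <= d')%N -> (G d <= G d')%VS.
  move=> /subnK <-; elim: (d' - d)%N => // k IHk; apply: subv_trans IHk _.
  by rewrite addSn /G big_ord_recr addvSl.
have /fin_all_exists[dd ddE] (i : 'I_(\dim {:M})) := mG (vbasis {:M})`_i.
pose D := \max_i dd i.
have -> : {:M}%VS = G D.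
  apply/eqP; rewrite eqEsubv subvf andbT; apply/subvP => m _.
  rewrite (coord_vbasis (memvf m)); apply: rpred_sum => i _; apply: rpredZ.
  exact: (subvP (GS _ _ (leq_bigmax i)) _ (ddE i)).
apply: leq_trans (dimG D) _; case: (D) => [|D']; rewrite ?dimv0 //.
exact: dimvS (subvf _).
Qed.

End Fusion.

(** * Linear maps prescribed on a spanning family *)

Section LinearExtension.
Context {K : numFieldType} {V W : vectType K} {I : Type}.

(** Stated by duality, since [cell_span] tests vectors on linear forms. *)
Definition dual_spanning (E : I -> V) :=
  forall phi : {linear V -> K^o}, (forall i, phi (E i) = 0) -> forall v, phi v = 0.

Lemma full_of_dual (U : {vspace V}) :
  (forall phi : {linear V -> K^o}, (forall u, u \in U -> phi u = 0) -> forall v, phi v = 0) ->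
  forall v, v \in U.
Proof.
move=> H v; have : (\1%VF - projv U) v = 0.
  apply: vec_eq0 => phi.
  apply: (H [the {linear V -> K^o} of phi \o (\1%VF - projv U)]) => u uU /=.
  by rewrite add_lfunE opp_lfunE id_lfunE projv_id // subrr linear0.
rewrite add_lfunE opp_lfunE id_lfunE => /eqP; rewrite subr_eq0 => /eqP->.
exact: memv_proj.
Qed.

Lemma spanning_comb (E : I -> V) : dual_spanning E -> forall v,
  exists l : seq (K * I), v = \sum_(x <- l) x.1 *: E x.2.
Proof.
move=> HE.
have [||U UP] := @vspace_of_pred _ V (fun v => exists l : seq (K * I), v = \sum_(x <- l) x.1 *: E x.2).
- by exists [::]; rewrite big_nil.
- move=> c u v [l1 ->] [l2 ->]; exists ([seq (c * x.1, x.2) | x <- l1] ++ l2).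
  rewrite big_cat big_map scaler_sumr; congr (_ + _).
  by apply: eq_bigr => x _; rewrite scalerA.
move=> v; apply/UP; move: v; apply: full_of_dual => phi H.
apply: HE => i; apply: H; apply/UP; exists [:: (1, i)].
by rewrite big_seq1 scale1r.
Qed.

Lemma spanning_sum (E : I -> V) : dual_spanning E -> forall v,
  exists r (c : 'I_r -> K) (p : 'I_r -> I), v = \sum_i c i *: E (p i).
Proof.
move=> HE v; have [l ->] := spanning_comb HE v.
exists (size l), (fun i => (tnth (in_tuple l) i).1), (fun i => (tnth (in_tuple l) i).2).
by rewrite big_tnth.
Qed.

Lemma linear_extension (E : I -> V) (g : I -> W) : dual_spanning E ->
  (forall r (c : 'I_r -> K) (p : 'I_r -> I),
     \sum_i c i *: E (p i) = 0 -> \sum_i c i *: g (p i) = 0) ->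
  exists Phi : 'Hom(V, W), forall i, Phi (E i) = g i.
Proof.
move=> HE H.
have {}H (l : seq (K * I)) : \sum_(x <- l) x.1 *: E x.2 = 0 -> \sum_(x <- l) x.1 *: g x.2 = 0.
  rewrite big_tnth => h; rewrite big_tnth; move: h.
  exact: (H _ (fun i => (tnth (in_tuple l) i).1) (fun i => (tnth (in_tuple l) i).2)).
have H2 (l1 l2 : seq (K * I)) c : \sum_(x <- l1) x.1 *: E x.2 = c *: \sum_(x <- l2) x.1 *: E x.2 ->
    \sum_(x <- l1) x.1 *: g x.2 = c *: \sum_(x <- l2) x.1 *: g x.2.
  move=> /eqP; rewrite -subr_eq0 => /eqP h; apply/eqP; rewrite -subr_eq0; apply/eqP.
  have := H (l1 ++ [seq (- c * x.1, x.2) | x <- l2]).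
  have auxE : \sum_(x <- l2) (- c * x.1) *: E x.2 = - (c *: \sum_(x <- l2) x.1 *: E x.2).
    by rewrite -scaleNr scaler_sumr; apply: eq_bigr => x _; rewrite scalerA.
  have auxg : \sum_(x <- l2) (- c * x.1) *: g x.2 = - (c *: \sum_(x <- l2) x.1 *: g x.2).
    by rewrite -scaleNr scaler_sumr; apply: eq_bigr => x _; rewrite scalerA.
  by rewrite !big_cat !big_map /= auxE auxg; apply.
(* One combination is chosen for every vector; linearity follows because relations go to
   relations. *)
have [l lE] := boolp.choice (spanning_comb HE).
pose s v := \sum_(x <- l v) x.1 *: g x.2.
have s_lin : linear s.
  move=> c u v; rewrite /s.
  have := @H2 (l (c *: u + v)) ([seq (c * x.1, x.2) | x <- l u] ++ l v) 1.
  rewrite !scale1r !big_cat !big_map /= -lE => ->.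
    by rewrite scaler_sumr; congr (_ + _); apply: eq_bigr => x _; rewrite scalerA.
  rewrite -lE {1}(lE u) scaler_sumr; congr (_ + _).
  by apply: eq_bigr => x _; rewrite scalerA.
pose sL := GRing.isLinear.Build K V W _ s s_lin.
pose sLin : {linear V -> W} := HB.pack s sL.
exists (linfun sLin) => i; rewrite lfunE /= /s.
have := @H2 (l (E i)) [:: (1, i)] 1; rewrite !big_seq1 !scale1r -lE.
exact.
Qed.

End LinearExtension.

(** * The criterion for linear relations *)

Section Relations.
Context {K : numFieldType} {n : nat} {a : 'I_n.+1 -> nat} {z : 'I_n.+1 -> K}.
Variable M : fusion_product a z.
Hypothesis zI : injective z.
Hypothesis a_gt0 : forall i, (0 < a i)%N.
Local Notation E := (cell (fusion_current M a_gt0)).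

Lemma cell_dual_spanning : dual_spanning E.
Proof. exact: cell_span. Qed.

(** The functions of [minors_indep] define a linear map from M onto a space of dimension prod a_i.
    Since dim M is at most this, the map is injective, so a combination killed by all of them is
    0. *)
Lemma relationP B r (c : 'I_r -> K) (P : 'I_r -> {poly K}) :
  (forall i, a i <= B.+1)%N ->
  \sum_i c i *: E (P i) = 0 <->
  (forall g, minors B (acol (a := a)) g -> \sum_i c i * g (P i) = 0).
Proof.
move=> aB; split=> [rel g gM|H]; first exact (relation_minors zI gM rel).
pose N := (\prod_(x <- [seq a i | i <- enum 'I_n.+1]) x)%N.
have [|w wM wI] := @minors_indep K [seq a i | i <- enum 'I_n.+1] B N _ erefl.
  by apply/allP => _ /mapP[i _ ->].
have NE : N = (\prod_i a i)%N by rewrite /N big_map big_enum.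
have [||Phi PhiE] := @linear_extension K M 'rV[K]_N _ E (fun P => \row_i w i P).
- exact: cell_dual_spanning.
- move=> r' c' P' rel; apply/rowP => j; rewrite summxE mxE.
  rewrite -[RHS](relation_minors zI (wM j) rel); apply: eq_bigr => i _.
  by rewrite !mxE.
have full : forall v, v \in limg Phi.
  apply: full_of_dual => phi phi0 v.
  have phi_e : forall i, phi (delta_mx 0 i) = 0.
    apply: wI => P'; have := phi0 _ (memv_img Phi (memvf (E P'))).
    rewrite PhiE (row_sum_delta (\row_i w i P')) linear_sum => sum0.
    rewrite -[RHS]sum0; apply: eq_bigr => i _.
    by rewrite linearZ /= mxE mulrC.
  by rewrite (row_sum_delta v) linear_sum big1 // => i _; rewrite linearZ /= phi_e; exact: mulr0.
have dimL : \dim (limg Phi) = N.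
  have -> : limg Phi = fullv by apply/eqP; rewrite eqEsubv subvf; apply/subvP => v _.
  by rewrite dimvf /dim /= mul1n.
have ker0 : lker Phi = 0%VS.
  apply/eqP; rewrite -dimv_eq0 -leqn0.
  have := limg_ker_dim Phi fullv; rewrite capfv dimL => dimE.
  have := dim_fusion M; rewrite -NE -dimE addnC.
  by rewrite -[X in (_ <= X)%N -> _]addn0 leq_add2l.
apply/eqP; rewrite -memv0 -ker0 memv_ker linear_sum; apply/eqP/rowP => j.
rewrite summxE mxE -[RHS](H _ (wM j)); apply: eq_bigr => i _.
by rewrite linearZ /= PhiE !mxE.
Qed.

End Relations.

(** * Comparison of A with A^- and with A' *)

Section Comparison.
Context {K : numFieldType} {n : nat} {a : 'I_n.+2 -> nat} {z : 'I_n.+2 -> K}.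
Context {z' : 'I_n.+1 -> K}.
Local Notation a' := (fun i : 'I_n.+1 => a (widen_ord (leq_pred n.+2) i)).
Variables (M : fusion_product a z) (M' : fusion_product a' z').
Hypothesis zI : injective z.
Hypothesis z'I : injective z'.
Hypothesis a_gt0 : forall i, (0 < a i)%N.
Hypothesis a_max : forall i, i != ord_max -> (a i < a ord_max)%N.

Definition amin i := if i == ord_max then (a i).-1 else a i.
Variable Mm : fusion_product amin z.

Lemma a'_gt0 i : (0 < a' i)%N. Proof. exact: a_gt0. Qed.

Lemma a_max_gt1 : (1 < a ord_max)%N.
Proof. by apply: leq_trans (a_max (i := ord0) _); rewrite ?ltnS ?a_gt0. Qed.

Lemma amin_gt0 i : (0 < amin i)%N.
Proof. by rewrite /amin; case: eqP => [->|_]; rewrite ?a_gt0 // -ltnS prednK // a_max_gt1. Qed.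

Local Notation B := (a ord_max).-1.
Local Notation E := (cell (fusion_current M a_gt0)).
Local Notation E' := (cell (fusion_current M' a'_gt0)).
Local Notation Em := (cell (fusion_current Mm amin_gt0)).

Lemma BE : B.+1 = a ord_max. Proof. by rewrite prednK. Qed.

Lemma a_le i : (a i <= B.+1)%N.
Proof. by rewrite BE; have [->//|/a_max/ltnW] := eqVneq i ord_max. Qed.

Lemma amin_le i : (amin i <= B.+1)%N.
Proof. by rewrite /amin; case: eqP => _; [apply: leq_trans (leq_pred _) (a_le i) | apply: a_le]. Qed.

Lemma acol_split (b : 'I_n.+2 -> nat) k : acol (a := b) k =
  (acol (a := fun i : 'I_n.+1 => b (widen_ord (leq_pred n.+2) i)) k + (k.+1 < b ord_max)%N)%N.
Proof.
rewrite !acolE -!sum1_card big_mkcond big_ord_recr /=; congr (_ + _)%N.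
rewrite [RHS]big_mkcond; apply: eq_bigr => i _; rewrite !inE.
by congr (if (_ < b _)%N then _ else _); apply: val_inj.
Qed.

Lemma acol_pred k : (k < B)%N -> acol (a := a') k = (acol (a := a) k).-1.
Proof. by move=> kB; rewrite [in RHS]acol_split (_ : (k.+1 < _)%N) ?addn1 //; lia. Qed.

Lemma amin_widen : (fun i : 'I_n.+1 => amin (widen_ord (leq_pred n.+2) i)) =1 a'.
Proof. by move=> i; rewrite /amin ifN // -val_eqE /= neq_ltn ltn_ord. Qed.

Lemma eq_acol m (b b' : 'I_m -> nat) k : b =1 b' -> acol (a := b) k = acol (a := b') k.
Proof. by move=> bb; rewrite !acolE; apply: eq_card => i; rewrite !inE bb. Qed.

Lemma acol_amin k : acol (a := amin) k = (acol (a := a') k + (k.+1 < B)%N)%N.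
Proof. by rewrite acol_split (eq_acol _ amin_widen) /amin eqxx. Qed.

(** This is where the maximality of a_n has to be strict: no other a_i exceeds a_n - 1. *)
Lemma acol_last : acol (a := a') B.-1 = 0%N.
Proof.
rewrite acolE; apply: eq_card0 => i; rewrite inE; apply/negbTE.
have := a_max (i := widen_ord (leq_pred n.+2) i).
rewrite -val_eqE /= neq_ltn ltn_ord => /(_ isT).
by have := a_max_gt1; lia.
Qed.

Let k0B : (B.-1 < B)%N. Proof. by have := a_max_gt1; lia. Qed.
Let mk0 : acol (a := a) B.-1 = 1%N.
Proof. by rewrite acol_split acol_last; have := a_max_gt1; lia. Qed.
Let mk0' : acol (a := amin) B.-1 = 0%N.
Proof. by rewrite acol_amin acol_last; have := a_max_gt1; lia. Qed.
Let mk k : k != B.-1 -> acol (a := a) k = acol (a := amin) k.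
Proof. by move=> kB; rewrite acol_amin acol_split; congr (_ + nat_of_bool _)%N; lia. Qed.

(** By [minors_decr] a product of minors for A is g, P_0 g or 0 with g one for A^-; conversely g and
    P_0 g are products of minors for A. *)
Lemma relation_split r (c : 'I_r -> K) (P : 'I_r -> {poly K}) :
  \sum_i c i *: E (P i) = 0 <->
  \sum_i c i *: Em (P i) = 0 /\ \sum_i (c i * (P i)`_0) *: Em (P i) = 0.
Proof.
rewrite (relationP M zI a_gt0 c P a_le) (relationP Mm zI amin_gt0 c P amin_le).
rewrite (relationP Mm zI amin_gt0 _ P amin_le).
split=> [H|[H1 H2] g gM].
  split=> g gM.
    apply: H; apply: minors_mono gM => k _.
    by have [->|/mk->//] := eqVneq k B.-1; rewrite mk0'.
  rewrite -[RHS](H (fun P => P`_0 * g P)).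
    by apply: eq_bigr => i _; rewrite mulrA.
  by apply: (@minors_incr _ _ _ _ B.-1) gM; rewrite ?mk0 ?mk0'.
have [g1 g1M gE] := minors_decr k0B mk0 mk0' mk gM.
case: gE => gE.
- by rewrite -[RHS](H1 g1 g1M); apply: eq_bigr => i _; rewrite gE.
- by rewrite -[RHS](H2 g1 g1M); apply: eq_bigr => i _; rewrite gE mulrA.
- by rewrite big1 // => i _; rewrite gE mulr0.
Qed.

(** Removing a_n lowers every column by one, which is the effect that the factor X has on the
    minors. *)
Lemma relation_restrict r (c : 'I_r -> K) (Q : 'I_r -> {poly K}) :
  \sum_i c i *: E (Q i * 'X) = 0 <-> \sum_i c i *: E' (Q i) = 0.
Proof.
rewrite (relationP M zI a_gt0 c _ a_le).
rewrite (relationP M' z'I a'_gt0 c Q (fun i => a_le _)).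
split=> H g gM.
  have [|g1 g1M gE] := @minors_lift K B (acol (a := a)) g.
    by apply: minors_mono gM => k kB; rewrite acol_pred.
  by rewrite -[RHS](H g1 g1M); apply: eq_bigr => i _; rewrite gE.
have [g0|gM'] := minors_restrict gM.
  by rewrite big1 // => i _; rewrite g0 mulr0.
apply: (H (fun Q => g (Q * 'X))); apply: minors_mono gM' => k kB.
by rewrite acol_pred.
Qed.

Lemma split_maps : exists alpha0 alpha1 : 'Hom(M, Mm),
  [/\ forall P, alpha0 (E P) = Em P, forall P, alpha1 (E P) = P`_0 *: Em P
    & forall x, alpha0 x = 0 -> alpha1 x = 0 -> x = 0].
Proof.
have [|a0 a0E] := @linear_extension K M Mm _ E Em (@cell_dual_spanning _ _ _ _ M a_gt0).
  by move=> r c P /relation_split[].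
have [|a1 a1E] := @linear_extension K M Mm _ E (fun P => P`_0 *: Em P)
    (@cell_dual_spanning _ _ _ _ M a_gt0).
  move=> r c P /relation_split[_ H]; rewrite -[RHS]H; apply: eq_bigr => i _.
  by rewrite scalerA.
exists a0, a1; split=> // x.
have [r [c [P ->]]] := spanning_sum (@cell_dual_spanning _ _ _ _ M a_gt0) x.
rewrite !linear_sum => H0 H1; apply: (relation_split c P).2.
split; [rewrite -[RHS]H0 | rewrite -[RHS]H1]; apply: eq_bigr => i _.
  by rewrite linearZ /= a0E.
by rewrite linearZ /= a1E scalerA.
Qed.

Lemma restrict_map : exists2 theta : 'Hom(M', M),
  (forall Q, theta (E' Q) = E (Q * 'X)) & lker theta = 0%VS.
Proof.
have [|th thE] := @linear_extension K M' M _ E' (fun Q => E (Q * 'X))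
    (@cell_dual_spanning _ _ _ _ M' a'_gt0).
  by move=> r c Q /relation_restrict.
exists th => //; apply/eqP; rewrite -subv0; apply/subvP => x.
rewrite memv_ker memv0 => /eqP.
have [r [c [Q ->]]] := spanning_sum (@cell_dual_spanning _ _ _ _ M' a'_gt0) x.
rewrite linear_sum => H; apply/eqP; apply: (relation_restrict c Q).1.
by rewrite -[RHS]H; apply: eq_bigr => i _; rewrite linearZ /= thE.
Qed.

End Comparison.

(** * Trivial open sets, bihomogeneous sums and generators of lines *)

Section ProjectiveMore.
Context {K : numFieldType}.
Implicit Types V W : vectType K.

Lemma zopenT V : zopen (fun _ : {vspace V} => True).
Proof.
move=> L _ _; exists 0%N, (fun=> 1); split=> //; first exact: homfun_cst.
by exists 0; rewrite ?mem0v ?oner_neq0.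
Qed.

Lemma zopen2T V W : zopen2 (fun (_ : {vspace V}) (_ : {vspace W}) => True).
Proof.
move=> L1 L2 _ _ _; exists 0%N, 0%N, (fun _ _ => 1); split=> //.
  exists 1%N, (fun _ => 1), (fun _ => 1); split=> *; rewrite ?dhomog1 //.
  by rewrite big_ord1 /mpeval !meval1 mulr1.
by exists 0, 0; rewrite !mem0v oner_neq0.
Qed.

Lemma bihomfun_sum V W d1 d2 r (f : 'I_r -> V -> K) (h : 'I_r -> W -> K) :
  (forall k, homfun d1 (f k)) -> (forall k, homfun d2 (h k)) ->
  bihomfun d1 d2 (fun v w => \sum_k f k v * h k w).
Proof.
move=> Hf Hh.
have /fin_all_exists[p pP] (k : 'I_r) : exists p : {mpoly K[\dim {:V}]},
    p \is d1.-homog /\ forall v, f k v = mpeval p v.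
  by have [p p1 p2] := Hf k; exists p.
have /fin_all_exists[q qP] (k : 'I_r) : exists q : {mpoly K[\dim {:W}]},
    q \is d2.-homog /\ forall v, h k v = mpeval q v.
  by have [q q1 q2] := Hh k; exists q.
exists r, p, q; split=> [k|k|v w]; [exact: (pP k).1 | exact: (qP k).1 |].
by apply: eq_bigr => k _; rewrite (pP k).2 (qP k).2.
Qed.

(** The maps on lines are defined through [vpick]; this compares the vector picked with a given
    generator. *)
Lemma vpick_line V (x : V) : x != 0 -> exists2 c, c != 0 & vpick <[x]>%VS = c *: x.
Proof.
move=> x0; apply: line_mem; first exact: memv_pick.
by rewrite vpick0 -dimv_eq0 dim_vline x0.
Qed.

Lemma lfun_inverse V W (f : 'Hom(V, W)) : lker f = 0%VS ->
  exists g : 'Hom(W, V), forall x, g (f x) = x.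
Proof. by move=> /eqP f0; exists (f^-1)%VF => x; apply: lker0_lfunK. Qed.

End ProjectiveMore.

(** * Homogeneous coordinates on the projective line *)

Section Plane.
Context {K : numFieldType}.

Definition ycoord (i : 'I_2) (y : 'rV[K]_2) : K^o := y ord0 i.

Lemma ycoord_linear i : linear (ycoord i).
Proof. by move=> c u v; rewrite /ycoord !mxE. Qed.
HB.instance Definition _ i :=
  GRing.isLinear.Build K 'rV[K]_2 K^o _ (ycoord i) (ycoord_linear i).

Definition row2 (s t : K) : 'rV[K]_2 := \row_j (if j == ord0 then s else t).

Lemma row2_0 s t : ycoord ord0 (row2 s t) = s. Proof. by rewrite /ycoord mxE. Qed.
Lemma row2_1 s t : ycoord ord_max (row2 s t) = t. Proof. by rewrite /ycoord mxE. Qed.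

Lemma row2_eta y : y = row2 (ycoord ord0 y) (ycoord ord_max y).
Proof.
apply/rowP => j; rewrite mxE /ycoord; case: eqP => [->//|/eqP j0].
by congr (y _ _); apply: val_inj; case: j j0 => [[|[|]]].
Qed.

Lemma row2_eq0 s t : (row2 s t == 0) = (s == 0) && (t == 0).
Proof.
apply/eqP/andP => [H|[/eqP-> /eqP->]].
  have := row2_0 s t; have := row2_1 s t; rewrite H !linear0 => <- <-.
  by rewrite eqxx.
by apply/rowP => j; rewrite !mxE if_same.
Qed.

Lemma row2Z c s t : c *: row2 s t = row2 (c * s) (c * t).
Proof. by apply/rowP => j; rewrite !mxE; case: ifP. Qed.

Lemma hommap_row2 (V : vectType K) d (f h : V -> K) : homfun d f -> homfun d h ->
  hommap d (fun v => row2 (f v) (h v)).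
Proof.
move=> Hf Hh; apply: hommap_dual => phi.
apply: homfun_ext (homfunD (homfunZ (phi (row2 1 0)) Hf) (homfunZ (phi (row2 0 1)) Hh)) => v.
have -> : row2 (f v) (h v) = f v *: row2 1 0 + h v *: row2 0 1.
  by apply/rowP => j; rewrite !mxE; case: ifP => _; rewrite !(mulr1, mulr0, addr0, add0r).
by rewrite linearD !linearZ /= mulrC [phi _ * _]mulrC.
Qed.

(* The action of a Weyl group element on P^1. *)
Definition rot2 (y : 'rV[K]_2) : 'rV[K]_2 := row2 (- ycoord ord_max y) (ycoord ord0 y).

Lemma rot2K y : rot2 (rot2 y) = - y.
Proof.
by rewrite /rot2 row2_0 row2_1 [in RHS](row2_eta y) -[RHS]scaleN1r row2Z !mulN1r.
Qed.

Lemma rot2_linear : linear rot2.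
Proof.
move=> c u v; apply/rowP => j; rewrite !mxE !linearD !linearZ /=.
by case: ifP => _ //; rewrite opprD mulrN.
Qed.
HB.instance Definition _ := GRing.isLinear.Build K 'rV[K]_2 'rV[K]_2 _ rot2 rot2_linear.

End Plane.

HB.instance Definition _ (K : numFieldType) (V : vectType K) k T :=
  GRing.isLinear.Build K V V _ (@dpow K V k T) (dpow_lin k T).

Lemma incone_eq (K : fieldType) (V W : vectType K) I (F : I -> V) (f g : {linear V -> W}) x :
  incone F x -> (forall i, f (F i) = g (F i)) -> f x = g x.
Proof.
move=> Fx fg; apply/eqP; rewrite -subr_eq0; apply/eqP.
apply: (incone_linear (f := [the {linear V -> W} of f \- g]) Fx) => i /=.
by rewrite fg subrr.
Qed.

(** * The bundle map, its charts and its fibers *)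

Section Bundle.
Context {K : numFieldType} {n N N' : nat} {V Z V' : vectType K}.
Variables (C : current n.+2 N V) (C' : current n.+1 N' V').
Variables (Em : {poly K} -> Z) (al0 al1 : 'Hom(V, Z)) (theta : 'Hom(V', V)).
Local Notation E := (cell C).
Local Notation E' := (cell C').
Local Notation w := (weyl C).
Local Notation D := (\dim {:V}).
Local Notation trans c := (exp_nil (ce C c%:P)).
Local Notation y0 y := (ycoord ord0 y).
Local Notation y1 y := (ycoord ord_max y).
Hypothesis al0E : forall P, al0 (E P) = Em P.
Hypothesis al1E : forall P, al1 (E P) = P`_0 *: Em P.
Hypothesis al_inj : forall x, al0 x = 0 -> al1 x = 0 -> x = 0.
Hypothesis thetaE : forall Q, theta (E' Q) = E (Q * 'X).
Hypothesis theta_ker : lker theta = 0%VS.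
Implicit Types (P Q : {poly K}) (x u : V) (y : 'rV[K]_2) (c s t : K).

Definition cone_set (W : vectType K) I (F : I -> W) : pset W :=
  fun L => exists x : W, [/\ x != 0, L = <[x]>%VS & incone F x].

Lemma cone_set_mem (W : vectType K) I (F : I -> W) L v :
  cone_set F L -> v \in L -> v != 0 -> L = <[v]>%VS /\ incone F v.
Proof.
move=> [x [x0 -> Fx]] vL v0; have [c c0 ->] := line_mem vL v0.
by rewrite lineZ //; split=> //; apply: incone_scale.
Qed.

(** The equation al1 x = (y_1 / y_0) al0 x, cleared of denominators so as to include y_0 = 0. It is
    a relation because y is only determined up to a scalar. *)
Definition Rpi x y := y != 0 /\ y1 y *: al0 x = y0 y *: al1 x.

Lemma Rpi_cell P : Rpi (E P) (row2 1 P`_0).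
Proof.
split; first by rewrite row2_eq0 oner_eq0.
by rewrite row2_0 row2_1 al0E al1E scale1r.
Qed.

Lemma RpiZ x y c : Rpi x y -> Rpi (c *: x) y.
Proof.
move=> [yn xy]; split=> //.
by rewrite !linearZ /= xy.
Qed.

Lemma RpiZy x y c : c != 0 -> Rpi x y -> Rpi x (c *: y).
Proof.
move=> c0 [yn xy]; split; first by rewrite scaler_eq0 negb_or c0.
by rewrite !linearZ /= -!scalerA xy.
Qed.

Lemma row2_line y y' : y != 0 -> y' != 0 -> y0 y * y1 y' = y1 y * y0 y' ->
  <[y]>%VS = <[y']>%VS.
Proof.
move=> yn y'n H; have [s0|s0] := eqVneq (y0 y) 0.
  have t0 : y1 y != 0 by apply: contraNneq yn => t0; rewrite [y]row2_eta s0 t0 row2_eq0 eqxx.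
  have s'0 : y0 y' = 0.
    by apply/eqP; move/esym/eqP: H; rewrite s0 mul0r mulf_eq0 (negPf t0).
  have t'0 : y1 y' != 0.
    by apply: contraNneq y'n => t'; rewrite [y']row2_eta s'0 t' row2_eq0 eqxx.
  rewrite [y]row2_eta [y']row2_eta s0 s'0 -(lineZ _ (_ : y1 y' / y1 y != 0)).
    by rewrite row2Z mulr0 divfK.
  by rewrite mulf_neq0 ?invr_eq0.
have s'0 : y0 y' != 0.
  apply: contraNneq y'n => s'; rewrite [y']row2_eta s'.
  by move/eqP: H; rewrite s' mulr0 mulf_eq0 (negPf s0) => /eqP->; rewrite row2_eq0 eqxx.
rewrite [y]row2_eta [y']row2_eta -(lineZ (row2 (y0 y) _) (_ : y0 y' / y0 y != 0)).
  rewrite row2Z divfK //; congr <[row2 _ _]>%VS.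
  by rewrite mulrAC [_ * y1 y]mulrC -H mulrAC divff ?mul1r.
by rewrite mulf_neq0 ?invr_eq0.
Qed.

(** If y and y' were not proportional, their determinant would be a nonzero scalar killing al0 x and
    al1 x, and then x = 0 by [al_inj]. *)
Lemma Rpi_uniq x y y' : x != 0 -> Rpi x y -> Rpi x y' -> <[y]>%VS = <[y']>%VS.
Proof.
move=> xn [yn xy] [y'n xy']; apply: row2_line => //.
have H0 : (y0 y * y1 y' - y1 y * y0 y') *: al0 x = 0.
  rewrite scalerBl -!scalerA xy' [y1 y *: _]scalerA [y1 y * _]mulrC -scalerA xy.
  by rewrite !scalerA [y0 y * _]mulrC subrr.
have H1 : (y0 y * y1 y' - y1 y * y0 y') *: al1 x = 0.
  rewrite scalerBl [y0 y * _]mulrC -!scalerA -xy -xy' !scalerA.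
  by rewrite [y1 y * _]mulrC subrr.
apply/eqP; rewrite -subr_eq0; apply/eqP.
apply: contraNeq xn => d0; apply/eqP/al_inj.
  by apply/eqP; move/eqP: H0; rewrite scaler_eq0 (negPf d0).
by apply/eqP; move/eqP: H1; rewrite scaler_eq0 (negPf d0).
Qed.

(** The 2 x 2 minors of the pair (al0 x, al1 x) are quadratic forms in x that vanish on the cell,
    hence on its closure. *)
Lemma incone_rank (zeta zeta' : {linear Z -> K^o}) x : incone E x ->
  zeta (al0 x) * zeta' (al1 x) = zeta' (al0 x) * zeta (al1 x).
Proof.
move=> Ex; apply/eqP; rewrite -subr_eq0; apply/eqP.
pose L (b : {linear Z -> K^o}) (al : 'Hom(V, Z)) := [the {linear V -> K^o} of b \o al].
pose h u := L zeta al0 u * L zeta' al1 u + (-1) * (L zeta' al0 u * L zeta al1 u).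
have hh : homfun (1 + 1) h.
  by apply: homfunD; last apply: homfunZ; apply: homfunM; apply: homfun_linear.
have := Ex _ _ hh; rewrite /h /= mulN1r; apply=> P.
rewrite !al0E !al1E !linearZ /= mulN1r; apply/eqP; rewrite subr_eq0; apply/eqP.
by rewrite /GRing.scale /=; ring.
Qed.

(** Any linear form that does not kill both vectors computes their ratio; this is the local formula
    for pi. *)
Lemma Rpi_form (zeta : {linear Z -> K^o}) x : incone E x ->
  (zeta (al0 x) != 0) || (zeta (al1 x) != 0) ->
  Rpi x (row2 (zeta (al0 x)) (zeta (al1 x))).
Proof.
move=> Ex z0; split; first by rewrite row2_eq0 negb_and.
rewrite row2_0 row2_1; apply/eqP; rewrite -subr_eq0; apply/eqP/vec_eq0 => xi.
rewrite linearB !linearZ /= scalerN.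
by have := incone_rank zeta xi Ex; rewrite /GRing.scale /= => ->; rewrite mulrC subrr.
Qed.

Lemma nonzero_form (W : vectType K) (v : W) : v != 0 ->
  exists zeta : {linear W -> K^o}, zeta v != 0.
Proof.
move=> v0; case: (boolp.EM (exists zeta : {linear W -> K^o}, zeta v != 0)) => // H.
case/eqP: v0; apply: vec_eq0 => zeta; apply/eqP/negPn/negP => z0.
by apply: H; exists zeta.
Qed.

Lemma Rpi_exists_form x : incone E x -> x != 0 -> exists zeta : {linear Z -> K^o},
  (zeta (al0 x) != 0) || (zeta (al1 x) != 0).
Proof.
move=> Ex xn; have [a0|a0] := eqVneq (al0 x) 0.
  have a1 : al1 x != 0 by apply: contraNneq xn => a1; apply/eqP/al_inj.
  by have [zeta zn] := nonzero_form a1; exists zeta; rewrite zn orbT.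
by have [zeta zn] := nonzero_form a0; exists zeta; rewrite zn.
Qed.

Lemma Rpi_exists x : incone E x -> x != 0 -> exists y, Rpi x y.
Proof.
move=> Ex xn; have [zeta zn] := Rpi_exists_form Ex xn.
by exists (row2 (zeta (al0 x)) (zeta (al1 x))); apply: Rpi_form.
Qed.

Lemma pi_exists : exists pi : {vspace V} -> {vspace 'rV[K]_2},
  forall x y, x != 0 -> Rpi x y -> pi <[x]>%VS = <[y]>%VS.
Proof.
have /boolp.choice[pi piP] (L : {vspace V}) : exists l : {vspace 'rV[K]_2},
    forall x y, L = <[x]>%VS -> x != 0 -> Rpi x y -> l = <[y]>%VS.
  case: (boolp.EM (exists x y, [/\ L = <[x]>%VS, x != 0 & Rpi x y])).
    move=> [x [y [-> xn xy]]]; exists <[y]>%VS => x' y' xx' x'n xy'.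
    have [c c0 xE] := line_eq xn xx'.
    by apply: (Rpi_uniq xn xy); rewrite xE; apply: RpiZ.
  by move=> H; exists 0%VS => x y Lx xn xy; case: H; exists x, y.
by exists pi => x y; apply: piP.
Qed.

(** On the cell, w is P -> -1/P up to scalars, so P_0 goes to -1/P_0 when it is nonzero. The
    identity [key] expresses this by quadratic forms in x, which makes it extend to the closure. *)
Lemma Rpi_weyl x y : incone E x -> x != 0 -> Rpi x y -> Rpi (w x) (rot2 y).
Proof.
move=> Ex xn xy.
have key (zeta zeta' : {linear Z -> K^o}) :
    zeta (al0 (w x)) * zeta' (al0 x) + zeta (al1 (w x)) * zeta' (al1 x) = 0.
  pose L (b : {linear Z -> K^o}) (al : 'Hom(V, Z)) := [the {linear V -> K^o} of b \o al].
  pose Lw (b : {linear Z -> K^o}) (al : 'Hom(V, Z)) :=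
    [the {linear V -> K^o} of b \o (al \o w)].
  pose h u : K^o := L zeta' al0 u * Lw zeta al0 u + L zeta' al1 u * Lw zeta al1 u.
  have hh : homfun (1 + 1) h.
    by apply: homfunD; apply: homfunM; apply: homfun_linear.
  rewrite ![zeta _ * _]mulrC; apply: (Ex _ _ hh) => P.
  apply: (cell_generic (W := K^o) (Y := fun P => h (E P))) => [|Q Q0].
    have pM (f g : {linear V -> K^o}) :
        polyfun (fun c => (f (E (P + c%:P)) * g (E (P + c%:P)) : K^o)).
      have [q qE] := polyfun_coef (polyfun_cell C P) f.
      have := polyfun_scale q (polyfun_lin g (polyfun_cell C P)).
      by apply: polyfun_ext => c; rewrite qE.
    by apply: polyfunD; apply: pM.
  have [R QR] := modX_inv (n := n.+1) Q0.
  rewrite /h /= (weyl_cell_inv C QR) !linearZ /= !al0E !al1E !linearZ /=.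
  have := modX_coef0 QR; rewrite coef1 coefM big_ord1 coefN /= => QR0.
  rewrite /GRing.scale /=.
  transitivity (zeta' (Em Q) * ((- Q`_0) ^+ N * zeta (Em (- R))) * (1 - Q`_0 * R`_0)).
    by ring.
  by rewrite QR0 subrr mulr0.
have [zeta' zn] := Rpi_exists_form Ex xn.
have xy' := Rpi_form Ex zn; have [[yn _] [y'n _]] := (xy, xy').
have [c c0 yE] := line_eq yn (Rpi_uniq xn xy xy').
split.
  apply: contra_neq yn => /(congr1 rot2); rewrite rot2K linear0 => /eqP.
  by rewrite oppr_eq0 => /eqP.
rewrite /rot2 row2_0 row2_1 scaleNr; apply/eqP; rewrite -subr_eq0 opprK.
apply/eqP/vec_eq0 => zeta; rewrite yE !linearZ /= row2_0 row2_1 linearD !linearZ /=.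
have := key zeta zeta'; rewrite /GRing.scale /= => k0.
transitivity (c * (zeta (al0 (w x)) * zeta' (al0 x) + zeta (al1 (w x)) * zeta' (al1 x))).
  by ring.
by rewrite k0 mulr0.
Qed.

Lemma trans_cell c P : trans c (E P) = E (P + c%:P).
Proof. by rewrite -cellD addrC. Qed.

Lemma transK c x : trans c (trans (- c) x) = x.
Proof. by rewrite polyCN linearN exp_nilNK //; apply: c_enil. Qed.

Lemma transNK c x : trans (- c) (trans c x) = x.
Proof. by rewrite polyCN linearN exp_nilKN //; apply: c_enil. Qed.

(** The homogenization s^D exp((t/s) e_0), polynomial in s and t, which stands in for the
    translation by a ratio of linear forms. *)
Definition homexp s t u := \sum_(k < D.+1) (t ^+ k * s ^+ (D - k)) *: dpow k (ce C 1) u.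

Lemma homexpE s c u : homexp s (c * s) u = s ^+ D *: trans c u.
Proof.
rewrite /homexp /exp_nil scaler_sumr; apply: eq_bigr => k _.
transitivity (s ^+ D *: dpow k (ce C c%:P) u) => //.
rewrite ce_const dpowZ [RHS]scalerA; congr (_ *: _).
by rewrite exprMn -mulrA -exprD subnKC 1?mulrC // -ltnS.
Qed.

Lemma trans_eq0 c x : (trans c x == 0) = (x == 0).
Proof.
apply/eqP/eqP => [H|->]; last by rewrite exp_nil_0.
by rewrite -(transNK c x) H exp_nil_0.
Qed.

Lemma theta_inv : exists kappa : 'Hom(V, V'), forall l, kappa (theta l) = l.
Proof. exact: lfun_inverse. Qed.

Lemma homexp_hom (W : vectType K) (f h : {linear V -> K^o}) (A : {linear V -> W})
    (g : {linear V -> V}) :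
  hommap (D + 1) (fun v => A (homexp (f v) (- h v) (g v))).
Proof.
apply: (hommap_ext (f := fun v => \sum_(k < D.+1)
    ((- h v) ^+ k * f v ^+ (D - k)) *: A (dpow k (ce C 1) (g v)))).
  by move=> v; rewrite /homexp [RHS]linear_sum; apply: eq_bigr => k _; rewrite [RHS]linearZ.
apply: hommap_sum => k _; apply: hommapZ; last first.
  exact: (hommap_linear [the {linear V -> W} of A \o (dpow k (ce C 1) \o g)]).
apply: homfun_form; [by rewrite -ltnS | | exact: homfun_linear].
by apply: homfun_ext (homfunZ (-1) (homfun_linear h)) => u; rewrite mulN1r.
Qed.

(** Translation by - al1 x / al0 x takes each E(P) to E(P - P_0), which has the form E(Q X). Made
    homogeneous by [homexp], it is a polynomial map on the whole cone, so the closure goes into the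
    closure. *)
Lemma incone_fiber x c : incone E x -> x != 0 -> al1 x = c *: al0 x ->
  incone (fun Q => E (Q * 'X)) (trans (- c) x).
Proof.
move=> Ex xn a1x.
have a0 : al0 x != 0.
  by apply: contraNneq xn => a0; apply/eqP/al_inj; rewrite ?a1x a0 ?scaler0.
have [zeta zn] := nonzero_form a0.
pose L (al : 'Hom(V, Z)) := [the {linear V -> K^o} of zeta \o al].
pose Phi u := homexp (L al0 u) (- L al1 u) u.
have hPhi : hommap (D + 1) Phi := homexp_hom (L al0) (L al1) idfun idfun.
have PhiE u b : L al1 u = b * L al0 u -> Phi u = L al0 u ^+ D *: trans (- b) u.
  by move=> H; rewrite /Phi H -mulNr homexpE.
have -> : trans (- c) x = (zeta (al0 x) ^+ D)^-1 *: Phi x.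
  rewrite (PhiE _ c); last by rewrite /= a1x linearZ.
  by rewrite scalerA mulVf ?scale1r // expf_neq0.
apply/incone_scale/(incone_map hPhi _ Ex) => P.
rewrite (PhiE _ P`_0); last by rewrite /= al0E al1E linearZ.
apply: incone_scale; rewrite trans_cell.
have /dvdpP[Q ->] : 'X %| P + (- P`_0)%:P.
  by rewrite dvdX_coef0 coefD coefC /= addrN.
exact: (@incone_id _ _ _ (fun Q => E (Q * 'X)) Q).
Qed.

Lemma Rpi_ratio x y : y0 y != 0 -> Rpi x y -> al1 x = (y1 y / y0 y) *: al0 x.
Proof.
move=> s0 [_ xy]; apply: (scalerI s0); rewrite -xy scalerA mulrCA divff ?mulr1 //.
Qed.

Lemma incone_fiber_sub c x : incone (fun Q => E (Q * 'X + c%:P)) x ->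
  incone E x /\ Rpi x (row2 1 c).
Proof.
move=> Ex; split; first by apply: incone_sub Ex => Q; apply: incone_id.
split; first by rewrite row2_eq0 oner_eq0.
rewrite row2_0 row2_1 scale1r.
apply: (incone_eq (f := [the {linear V -> Z} of *:%R c \o al0]) (g := al1) Ex) => Q /=.
by rewrite al0E al1E coefD coefMX coefC /= add0r.
Qed.

Lemma incone_theta l c : incone E' l ->
  incone (fun Q => E (Q * 'X + c%:P)) (trans c (theta l)).
Proof.
apply: (incone_map (hommap_linear [the {linear V' -> V} of exp_nil (ce C c%:P) \o theta])).
by move=> Q /=; rewrite thetaE trans_cell; exact: (@incone_id _ _ _ (fun Q => E (Q * 'X + c%:P)) Q).
Qed.

(** The composite of [kappa] and [theta] is linear and fixes each E(Q X), hence fixes their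
    closure. *)
Lemma incone_kappa (kappa : 'Hom(V, V')) m : (forall l, kappa (theta l) = l) ->
  incone (fun Q => E (Q * 'X)) m -> incone E' (kappa m) /\ theta (kappa m) = m.
Proof.
move=> kappaK Em'; split.
  apply: (incone_map (hommap_lfun kappa)) Em' => Q.
  by rewrite -thetaE kappaK; apply: incone_id.
apply: (incone_eq (f := [the {linear V -> V} of theta \o kappa])
  (g := [the {linear V -> V} of idfun]) Em') => Q /=.
by rewrite -thetaE kappaK.
Qed.

Lemma weyl2 x : incone E x -> w (w x) = (-1) ^+ N *: x.
Proof.
move=> Ex; apply: (incone_eq (f := [the {linear V -> V} of w \o w])
  (g := [the {linear V -> V} of *:%R ((-1) ^+ N : K)]) Ex) => P.
exact: weyl2_cell.
Qed.


Variable pi : {vspace V} -> {vspace 'rV[K]_2}.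
Hypothesis piP : forall x y, x != 0 -> Rpi x y -> pi <[x]>%VS = <[y]>%VS.

Lemma pi_Rpi x y : incone E x -> x != 0 -> y != 0 -> pi <[x]>%VS = <[y]>%VS -> Rpi x y.
Proof.
move=> Ex xn yn; have [y' xy'] := Rpi_exists Ex xn.
by rewrite (piP xn xy') => /esym/(line_eq yn)[c c0 ->]; apply: RpiZy.
Qed.

Lemma pi_cone L : cone_set E L -> proj (pi L).
Proof.
move=> [x [xn -> Ex]]; have [y xy] := Rpi_exists Ex xn.
by rewrite (piP xn xy); apply/proj_line; case: xy.
Qed.

Lemma regular_pi : regular (cone_set E) pi.
Proof.
move=> L [x [xn -> Ex]]; have [zeta zn] := Rpi_exists_form Ex xn.
pose La (al : 'Hom(V, Z)) := [the {linear V -> K^o} of zeta \o al].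
have [al alE xal] : exists2 al, al = al0 \/ al = al1 & zeta (al x) != 0.
  by case/orP: zn => zn; [exists al0; auto | exists al1; auto].
exists (nonvan (La al)), 1%N, (fun v => row2 (zeta (al0 v)) (zeta (al1 v))); split.
- exact: zopen_nonvan (homfun_linear _).
- by apply/(nonvan_line _ (homfun_linear _)).
- by apply: hommap_row2; apply: (homfun_linear (La _)).
move=> L' v L'E UL' vL' vn; have [L'v Ev] := cone_set_mem L'E vL' vn.
have zv : (zeta (al0 v) != 0) || (zeta (al1 v) != 0).
  move: UL'; rewrite L'v => /(nonvan_line _ (homfun_linear _)) /=.
  by case: alE => -> ->; rewrite ?orbT.
have xy := Rpi_form Ev zv; split; first by case: xy.
by rewrite L'v; apply: piP.
Qed.

Definition ratio y := y1 y / y0 y.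

Lemma ratioZ c y : c != 0 -> ratio (c *: y) = ratio y.
Proof. by move=> c0; rewrite /ratio !linearZ /= invfM mulrACA divff ?mul1r. Qed.

Lemma ratio_row2 y : y0 y != 0 -> y = y0 y *: row2 1 (ratio y).
Proof. by move=> s0; rewrite row2Z mulr1 mulrCA divff // mulr1 -row2_eta. Qed.

Lemma homexp_bihom (f : {linear V -> V}) (r : {linear 'rV[K]_2 -> 'rV[K]_2}) :
  bihommap D 1 (fun y (l : V') => f (homexp (y0 (r y)) (y1 (r y)) (theta l))).
Proof.
move=> i; have [m [p [q [Hp Hq pqE]]]] : bihomfun D 1 (fun y (l : V') => \sum_(k < D.+1)
    (y1 (r y) ^+ k * y0 (r y) ^+ (D - k)) *
    coord (vbasis {:V}) i (f (dpow k (ce C 1) (theta l)))).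
  apply: bihomfun_sum => k.
    apply: homfun_form; first by rewrite -ltnS.
      exact: (homfun_linear [the {linear 'rV[K]_2 -> K^o} of ycoord ord_max \o r]).
    exact: (homfun_linear [the {linear 'rV[K]_2 -> K^o} of ycoord ord0 \o r]).
  exact: (homfun_linear [the {linear V' -> K^o} of coord (vbasis {:V}) i \o
    (f \o (dpow k (ce C 1) \o theta))]).
exists m, p, q; split=> // y l; rewrite -pqE /homexp !linear_sum.
by apply: eq_bigr => k _; rewrite !linearZ.
Qed.

Section Chart.
Variables (g gi : 'End(V)) (r ri : {linear 'rV[K]_2 -> 'rV[K]_2}).
Hypothesis g_cone : forall x, incone E x -> incone E (g x).
Hypothesis gi_cone : forall x, incone E x -> incone E (gi x).
Hypothesis gK : forall x, incone E x -> gi (g x) = x.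
Hypothesis giK : forall x, incone E x -> g (gi x) = x.
Hypothesis g_Rpi : forall x y, incone E x -> x != 0 -> Rpi x y -> Rpi (g x) (r y).
Hypothesis gi_Rpi : forall x y, incone E x -> x != 0 -> Rpi x y -> Rpi (gi x) (ri y).
Hypothesis rK : forall y, ri (r y) = y.

Let r0 : {linear 'rV[K]_2 -> K^o} := [the {linear 'rV[K]_2 -> K^o} of ycoord ord0 \o r].

(** The maps [g] and [r] move the chart at hand to the standard one, y_0 != 0; with the identity and
    the Weyl element for [g], one computation serves both charts. *)
Lemma chart_trivial : let YU := fun Y : {vspace 'rV[K]_2} => proj Y /\ nonvan r0 Y in
  let XU := fun L : {vspace V} => cone_set E L /\ nonvan r0 (pi L) in
  exists (phi : {vspace V} -> {vspace V'})
         (psi : {vspace 'rV[K]_2} -> {vspace V'} -> {vspace V}),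
  [/\ regular XU phi, regular2 YU (cone_set E') psi,
      forall L, XU L -> cone_set E' (phi L) /\ psi (pi L) (phi L) = L
    & forall Y l, YU Y -> cone_set E' l ->
      [/\ XU (psi Y l), pi (psi Y l) = Y & phi (psi Y l) = l]].
Proof.
move=> YU XU; have [kappa kappaK] := theta_inv.
have gn x : incone E x -> x != 0 -> g x != 0.
  by move=> Ex; apply: contra_neq => gx; rewrite -(gK Ex) gx linear0.
have gin x : incone E x -> x != 0 -> gi x != 0.
  by move=> Ex; apply: contra_neq => gx; rewrite -(giK Ex) gx linear0.
have r0_line y : nonvan r0 <[y]>%VS <-> r0 y != 0.
  exact: (nonvan_line y (homfun_linear r0)).
(* The trivialization and its inverse on vectors. By [phiE] and [psiE] the resulting lines do not
   depend on the vectors picked. *)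
pose sec x y := kappa (trans (- ratio (r y)) (g x)).
pose ret y l := gi (trans (ratio (r y)) (theta l)).
pose phi L := <[sec (vpick L) (vpick (pi L))]>%VS.
pose psi Y l := <[ret (vpick Y) (vpick l)]>%VS.
have phiE x y : x != 0 -> y != 0 -> pi <[x]>%VS = <[y]>%VS ->
    phi <[x]>%VS = <[sec x y]>%VS.
  move=> xn yn xy; rewrite /phi xy.
  have [b b0 ->] := vpick_line xn; have [c c0 ->] := vpick_line yn.
  by rewrite /sec [r _]linearZ ratioZ // !linearZ /= lineZ.
have psiE y l : y != 0 -> l != 0 -> psi <[y]>%VS <[l]>%VS = <[ret y l]>%VS.
  move=> yn ln; rewrite /psi.
  have [b b0 ->] := vpick_line yn; have [c c0 ->] := vpick_line ln.
  by rewrite /ret [r _]linearZ ratioZ // !linearZ /= lineZ.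
have secP x y : incone E x -> x != 0 -> Rpi x y -> r0 y != 0 ->
    [/\ incone E' (sec x y), theta (sec x y) = trans (- ratio (r y)) (g x)
      & sec x y != 0].
  move=> Ex xn xy ry; have gxy := g_Rpi Ex xn xy.
  have := incone_fiber (g_cone Ex) (gn _ Ex xn) (Rpi_ratio ry gxy).
  move=> /(incone_kappa kappaK)[H1 H2]; split=> //.
  apply: contra_neq (gn _ Ex xn) => H; apply/eqP; move/eqP: H2.
  by rewrite -[kappa _]/(sec x y) H linear0 eq_sym trans_eq0.
have retP y l : incone E' l -> l != 0 -> r0 y != 0 ->
    [/\ incone E (ret y l), ret y l != 0, g (ret y l) = trans (ratio (r y)) (theta l)
      & Rpi (ret y l) y].
  move=> El ln ry; have [E1 xy] := incone_fiber_sub (incone_theta (c := ratio (r y)) El).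
  have tn : trans (ratio (r y)) (theta l) != 0.
    rewrite trans_eq0; apply: contra_neq ln => tl.
    by rewrite -(kappaK l) tl linear0.
  split; [exact: gi_cone | exact: gin | exact: giK |].
  rewrite /ret -[y in Rpi _ y]rK; apply: gi_Rpi => //.
  by rewrite [X in Rpi _ X](ratio_row2 ry); apply: RpiZy.
exists phi, psi; split.
- move=> L [[x [xn -> Ex]]]; have [y xy] := Rpi_exists Ex xn.
  rewrite (piP xn xy) => /r0_line ry.
  have a0 : al0 (g x) != 0.
    apply: contraNneq (gn _ Ex xn) => a0; apply/eqP/al_inj => //.
    by rewrite (Rpi_ratio ry (g_Rpi Ex xn xy)) a0 scaler0.
  have [zeta zn] := nonzero_form a0.
  pose La (al : 'Hom(V, Z)) := [the {linear V -> K^o} of zeta \o (al \o g)].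
  (* On this open set the ratio is a quotient with denominator zeta(al0 (g x)); multiplying by the
     D-th power of the denominator makes [phi] homogeneous of degree D + 1. *)
  exists (nonvan (La al0)), (D + 1)%N,
    (fun v => kappa (homexp (La al0 v) (- La al1 v) (g v))); split.
  + exact: zopen_nonvan (homfun_linear _).
  + by apply/(nonvan_line _ (homfun_linear _)).
  + exact: (homexp_hom (La al0) (La al1) kappa g).
  move=> L' v [L'E UL'] VL' vL' vn; have [L'v Ev] := cone_set_mem L'E vL' vn.
  have [y' vy'] := Rpi_exists Ev vn.
  move: UL' VL'; rewrite L'v (piP vn vy') => /r0_line ry'.
  move=> /(nonvan_line _ (homfun_linear _)) zv.
  have [_ _ sn] := secP _ _ Ev vn vy' ry'.
  have -> : - La al1 v = - ratio (r y') * La al0 v.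
    by rewrite /= (Rpi_ratio ry' (g_Rpi Ev vn vy')) linearZ mulNr.
  rewrite homexpE linearZ /= scaler_eq0 negb_or expf_neq0 // lineZ ?expf_neq0 //.
  split=> //; apply: phiE => //; first by case: vy'.
  exact: piP.
- move=> L1 L2 _ _.
  exists (fun _ _ => True), D, 1%N, (fun y (l : V') =>
    gi (homexp (y0 (r y)) (y1 (r y)) (theta l))); split=> //.
  + exact: zopen2T.
  + exact: homexp_bihom.
  move=> Y L' y l [Yp UY] L'E _ yY yn lL ln.
  have [L'l El] := cone_set_mem L'E lL ln.
  have YE : Y = <[y]>%VS.
    by have [y' y'n YE] := line_gen Yp; move: yY; rewrite YE => /line_mem/(_ yn)[c c0 ->]; rewrite lineZ.
  move: UY; rewrite YE L'l => /r0_line ry.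
  have [_ rn _ _] := retP y l El ln ry.
  have -> : y1 (r y) = ratio (r y) * y0 (r y) by rewrite divfK.
  rewrite homexpE linearZ /= scaler_eq0 negb_or expf_neq0 // lineZ ?expf_neq0 //.
  by split=> //; apply: psiE.
- move=> L [[x [xn -> Ex]]]; have [y xy] := Rpi_exists Ex xn.
  rewrite (piP xn xy) => /r0_line ry; have yn : y != 0 by case: xy.
  have [sE sT sn] := secP _ _ Ex xn xy ry.
  rewrite (phiE _ _ xn yn (piP xn xy)); split; first by exists (sec x y).
  by rewrite psiE // /ret sT transK gK.
- move=> Y L [Yp]; have [y yn ->] := line_gen Yp => /r0_line ry [l [ln -> El]].
  have [rE rn gr ry'] := retP y l El ln ry.
  have pr := piP rn ry'.
  rewrite psiE //; split=> //.
    by split; [exists (ret y l) | rewrite pr; apply/r0_line].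
  by rewrite (phiE _ _ rn yn pr) /sec gr transNK kappaK.
Qed.

End Chart.

Lemma bundle_trivial :
  locally_trivial_bundle (cone_set E) (@proj _ 'rV[K]_2) (cone_set E') pi.
Proof.
split; [exact: regular_pi | exact: pi_cone |].
move=> Y Yp; have [y yn ->] := line_gen Yp.
have chart_open (r : {linear 'rV[K]_2 -> 'rV[K]_2}) : y0 (r y) != 0 ->
    zopen (nonvan [the {linear 'rV[K]_2 -> K^o} of ycoord ord0 \o r]) /\
    nonvan [the {linear 'rV[K]_2 -> K^o} of ycoord ord0 \o r] <[y]>%VS.
  move=> ry; split; first exact: zopen_nonvan (homfun_linear _).
  by apply/(nonvan_line _ (homfun_linear _)).
have [s0|s0] := eqVneq (y0 y) 0; last first.
  have [//|U1 U2] := chart_open [the {linear 'rV[K]_2 -> 'rV[K]_2} of idfun].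
  exists (nonvan [the {linear 'rV[K]_2 -> K^o} of ycoord ord0 \o idfun]); split=> //.
  by apply: (chart_trivial (g := \1%VF) (gi := \1%VF) (ri := idfun)) => *;
    rewrite ?id_lfunE.
(* The point at infinity is moved into the standard chart by w, whose inverse on the cone is (-1)^N
   w. *)
have ry : y0 (rot2 y) != 0.
  rewrite row2_0 oppr_eq0; apply: contraNneq yn => t0.
  by rewrite [y]row2_eta s0 t0 row2_eq0 eqxx.
have [//|U1 U2] := chart_open [the {linear 'rV[K]_2 -> 'rV[K]_2} of rot2].
exists (nonvan [the {linear 'rV[K]_2 -> K^o} of ycoord ord0 \o rot2]); split=> //.
have sgnK : (-1) ^+ N * (-1) ^+ N = 1 :> K by rewrite -exprMn mulrNN mulr1 expr1n.
apply: (chart_trivial (g := w) (gi := (-1) ^+ N *: w) (r := rot2)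
  (ri := [the {linear 'rV[K]_2 -> 'rV[K]_2} of -%R \o rot2])).
- by move=> x; apply: incone_weyl.
- by move=> x Ex; rewrite scale_lfunE; apply/incone_scale/incone_weyl.
- by move=> x Ex; rewrite scale_lfunE weyl2 // scalerA sgnK scale1r.
- by move=> x Ex; rewrite scale_lfunE linearZ /= weyl2 // scalerA sgnK scale1r.
- exact: Rpi_weyl.
- move=> x y' Ex xn /(Rpi_weyl Ex xn) xy; rewrite scale_lfunE /= -scaleN1r.
  by apply/RpiZ/RpiZy => //; rewrite oppr_eq0 oner_eq0.
- by move=> y' /=; rewrite rot2K opprK.
Qed.

Lemma fiber_finite c L : (cone_set E L /\ pi L = <[row2 1 c]>%VS) <->
  cone_set (fun Q => E (Q * 'X + c%:P)) L.
Proof.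
have rn : row2 1 c != 0 by rewrite row2_eq0 oner_eq0.
split=> [[[x [xn -> Ex]] /(pi_Rpi Ex xn rn) xy]|[x [xn -> /incone_fiber_sub[Ex xy]]]].
  exists x; split=> //.
  have a1x : al1 x = c *: al0 x by case: xy => _; rewrite row2_0 row2_1 scale1r.
  rewrite -(transK c x); move: (incone_fiber Ex xn a1x).
  apply: (incone_map (hommap_linear [the {linear V -> V} of exp_nil (ce C c%:P)])).
  by move=> Q /=; rewrite trans_cell; exact: (@incone_id _ _ _ (fun Q => E (Q * 'X + c%:P)) Q).
by split; [exists x | apply: piP].
Qed.

Lemma Rpi_cocell Q : cell C (Q * 'X) != 0 -> Rpi (cocell C (- (Q * 'X))) (row2 0 1).
Proof.
move=> En; rewrite -weyl_cell.
have := Rpi_weyl (@incone_id _ _ _ E (Q * 'X)) En (Rpi_cell (Q * 'X)).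
by rewrite /rot2 row2_0 row2_1 coefMX oppr0.
Qed.

Hypothesis v_neq0 : cv C != 0.

Lemma cell_neq0 P : E P != 0.
Proof.
apply: contra_neq v_neq0 => EP.
by rewrite -(exp_nilKN (cv C) (c_enil C P)) -/(E P) EP exp_nil_0.
Qed.

Lemma top_neq0 : top C != 0.
Proof.
apply: contra_neq v_neq0 => t0; apply: (weyl_inj (C := C)).
by rewrite weyl_v t0 linear0.
Qed.

Lemma cocell_neq0 Q : cocell C Q != 0.
Proof.
apply: contra_neq top_neq0 => EP.
by rewrite -(exp_nilKN (top C) (c_fnil C Q)) -/(cocell C Q) EP exp_nil_0.
Qed.

Lemma pi_cell P : pi <[E P]>%VS = <[row2 1 P`_0]>%VS.
Proof. by apply: piP (cell_neq0 P) (Rpi_cell P). Qed.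

Lemma Rpi_cocell0 Q : Rpi (cocell C (Q * 'X)) (row2 0 1).
Proof. by have := Rpi_cocell (cell_neq0 (- Q * 'X)); rewrite mulNr opprK. Qed.

Lemma pi_cocell Q : pi <[cocell C (Q * 'X)]>%VS = <[row2 0 1]>%VS.
Proof. by apply: piP (cocell_neq0 _) (Rpi_cocell0 Q). Qed.

(** The Weyl element exchanges this fiber with the one over [1 : 0], which is [incone_fiber] at c =
    0, and it turns E(Q X) into the vector [cocell C (- (Q * 'X))]. *)
Lemma fiber_infinite L : (cone_set E L /\ pi L = <[row2 0 1]>%VS) <->
  cone_set (fun Q => cocell C (Q * 'X)) L.
Proof.
have rn : row2 0 1 != 0 :> 'rV[K]_2 by rewrite row2_eq0 oner_eq0 andbF.
split=> [[[x [xn -> Ex]] /(pi_Rpi Ex xn rn) xy]|[x [xn -> cx]]].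
  exists x; split=> //.
  have wn : w x != 0.
    by apply: contra_neq xn => wx; apply: (weyl_inj (C := C)); rewrite wx linear0.
  have /Rpi_ratio := Rpi_weyl Ex xn xy; rewrite /rot2 !row2_0 !row2_1 mul0r oppr_eq0 oner_eq0.
  move=> /(_ isT)/(incone_fiber (incone_weyl Ex) wn).
  rewrite oppr0 polyC0 linear0 exp_nil0 => wE.
  have -> : x = (-1) ^+ N *: w (w x).
    by rewrite weyl2 // scalerA -exprMn mulrNN mulr1 expr1n scale1r.
  apply: incone_scale; apply: (incone_map (hommap_lfun w)) wE => Q.
  rewrite weyl_cell -mulNr.
  exact: (@incone_id _ _ _ (fun Q => cocell C (Q * 'X)) (- Q)).
have Ex : incone E x by apply: incone_sub cx => Q; apply: incone_cocell.
split; first by exists x.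
apply: piP => //; split=> //; rewrite row2_0 row2_1 scale1r scale0r.
apply: (incone_linear cx) => Q; case: (Rpi_cocell0 Q) => _.
by rewrite row2_0 row2_1 scale1r scale0r.
Qed.

Definition orbit_curve : pset V :=
  fun L => (exists c, L = <[E c%:P]>%VS) \/ L = <[top C]>%VS.

(** The rational normal curve of degree N in homogeneous coordinates; it provides the inverse of pi
    on the orbit of SL_2. *)
Definition curve y := \sum_(k < N.+1) (y1 y ^+ k * y0 y ^+ (N - k)) *: weight_vec C k.

Lemma curve_cell y : y0 y != 0 -> curve y = y0 y ^+ N *: E (ratio y)%:P.
Proof.
move=> s0; rewrite cell_const scaler_sumr; apply: eq_bigr => k _.
rewrite [RHS]scalerA; congr (_ *: _).
have -> : y0 y ^+ N = y0 y ^+ (N - k) * y0 y ^+ k by rewrite -exprD subnK // -ltnS.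
by rewrite /ratio expr_div_n -mulrA [y0 y ^+ k * _]mulrC divfK 1?mulrC ?expf_neq0.
Qed.

Lemma curve_top y : y0 y = 0 -> curve y = y1 y ^+ N *: top C.
Proof.
move=> s0; rewrite /curve big_ord_recr /= subnn mulr1 big1 ?add0r // => k _.
by rewrite s0 expr0n subn_eq0 leqNgt ltn_ord /= mulr0 scale0r.
Qed.

Lemma cocell0 : cocell C (0 * 'X) = top C.
Proof. by rewrite /cocell mul0r linear0 exp_nil0. Qed.

Lemma curveP y : y != 0 ->
  [/\ curve y != 0, Rpi (curve y) y & orbit_curve <[curve y]>%VS].
Proof.
move=> yn; have [s0|s0] := eqVneq (y0 y) 0.
  have t0 : y1 y != 0.
    by apply: contraNneq yn => t0; rewrite [y]row2_eta s0 t0 row2_eq0 eqxx.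
  rewrite curve_top //; split.
  - by rewrite scaler_eq0 negb_or expf_neq0 ?top_neq0.
  - have -> : y = y1 y *: row2 0 1 by rewrite row2Z mulr0 mulr1 {1}[y]row2_eta s0.
    by apply/RpiZ/RpiZy => //; rewrite -cocell0; apply: Rpi_cocell0.
  - by right; rewrite lineZ ?expf_neq0.
rewrite curve_cell //; split.
- by rewrite scaler_eq0 negb_or expf_neq0 ?cell_neq0.
- rewrite [y in Rpi _ y]ratio_row2 //; apply/RpiZ/RpiZy => //.
  by have := Rpi_cell (ratio y)%:P; rewrite coefC.
- by left; exists (ratio y); rewrite lineZ ?expf_neq0.
Qed.

Lemma orbit_curve_cone L : orbit_curve L -> cone_set E L.
Proof.
case=> [[c ->]|->].
  by exists (E c%:P); split; [apply: cell_neq0 | | apply: incone_id].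
exists (top C); split; [exact: top_neq0 | by [] |].
by rewrite -cocell0; apply: incone_cocell.
Qed.

Lemma isomorphism_orbit : isomorphism orbit_curve (@proj _ 'rV[K]_2) pi.
Proof.
pose psi (Y : {vspace 'rV[K]_2}) := <[curve (vpick Y)]>%VS.
have psiE y : y != 0 -> psi <[y]>%VS = <[curve y]>%VS.
  move=> yn; rewrite /psi; have [c c0 ->] := vpick_line yn.
  have -> : curve (c *: y) = c ^+ N *: curve y.
    rewrite /curve scaler_sumr; apply: eq_bigr => k _.
    rewrite [RHS]scalerA !linearZ /= !exprMn mulrACA -exprD subnKC //.
    by rewrite -ltnS.
  by rewrite lineZ // expf_neq0.
exists psi; split.
- move=> L /orbit_curve_cone/regular_pi[U [d [Phi [H1 H2 H3 H4]]]].
  exists U, d, Phi; split=> // L' v /orbit_curve_cone; exact: H4.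
- move=> Y _; exists (fun _ => True), N, curve; split=> //.
  + exact: zopenT.
  + apply: hommap_dual => f.
    apply: (homfun_ext (h := fun y => \sum_(k < N.+1)
      f (weight_vec C k) * (y1 y ^+ k * y0 y ^+ (N - k)))).
      move=> y; rewrite /curve [RHS]linear_sum; apply: eq_bigr => k _.
      by rewrite [RHS]linearZ mulrC.
    apply: homfun_sum => k _; apply: homfunZ; apply: homfun_form; first by rewrite -ltnS.
      exact: homfun_linear.
    exact: homfun_linear.
  move=> L y Lp _ yL yn; have [cn _ _] := curveP yn; split=> //.
  have -> : L = <[y]>%VS by have [x xn LE] := line_gen Lp;
    move: yL; rewrite LE => /line_mem/(_ yn)[c c0 ->]; rewrite lineZ.
  exact: psiE.
- move=> L oL; split; first exact/pi_cone/orbit_curve_cone.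
  case: oL => [[c ->]|->].
    rewrite pi_cell psiE ?row2_eq0 ?oner_eq0 // curve_cell ?row2_0 ?oner_eq0 //.
    by rewrite expr1n scale1r /ratio row2_0 row2_1 divr1 coefC.
  rewrite -cocell0 pi_cocell psiE ?row2_eq0 ?oner_eq0 ?andbF //.
  by rewrite curve_top ?row2_0 // row2_1 expr1n scale1r cocell0.
- move=> Y Yp; have [y yn ->] := line_gen Yp; have [cn cR cO] := curveP yn.
  by rewrite psiE //; split=> //; apply: piP.
Qed.

End Bundle.

Lemma in_orbit_mod (K : numFieldType) n N (V : vectType K) (C : current n.+1 N V)
    (B B' D D' : {poly K}) x :
  'X^(n.+1) %| B - B' -> 'X^(n.+1) %| D - D' ->
  in_orbit C B D x -> in_orbit C B' D' x.
Proof.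
move=> BB DD; rewrite /in_orbit (modX_coef0 BB) (modX_coef0 DD).
have DD' := DD; rewrite -dvdpNr opprB in DD'.
have BB' := BB; rewrite -dvdpNr opprB in BB'.
case=> [[D0 [c [P [c0 H ->]]]]|[D0 [c [P [c0 H ->]]]]]; [left|right]; split=> //;
  exists c, P; split=> //.
  rewrite (_ : _ - _ = P * (D' - D) + 1 * ((P * D - B) + (B - B'))); last by ring.
  by apply: dvdp_lin => //; apply: dvdp_add.
rewrite (_ : _ - _ = P * (B' - B) + 1 * ((P * B - D) + (D - D'))); last by ring.
by apply: dvdp_lin => //; apply: dvdp_add.
Qed.

(** * Representatives of truncated polynomials *)

Section TruncatedPolynomials.
Context {K : fieldType} {n : nat}.
Local Notation tp := (trunc_poly (K := K) n.+1).

Lemma dvdp_trunc_mod (p : {poly K}) : 'X^(n.+1) %| p - Pdiv.CommonRing.rmodp p (mk_monic 'X^(n.+1)).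
Proof.
rewrite mk_monic_Xn /= {1}(Pdiv.RingMonic.rdivp_eq (monicXn K n.+1) p).
by rewrite addrK dvdp_mull.
Qed.

Lemma dvdp_in_qpoly (p : {poly K}) :
  'X^(n.+1) %| p - (in_qpoly 'X^(n.+1) p : {poly K}).
Proof. exact: dvdp_trunc_mod. Qed.

Lemma dvdp_truncM (p q : tp) :
  'X^(n.+1) %| (p : {poly K}) * (q : {poly K}) - (p * q : tp).
Proof. exact: dvdp_trunc_mod. Qed.

Lemma trunc_coefE (p : tp) i : (n < i)%N -> trunc_coef p i = 0.
Proof.
move=> ni; apply: nth_default.
have size_mk : size (mk_monic ('X^(n.+1) : {poly K})) = n.+2.
  by rewrite mk_monic_Xn size_polyXn.
have := leq_trans (size_mk_monic p : (_ < _)%N) (eq_leq size_mk).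
by rewrite ltnS => /leq_trans; apply.
Qed.

End TruncatedPolynomials.

(** * The orbit of G in terms of the cells *)

Section Orbits.
Context {K : numFieldType} {n : nat} {a : 'I_n.+1 -> nat} {z : 'I_n.+1 -> K}.
Variable M : fusion_product a z.
Hypothesis a_gt0 : forall i, (0 < a i)%N.
Local Notation N := (\sum_i (a i).-1)%N.
Local Notation C := (fusion_current M a_gt0).
Local Notation E := (cell C).
Local Notation tp := (trunc_poly (K := K) n.+1).
Local Notation low := (low_tens (K := K) a).
Implicit Types (p : nat -> K) (P Q : {poly K}).

Lemma ce_poly p : ce C (\poly_(i < n.+1) p i) =
  \sum_(0 <= i < n.+1) p i *: fp_act M (@sl2_e K) i.
Proof.
rewrite big_mkord; apply: eq_bigr => i _.
by rewrite coef_poly ltn_ord.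
Qed.

Lemma cf_poly p : cf C (\poly_(i < n.+1) p i) =
  \sum_(0 <= i < n.+1) p i *: fp_act M (@sl2_f K) i.
Proof.
rewrite big_mkord; apply: eq_bigr => i _.
by rewrite coef_poly ltn_ord.
Qed.

Lemma exp_eE p m : exp_e p m = exp_nil (ce C (\poly_(i < n.+1) p i)) m.
Proof. by rewrite ce_poly. Qed.

Lemma exp_fE p m : exp_f p m = exp_nil (cf C (\poly_(i < n.+1) p i)) m.
Proof. by rewrite cf_poly. Qed.

Lemma poly_trunc (q : tp) : \poly_(i < n.+1) trunc_coef q i = (q : {poly K}).
Proof.
apply/polyP => i; rewrite coef_poly; case: ltnP => // /trunc_coefE.
by rewrite /trunc_coef => ->.
Qed.

Lemma exp_trunc_e (q : tp) m : exp_e (trunc_coef q) m = exp_nil (ce C q) m.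
Proof. by rewrite exp_eE poly_trunc. Qed.

Lemma exp_trunc_f (q : tp) m : exp_f (trunc_coef q) m = exp_nil (cf C q) m.
Proof. by rewrite exp_fE poly_trunc. Qed.

Lemma elementary_mulE (R : comNzRingType) m (p : R) (i j : 'I_2) (g : 'M_(2, m)) k l :
  ((1%:M + p *: delta_mx i j) *m g) k l = g k l + p * ((k == i)%:R * g j l).
Proof.
rewrite mulmxDl mul1mx mxE -scalemxAl; congr (_ + _); rewrite !mxE; congr (_ * _).
rewrite (bigD1 j) //= mxE eqxx andbT big1 ?addr0 // => h /negPf hj.
by rewrite mxE hj andbF mul0r.
Qed.

(** An elementary matrix changes the second column (B, D) into (B + p D, D) or (B, D + p B), and
    [in_orbit_exp_e] and [in_orbit_exp_f] follow these changes. *)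
Lemma SL2_act_orbit (g : 'M[tp]_2) (T : M -> M) : SL2_act g T ->
  in_orbit C (g ord0 ord_max) (g ord_max ord_max) (T (v_low M)).
Proof.
elim=> [|p {}g {}T _ IH|p {}g {}T _ IH].
- by rewrite !mxE /=; apply: in_orbit_v.
- rewrite !elementary_mulE eqxx mul1r mul0r mulr0 addr0 /= exp_trunc_e.
  apply: in_orbit_mod (in_orbit_exp_e p IH); last by rewrite subrr dvdp0.
  by rewrite /= opprD addrACA subrr add0r; apply: dvdp_truncM.
- rewrite !elementary_mulE eqxx mul1r mul0r mulr0 addr0 /= exp_trunc_f.
  apply: in_orbit_mod (in_orbit_exp_f p IH); first by rewrite subrr dvdp0.
  by rewrite /= opprD addrACA subrr add0r; apply: dvdp_truncM.
Qed.

Lemma det_elementary (R : comNzRingType) m (i j : 'I_m) (p : R) : i != j ->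
  \det (1%:M + p *: delta_mx i j) = 1.
Proof.
have low (k l : 'I_m) : (l < k)%N -> \det (1%:M + p *: delta_mx k l) = 1.
  move=> lk; rewrite det_trig.
    rewrite big1 // => h _; rewrite !mxE eqxx.
    case: (h =P k) => [->|_] /=; last by rewrite mulr0 addr0.
    by rewrite -val_eqE /= gtn_eqF // mulr0 addr0.
  apply/is_trig_mxP => h h' hh'; rewrite !mxE -!val_eqE /= ltn_eqF // add0r.
  case: (h =P k :> nat) => [hk|_]; last by rewrite mulr0.
  by rewrite gtn_eqF ?mulr0 //; apply: ltn_trans hh'; rewrite hk.
move=> ij; case: (ltngtP i j) => [lij|/low //|/val_inj/eqP]; last by rewrite (negPf ij).
by rewrite -det_tr linearD linearZ /= trmx1 trmx_delta low.
Qed.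

Lemma G_orbit_cell P : G_orbit M <[E P]>%VS.
Proof.
pose q : tp := in_qpoly 'X^(n.+1) P.
exists ((1%:M + q *: delta_mx ord0 ord_max) *m 1%:M), (exp_e (trunc_coef q) \o id).
split; first by rewrite mulmx1 det_elementary.
  exact/SL2_actE/SL2_act1.
rewrite /= exp_trunc_e; congr <[_]>%VS; apply: cell_mod.
exact: dvdp_in_qpoly.
Qed.

(** The orbit lies in the closure of the first cell by [in_orbit_incone], and the lines of this cell
    are images of that of v under elementary matrices. *)
Lemma sh_cone : sh M = cone_set E.
Proof.
apply: boolp.funext => L; apply: boolp.propext; split=> [[Lp H]|[x [xn -> Ex]]].
  have [x xn LE] := line_gen Lp; exists x; split=> // d h hd h0.
  apply: (H d h hd) => [L' v|]; last by rewrite LE memv_line.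
  move=> [g [T [_ /SL2_act_orbit/in_orbit_incone ET ->]]] /vlineP[c ->].
  exact: (incone_scale c ET hd h0).
split; first exact/proj_line.
move=> d h hd h0 v /vlineP[c ->]; apply: (incone_scale c Ex hd) => P.
exact: (h0 _ _ (G_orbit_cell P) (memv_line _)).
Qed.

Lemma low_neq0 : v_low M != 0.
Proof.
apply/eqP => /(symb_ker M (filt_low z 0)) /= /ffunP.
have J0 i : (0 < a i)%N by [].
move=> /(_ [ffun i => Ordinal (J0 i)]); rewrite !ffunE.
have -> : [forall i, ([ffun i => Ordinal (J0 i)] : tindex a) i == 0%N :> nat] = true.
  by apply/forallP => i; rewrite ffunE.
by move/eqP; rewrite oner_eq0.
Qed.

Lemma ce1_symb k : iter k (ce C 1) (v_low M) =
  symb M 0 (iter k (XT z 1 (fun=> 1)) low) /\ filt z 0 (iter k (XT z 1 (fun=> 1)) low).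
Proof.
elim: k => [|k [IH Fk]]; first by split=> //; apply: filt_low.
have te := tr_e (K := K).
rewrite !iterS IH XTE big_ord1 scale1r; split; last exact: (filt_act 0 te Fk).
have -> : ce C 1 (symb M 0 (iter k (XT z 1 (fun=> 1)) low)) =
    fp_act M (@sl2_e K) 0 (symb M 0 (iter k (XT z 1 (fun=> 1)) low)).
  by rewrite fp_act_X.
by rewrite fp_actE.
Qed.

(** The vector e_0^N low / N! is supported at the highest tensor, where its coordinate is the
    inverse of prod (a_i - 1)!; hence the constant [c]. *)
Lemma u_highE : exists2 c, c != 0 & u_high M = c *: top C.
Proof.
pose c : K := \prod_i ((a i).-1)`!%:R.
have c0 : c != 0 by apply/prodf_neq0 => i _; apply: factr_neq0.
exists c => //; rewrite /top /weight_vec /dpow (ce1_symb N).1.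
have -> : (N`!%:R)^-1 *: symb M 0 (iter N (XT z 1 (fun=> 1)) low) =
    symb M 0 (dpow N (XT z 1 (fun=> 1)) low) by rewrite linearZ.
rewrite -linearZ; congr (symb M 0 _); apply/ffunP => J.
rewrite [RHS]ffunE dpow_XT ffunE.
case: (boolP [forall i, _]) => [/forallP H|].
  have JE i : (J i = (a i).-1 :> nat) by have /eqP := H i; lia.
  rewrite /size_index (eq_bigr (fun i => (a i).-1)) // eqxx mul1r /monval.
  rewrite (eq_bigr (fun i => ((a i).-1)`!%:R^-1)) => [|i _].
    by rewrite prodfV -/c /GRing.scale /= mulfV.
  by rewrite JE /pts big_ord1 mul1r expr0 expr1n mul1r.
rewrite negb_forall => /existsP[i Hi].
suff /ltn_eqF -> : (size_index J < N)%N by rewrite mul0r scaler0.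
rewrite /size_index [X in (X < _)%N](bigD1 i) //= [X in (_ < X)%N](bigD1 i) //= -addSn.
have Jle j : (J j <= (a j).-1)%N by have := ltn_ord (J j); lia.
apply: leq_add; last by apply: leq_sum => j _; apply: Jle.
by rewrite ltn_neqAle Jle andbT; apply: contra Hi => /eqP ->; rewrite prednK.
Qed.

End Orbits.

(** * The orbit of SL_2 and the map [pi_tilde] *)

Section ConstantOrbits.
Context {K : numFieldType} {n : nat} {a : 'I_n.+2 -> nat} {z : 'I_n.+2 -> K}.
Variable M : fusion_product a z.
Hypothesis a_gt0 : forall i, (0 < a i)%N.
Local Notation C := (fusion_current M a_gt0).
Local Notation E := (cell C).
Local Notation tp := (trunc_poly (K := K) n.+2).
Implicit Types (p q : nat -> K) (P Q : {poly K}).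

Definition cst (c : K) : tp := in_qpoly 'X^(n.+2) c%:P.

Lemma cst_zmod : zmod_morphism cst.
Proof. by move=> c d; rewrite /cst polyCB raddfB. Qed.
Lemma cst_monoid : monoid_morphism cst.
Proof. by split=> [|c d]; rewrite /cst ?polyC1 ?in_qpoly1 // polyCM in_qpolyM. Qed.
HB.instance Definition _ := GRing.isZmodMorphism.Build K tp cst cst_zmod.
HB.instance Definition _ := GRing.isMonoidMorphism.Build K tp cst cst_monoid.

Lemma exp_cst_e c m : exp_e (trunc_coef (cst c)) m = exp_nil (ce C c%:P) m.
Proof.
rewrite (exp_trunc_e (M := M) a_gt0); congr (exp_nil _ m); symmetry; apply: ce_mod.
exact: dvdp_in_qpoly.
Qed.

Lemma exp_cst_f c m : exp_f (trunc_coef (cst c)) m = exp_nil (cf C c%:P) m.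
Proof.
rewrite (exp_trunc_f (M := M) a_gt0); congr (exp_nil _ m); symmetry; apply: cf_mod.
exact: dvdp_in_qpoly.
Qed.

Lemma map_elementary c (i j : 'I_2) :
  map_mx cst (1%:M + c *: delta_mx i j) = 1%:M + cst c *: delta_mx i j.
Proof. by rewrite map_mxD map_mx1 map_mxZ map_delta_mx. Qed.

Lemma modX_solve P b d : d != 0 -> 'X^(n.+2) %| P * d%:P - b%:P ->
  'X^(n.+2) %| P - (b / d)%:P.
Proof.
move=> d0 H; have -> : P - (b / d)%:P = (d^-1)%:P * (P * d%:P - b%:P).
  rewrite mulrBr mulrCA -!polyCM mulVf // mulr1 [b * _]mulrC.
  by [].
by rewrite dvdp_mull.
Qed.

Lemma SL2_orbit_curve : SL2_orbit M = orbit_curve C.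
Proof.
apply: boolp.funext => L; apply: boolp.propext; split.
  move=> [g [T [_ /(SL2_act_orbit a_gt0) + ->]]]; rewrite !mxE.
  move=> /(@in_orbit_mod _ _ _ _ _ _ (g ord0 ord_max)%:P _ (g ord_max ord_max)%:P).
  have cstE c : 'X^(n.+2) %| (cst c : {poly K}) - c%:P.
    by rewrite -dvdpNr opprB; apply: dvdp_in_qpoly.
  move=> /(_ (cstE _) (cstE _)); set b := g _ _; set d := g _ _.
  case=> [[]|[]]; rewrite coefC /= => d0 [c [P [c0 /(modX_solve d0) HP ->]]].
    by left; exists (b / d); rewrite lineZ // (cell_mod C HP).
  have -> : cocell C P = cocell C (d / b)%:P by rewrite /cocell (cf_mod C HP).
  have [->|q0] := eqVneq (d / b) 0.
    by right; rewrite lineZ // /cocell linear0 exp_nil0.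
  left; exists (d / b)^-1; rewrite lineZ //.
  have H : 'X^(n.+2) %| ((d / b)^-1)%:P * (d / b)%:P - 1.
    by rewrite -polyCM mulVf // subrr dvdp0.
  rewrite (cell_cocell C H) lineZ // coefC /= expf_neq0 //.
  by rewrite invr_eq0.
case=> [[c ->]|->].
  exists ((1%:M + c *: delta_mx ord0 ord_max) *m 1%:M), (exp_e (trunc_coef (cst c)) \o id).
  split; first by rewrite mulmx1 det_elementary.
    rewrite -[map_mx _ _]/(map_mx cst _) map_mxM map_elementary map_mx1.
    exact/SL2_actE/SL2_act1.
  by rewrite /= exp_cst_e.
(* The point at infinity is reached by the Weyl element, written as three elementary matrices. *)
exists ((1%:M + 1 *: delta_mx ord0 ord_max) *m ((1%:M + (-1) *: delta_mx ord_max ord0) *m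
  ((1%:M + 1 *: delta_mx ord0 ord_max) *m 1%:M))),
  (exp_e (trunc_coef (cst 1)) \o (exp_f (trunc_coef (cst (-1))) \o
    (exp_e (trunc_coef (cst 1)) \o id))); split.
- by rewrite !det_mulmx !det_elementary // det1 !mulr1.
- rewrite -[map_mx _ _]/(map_mx cst _) !map_mxM !map_elementary map_mx1.
  exact/SL2_actE/SL2_actF/SL2_actE/SL2_act1.
by rewrite /= !exp_cst_e exp_cst_f polyCN polyC1 linearN -weylE weyl_v.
Qed.

(** Coefficient sequences become polynomials: the condition q_0 = 0 gives a multiple of X, and u_A
    spans the same line as [top C]. *)
Lemma pi_tilde_iff L1 L2 : pi_tilde M L1 L2 <->
  (exists P, L1 = <[E P]>%VS /\ L2 = <[E (P`_0)%:P]>%VS) \/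
  (exists Q, L1 = <[cocell C (Q * 'X)]>%VS /\ L2 = <[top C]>%VS).
Proof.
have [k k0 uE] := u_highE M a_gt0.
have fE c : c *: fp_act M (@sl2_e K) 0 = ce C c%:P.
  rewrite ce_const; congr (_ *: _); apply/lfunP => m.
  by rewrite fp_act_X.
have coefX0 (Q : {poly K}) : Q`_0 = 0 -> exists R, Q = R * 'X.
  by move/eqP; rewrite -dvdX_coef0 => /dvdpP.
split=> [[p|q q0]|[[P [-> ->]]|[Q [-> ->]]]].
- left; exists (\poly_(i < n.+2) p i).
  by rewrite (exp_eE (M := M) a_gt0) fE coef_poly.
- right; have [|R RE] := coefX0 (\poly_(i < n.+2) q i); first by rewrite coef_poly.
  by exists R; rewrite (exp_fE (M := M) a_gt0) uE exp_nilZ RE !(lineZ _ k0).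
- have := @pi_tilde_e _ _ _ _ M (fun i => P`_i).
  rewrite (exp_eE (M := M) a_gt0) fE.
  have -> : exp_nil (ce C (\poly_(i < n.+2) P`_i)) (v_low M) = E P.
    by rewrite -/(take_poly n.+2 P) (cell_trunc M a_gt0 P).
  by [].
have := @pi_tilde_f _ _ _ _ M (fun i => (Q * 'X)`_i).
rewrite (exp_fE (M := M) a_gt0) uE exp_nilZ !(lineZ _ k0) coefMX => /(_ erefl).
have -> : exp_nil (cf C (\poly_(i < n.+2) (Q * 'X)`_i)) (top C) = cocell C (Q * 'X).
  congr (exp_nil _ _); apply: cf_mod.
  rewrite -/(take_poly n.+2 (Q * 'X)) -dvdpNr opprB.
  by rewrite -{1}[Q * 'X](poly_take_drop n.+2) addrAC subrr add0r dvdp_mull.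
by [].
Qed.

End ConstantOrbits.

(** * Fibers of pi as closures of the fibers of [pi_tilde] *)

Lemma zclosure_cone (K : numFieldType) (V : vectType K) I (F : I -> V) (S : pset V) L :
  (forall L1, S L1 <-> exists i, L1 = <[F i]>%VS) -> zclosure S L <-> cone_set F L.
Proof.
move=> SF; split=> [H|[x [xn -> Fx]]]; last exact/(zclosure_incone xn SF).
have [x xn LE] := line_gen (zclosure_proj H); exists x; split=> //.
by apply/(zclosure_incone xn SF); rewrite -LE.
Qed.

Lemma row2_line_inj (K : numFieldType) (b c : K) :
  <[row2 1 b]>%VS = <[row2 1 c]>%VS -> b = c.
Proof.
have bn : row2 1 b != 0 by rewrite row2_eq0 oner_eq0.
move=> /(line_eq bn)[k _]; rewrite row2Z mulr1 => H.
have := congr1 (ycoord ord0) H; have := congr1 (ycoord ord_max) H.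
by rewrite !row2_0 !row2_1 => -> <-; rewrite mul1r.
Qed.

Lemma row2_line_neq (K : numFieldType) (c : K) :
  <[row2 0 1]>%VS <> <[row2 1 c]>%VS.
Proof.
have bn : row2 0 1 != 0 :> 'rV[K]_2 by rewrite row2_eq0 oner_eq0 andbF.
move=> /(line_eq bn)[k k0 /(congr1 (ycoord ord0))].
by rewrite row2Z !row2_0 mulr1 => /esym/eqP; rewrite (negPf k0).
Qed.

Theorem theorem1p1 (R : realType) (n : nat) (a : 'I_n -> nat)
    (z : 'I_n -> R[i]) (z' : 'I_n.-1 -> R[i])
    (M : fusion_product a z)
    (M' : fusion_product (fun i : 'I_n.-1 => a (widen_ord (leq_pred n) i)) z') :
  (2 <= n)%N ->
  (forall i, 0 < a i)%N ->
  (forall i j : 'I_n, i <= j -> j < n.-1 -> a i <= a j)%N ->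
  (forall i j : 'I_n, i.+1 = j -> j.+1 = n -> a i < a j)%N ->
  injective z -> injective z' ->
  exists (iota pi : {vspace M} -> {vspace 'rV[R[i]]_2}),
    [/\ isomorphism (SL2_orbit M) (@proj _ 'rV[R[i]]_2) iota,
        forall L L', pi_tilde M L L' -> pi L = iota L',
        locally_trivial_bundle (sh M) (@proj _ 'rV[R[i]]_2) (sh M') pi
      & forall x : {vspace 'rV[R[i]]_2}, proj x -> forall L : {vspace M},
          (sh M L /\ pi L = x) <->
          (sh M L /\
           zclosure (fun L1 => exists2 L2, pi_tilde M L1 L2 & iota L2 = x) L)].
Proof.
case: n a z z' M M' => [|[|n]] a z z' M M' // _ a_gt0 a_mono a_last zI z'I.
have a_max i : i != ord_max -> (a i < a ord_max)%N.
  move=> iM; have il : (i <= n)%N.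
    by move: iM; rewrite -val_eqE /= neq_ltn => /orP[|]; have := ltn_ord i; lia.
  pose j : 'I_n.+2 := inord n; have jE : j = n :> nat by rewrite inordK.
  apply: (@leq_ltn_trans (a j)); first by apply: a_mono; rewrite jE.
  by apply: a_last; rewrite ?jE.
(* A fusion product for A^-, at the same points as for A, is the target of al0 and al1. *)
have [Mm] := fusion_product_exists (amin (a := a)) z.
have [al0 [al1 [al0E al1E al_inj]]] := split_maps M zI a_gt0 a_max Mm.
have [theta thetaE theta_ker] := restrict_map M M' zI z'I a_gt0 a_max.
set a'_gt0 := a'_gt0 a_gt0 in thetaE.
set C := fusion_current M a_gt0 in al0E al1E thetaE.
set C' := fusion_current M' a'_gt0 in thetaE.
have v0 : cv C != 0 := low_neq0 M a_gt0.
have [pi piP] := pi_exists al_inj.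
(* The orbit of SL_2 is identified with the projective line by pi itself. *)
exists pi, pi; split.
- rewrite (SL2_orbit_curve M a_gt0).
  exact: (isomorphism_orbit al0E al1E al_inj piP v0).
- move=> L L' /(pi_tilde_iff a_gt0)[[P [-> ->]]|[Q [-> ->]]].
    by rewrite !(pi_cell al0E al1E piP v0) coefC.
  rewrite (pi_cocell al0E al1E al_inj piP v0) -(cocell0 C).
  by rewrite (pi_cocell al0E al1E al_inj piP v0).
- rewrite (sh_cone M a_gt0) (sh_cone M' a'_gt0).
  exact: (bundle_trivial al0E al1E al_inj thetaE theta_ker piP).
move=> Y Yp L; rewrite (sh_cone M a_gt0); have [y yn ->] := line_gen Yp.
(* It is enough to exhibit one family whose lines form the fiber of [pi_tilde] and whose closure is
   the fiber of pi. *)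
have closureE I (F : I -> M) (Z : {vspace 'rV[R[i]]_2}) :
    ((cone_set (cell C) L /\ pi L = Z) <-> cone_set F L) ->
    (forall L1, (exists2 L2, pi_tilde M L1 L2 & pi L2 = Z) <->
      exists i, L1 = <[F i]>%VS) ->
    (cone_set (cell C) L /\ pi L = Z) <-> (cone_set (cell C) L /\
      zclosure (fun L1 => exists2 L2, pi_tilde M L1 L2 & pi L2 = Z) L).
  move=> fibF SF; rewrite (zclosure_cone _ SF) fibF.
  by split=> [H|[]//]; split=> //; case/fibF: H.
have pi_top : pi <[top C]>%VS = <[row2 0 1]>%VS.
  by rewrite -(cocell0 C) (pi_cocell al0E al1E al_inj piP v0).
have [s0|s0] := eqVneq (ycoord ord0 y) 0.
  have -> : <[y]>%VS = <[row2 0 1]>%VS.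
    have t0 : ycoord ord_max y != 0.
      by apply: contraNneq yn => t0; rewrite [y]row2_eta s0 t0 row2_eq0 eqxx.
    by rewrite -(lineZ (row2 0 1) t0) row2Z mulr0 mulr1 {1}[y]row2_eta s0.
  apply: closureE (fiber_infinite al0E al1E al_inj piP v0 L) _ => L1.
  split=> [[L2 /(pi_tilde_iff a_gt0)[[P [_ ->]]|[Q [-> _]] _]]|[Q ->]].
  - by rewrite (pi_cell al0E al1E piP v0) => /esym/row2_line_neq.
  - by exists Q.
  - exists <[top C]>%VS; last exact: pi_top.
    by apply/(pi_tilde_iff a_gt0); right; exists Q.
have -> : <[y]>%VS = <[row2 1 (ratio y)]>%VS by rewrite [y in LHS]ratio_row2 // lineZ.
apply: closureE (fiber_finite al0E al1E al_inj piP (ratio y) L) _ => L1.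
split=> [[L2 /(pi_tilde_iff a_gt0)[[P [-> ->]]|[Q [_ ->]]]]|[Q ->]].
- rewrite (pi_cell al0E al1E piP v0) coefC /= => /row2_line_inj P0.
  have /dvdpP[Q QE] : 'X %| P - (ratio y)%:P by rewrite dvdX_coef0 coefB coefC P0 subrr.
  by exists Q; rewrite -QE subrK.
- by rewrite pi_top => /row2_line_neq.
- have P0 : (Q * 'X + (ratio y)%:P)`_0 = ratio y by rewrite coefD coefMX coefC add0r.
  exists <[cell C (ratio y)%:P]>%VS; last by rewrite (pi_cell al0E al1E piP v0) coefC.
  by apply/(pi_tilde_iff a_gt0); left; exists (Q * 'X + (ratio y)%:P); rewrite P0.
Qed.
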